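(* Let $H$ be a real separable Hilbert space and $0<\alpha<1$. Let $Y$ be a cadlag $H$-valued Lévy process with $\mathcal{L}(Y(1))\in ID_\alpha$, let $I^{(\rho_\alpha)}:=\int_0^\infty t\,dY(\Gamma(-\alpha,t))$, and let $\phi_{I^{(\rho_\alpha)}}(y)$ and $\phi_{Y(1)}(y)$, $y\in H$, be the characteristic functions of $I^{(\rho_\alpha)}$ and $Y(1)$, respectively. Then for all $y\in H$ $$\log\phi_{I^{(\rho_\alpha)}}(y)=\int_0^\infty\log\phi_{Y(1)}(ty)\,t^{-\alpha-1}e^{-t}\,dt,\qquad \log\phi_{Y(1)}(y)=\mathfrak{L}^{-1}\big[s^{\alpha}\log\phi_{I^{(\rho_\alpha)}}(s^{-1}y);\,x\big]\big|_{x=1}.$$ Hence the mapping $\mathcal{K}^{(\rho_\alpha)}:ID_\alpha\to\mathcal{TS}_\alpha$ is an algebraic isomorphism between convolution semigroups, and for its inverse we have $$\big((\mathcal{K}^{(\rho_\alpha)})^{-1}(\nu)\big)^{\wedge}(y)=\exp\mathfrak{L}^{-1}\big[s^{\alpha}\log\hat\nu(s^{-1}y);\,x\big]\big|_{x=1},\qquad y\in H,\ \nu\in\mathcal{TS}_\alpha .$$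
   Context: Infinitely divisible laws on $H$: $\mu=[a,R,M]$ means $\hat\mu(y)=\exp[i\langle y,a\rangle-\frac12\langle Ry,y\rangle+\int_{H\setminus\{0\}}(e^{i\langle y,x\rangle}-1-i\langle y,x\rangle1_{\{\|x\|\le1\}}(x))M(dx)]$, with $a\in H$, $R$ a Gaussian covariance operator, $M$ a Lévy spectral measure, i.e. a Borel measure on $H\setminus\{0\}$ with $\int\min(1,\|x\|^2)M(dx)<\infty$. $ID_\alpha$ is the set of infinitely divisible $\mu=[a,R,M]$ on $H$ with $\int_{H\setminus\{0\}}\|x\|^\alpha M(dx)<\infty$. The hat (or superscript $\wedge$) denotes the characteristic function, $\mathcal{L}$ (applied to a random element) the law, and $\log$ of the characteristic function of an infinitely divisible law is its Lévy exponent (the bracket above). Let $\rho_\alpha(dt)=t^{-\alpha-1}e^{-t}dt$ on $(0,\infty)$ and $\Gamma(-\alpha,t)=\int_t^\infty u^{-\alpha-1}e^{-u}du=\rho_\alpha((t,\infty))$. For a Lévy process $Y$ with $\mathcal{L}(Y(1))\in ID_\alpha$, the random integral $\int_{(p,q]}t\,dY(\Gamma(-\alpha,t))$, $0<p<q<\infty$, has (in this paper's convention) the law with characteristic function $\exp\int_{(p,q]}\log\phi_{Y(1)}(ty)\,\rho_\alpha(dt)$, and $\int_0^\infty t\,dY(\Gamma(-\alpha,t))$ is the limit in distribution as $p\downarrow0$, $q\uparrow\infty$, which exists. The random integral mapping is $\mathcal{K}^{(\rho_\alpha)}(\mu):=\mathcal{L}(\int_0^\infty t\,dY_\mu(\Gamma(-\alpha,t)))$,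 $\mu\in ID_\alpha$, where $Y_\mu$ is a cadlag Lévy process with $\mathcal{L}(Y_\mu(1))=\mu$; and $\mathcal{TS}_\alpha:=\mathcal{K}^{(\rho_\alpha)}(ID_\alpha)$. The semigroup operation is convolution of measures. $\mathfrak{L}^{-1}[F(s);x]$ denotes the value at $x>0$ of the inverse Laplace transform of $F$, i.e. of the unique continuous function $f$ on $(0,\infty)$ with $\int_0^\infty e^{-sx}f(x)dx=F(s)$ for $s>0$; here it is taken in $s$ for each fixed $y$. *)

(* Defs.v *)
From HB Require Import structures.
From mathcomp Require Import all_boot all_order all_algebra.
From mathcomp Require Import all_classical all_reals all_analysis.
From mathcomp Require Import ring lra complex giry.

Set Implicit Arguments.
Unset Strict Implicit.
Unset Printing Implicit Defensive.

Import Order.TTheory GRing.Theory Num.Theory.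
Import numFieldNormedType.Exports.

Local Open Scope classical_set_scope.
Local Open Scope ring_scope.
Local Open Scope complex_scope.

HB.mixin Record CompleteNormedModule_isSeparableHilbert (R : realType) H
    of CompleteNormedModule R H := {
  inner : {dot H for (@idfun R)} ;
  inner_norm : forall x : H, inner x x = `|x| ^+ 2 ;
  hilbert_separable : exists2 D : set H, countable D & dense D
}.

#[short(type="separableHilbertType")]
HB.structure Definition SeparableHilbert (R : realType) :=
  {H of CompleteNormedModule R H & CompleteNormedModule_isSeparableHilbert R H}.

Notation "⟨ x , y ⟩" := (inner x y)
  (at level 0, x at level 99, y at level 99, format "⟨ x ,  y ⟩") : ring_scope.

(* A measure on this type is a function on all subsets, of which only the values
   on Borel sets are meaningful; so laws are compared with the relation [≡μ] of
   the library (agreement on measurable sets), not with Leibniz equality. *)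
Definition borel (T : ptopologicalType) := g_sigma_algebraType (@open T).

Section complex_integral.
Context {R : realType}.

Definition cexp (z : R[i]) : R[i] :=
  (expR (complex.Re z))%:C *
  (cos (complex.Im z) +i* sin (complex.Im z)).

Context d (T : measurableType d) (mu : {measure set T -> \bar R}).

Definition cintegrable (D : set T) (f : T -> R[i]) : Prop :=
  mu.-integrable D (EFin \o (fun x => complex.Re (f x))) /\
  mu.-integrable D (EFin \o (fun x => complex.Im (f x))).

Definition cintegral (D : set T) (f : T -> R[i]) : R[i] :=
  (\int[mu]_(x in D) complex.Re (f x)) +i* (\int[mu]_(x in D) complex.Im (f x)).

End complex_integral.

Section inverse_laplace.
Context {R : realType}.

Definition is_inverse_laplace (F f : R -> R[i]) : Prop :=
  [/\ {in `]0, +oo[, continuous (fun x => complex.Re (f x))},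
      {in `]0, +oo[, continuous (fun x => complex.Im (f x))} &
      forall s : R, 0 < s ->
        let g x := (expR (- s * x))%:C * f x in
        cintegrable lebesgue_measure `]0, +oo[ g /\
        cintegral lebesgue_measure `]0, +oo[ g = F s].

(* Such an f is unique on ]0, +oo[, so only values at x > 0 are meaningful. *)
Definition inverse_laplace (F : R -> R[i]) : R -> R[i] :=
  xget (fun=> 0) [set f | is_inverse_laplace F f].

End inverse_laplace.

Section convolution.
Context {R : realType} {H : separableHilbertType R}.
Local Notation law := (probability (borel H) R).

Definition addH (z : borel H * borel H) : borel H := (z.1 : H) + (z.2 : H).

Lemma measurable_addH : measurable_fun [set: borel H * borel H] addH.
Proof.
have [D cD dD] := @hilbert_separable R H.
have mball (c : H) (r : R) : measurable (ball c r : set (borel H)).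
  by apply: sub_sigma_algebra; exact: ball_open.
apply: (@measurability _ _ _ (borel H) _ _ (@open H) erefl) => _ [U oU <-].
rewrite setTI.
pose box (z : H * H * nat) : set (borel H * borel H) :=
  ball z.1.1 (z.2.+1%:R^-1 : R) `*` ball z.1.2 (z.2.+1%:R^-1 : R).
pose I := [set z : H * H * nat |
  [/\ D z.1.1, D z.1.2 & box z `<=` addH @^-1` U]].
have cI : countable I.
  apply: (@sub_countable _ _ _ ((D `*` D) `*` [set: nat])).
    by apply: subset_card_le => -[[x y] n] [].
  by apply: countableX; [exact: countableX|exact: countableP].
have -> : addH @^-1` U = \bigcup_(z in I) box z.
  apply/seteqP; split=> [[x y] /= Uxy|z [i [_ _ iU] iz]]; last exact: iU.
  have /nbhs_ballP[e /= e0 eU] : nbhs ((x : H) + (y : H)) U.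
    exact: open_nbhs_nbhs.
  have [n ne] : exists n : nat, n.+1%:R^-1 < e / 4.
    exists (Num.truncn (e / 4)^-1); rewrite invf_plt ?posrE ?divr_gt0//.
    exact: truncnS_gt.
  have n0 : 0 < (n.+1%:R^-1 : R) by rewrite invr_gt0.
  have near_D (c : H) : exists2 d, D d & ball d (n.+1%:R^-1 : R) c.
    have [|d [dc Dd]] := dD (ball c (n.+1%:R^-1 : R)) _ (ball_open _ _).
      by exists c; exact: ballxx.
    by exists d => //; exact: ball_sym.
  have [dx Ddx dxx] := near_D x; have [dy Ddy dyy] := near_D y.
  exists (dx, dy, n) => //; split=> //= -[u v] [/= dxu dyv].
  apply: eU; rewrite -ball_normE /= opprD addrACA.
  have sub (c p q : H) : ball c (n.+1%:R^-1 : R) p ->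
      ball c (n.+1%:R^-1 : R) q -> `|p - q| < e / 2.
    move=> /ball_sym cp cq; have := ball_triangle cp cq.
    rewrite -ball_normE /= => /lt_trans; apply.
    by rewrite [ltRHS](_ : _ = e / 4 + e / 4) ?ltrD//; field.
  rewrite (splitr e); apply: le_lt_trans (ler_normD _ _) _.
  by apply: ltrD; [exact: sub dxx dxu|exact: sub dyy dyv].
have /countable_injP[f finj0] := cI.
have finj z z' : I z -> I z' -> f z = f z' -> z = z'.
  by move=> Iz Iz'; apply: finj0; rewrite inE.
have -> : \bigcup_(z in I) box z =
    \bigcup_n \bigcup_(z in [set z | I z /\ f z = n]) box z.
  apply/seteqP; split=> [p [z Iz pz]|p [n _ [z [Iz _] pz]]].
    by exists (f z) => //; exists z.
  by exists z.
apply: bigcupT_measurable => n.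
have [[z [Iz fz]]|noz] := pselect (exists z, I z /\ f z = n); last first.
  rewrite bigcup0 // => z Iz; case: noz; by exists z.
have -> : \bigcup_(z in [set z | I z /\ f z = n]) box z = box z.
  apply/seteqP; split=> [p [z' [Iz' fz'] pz']|p pz]; last by exists z.
  by rewrite (finj z z') // fz fz'.
by apply: measurableX; exact: mball.
Qed.

HB.instance Definition _ :=
  isMeasurableFun.Build _ _ _ _ addH measurable_addH.

Definition conv (mu nu : law) : law := distribution (mu \x nu)%E addH.

End convolution.

Section infinitely_divisible.
Context {R : realType} {H : separableHilbertType R}.
Local Notation law := (probability (borel H) R).
Implicit Types (mu nu : law) (a y : H) (S : H -> H)
  (M : {measure set (borel H) -> \bar R}).

Definition char_fun mu y : R[i] :=
  cintegral mu setT (fun x => cexp (0 +i* ⟨y, x⟩)).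

(* [iter n (conv nu) nu] is the convolution of n.+1 copies of [nu]. *)
Definition infinitely_divisible mu : Prop :=
  forall n : nat, exists nu, mu ≡μ iter n (conv nu) nu.

(* [S] is the covariance operator of a centred Gaussian law on [H]. *)
Definition gaussian_covariance S : Prop :=
  exists gamma : law,
    (forall y, char_fun gamma y = (expR (- (⟨S y, y⟩ / 2)))%:C) /\
    (forall y z, ⟨S y, z⟩ = \int[gamma]_x (⟨y, x⟩ * ⟨z, x⟩)).

(* Measures on H \ {0} are encoded as measures on H which do not charge 0. *)
Definition levy_measure M : Prop :=
  M [set 0%R : H] = 0%E /\
  (\int[M]_(x in ~` [set 0%R : H]) (Num.min 1 (`|x : H| ^+ 2))%:E < +oo)%E.

Definition levy_khintchine a S M y : R[i] :=
  (0 +i* ⟨y, a⟩) - (⟨S y, y⟩ / 2)%:C +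
  cintegral M (~` [set 0%R : H]) (fun x =>
    cexp (0 +i* ⟨y, x⟩) - 1 -
    (0 +i* (⟨y, x⟩ * \1_[set x : H | `|x| <= 1] x))).

(* [mu = [a, S, M]] *)
Definition has_triplet mu a S M : Prop :=
  [/\ gaussian_covariance S, levy_measure M &
      forall y, char_fun mu y = cexp (levy_khintchine a S M y)].

(* The Lévy exponent of [mu]: it is uniquely determined when [mu] has a
   triplet, and has the junk value 0 otherwise. *)
Definition log_char_fun mu : H -> R[i] :=
  xget (fun=> 0) [set psi | exists a S M,
    has_triplet mu a S M /\ psi = levy_khintchine a S M].

Definition ID (alpha : R) : set law :=
  [set mu | infinitely_divisible mu /\ exists a S M,
    has_triplet mu a S M /\
    (\int[M]_(x in ~` [set 0%R : H]) (`|x : H| `^ alpha)%:E < +oo)%E].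

End infinitely_divisible.

Section random_integral.
Context {R : realType} {H : separableHilbertType R}.
Local Notation law := (probability (borel H) R).

Definition increment d (Omega : measurableType d) (P : probability Omega R)
    (Y : R -> {RV P >-> borel H}) (s t : R) (w : Omega) : borel H :=
  (Y t w : H) - (Y s w : H).

(* Paths are only considered at times t >= 0. *)
Record levy_process d (Omega : measurableType d) (P : probability Omega R)
    (Y : R -> {RV P >-> borel H}) : Prop := {
  levy_process0 : {ae P, forall w, Y 0 w = 0 :> H} ;
  levy_process_indep : forall (n : nat) (t : nat -> R)
      (B : nat -> set (borel H)),
    0 <= t 0%N -> {homo t : i j / (i <= j)%N >-> i <= j} ->
    (forall i, measurable (B i)) ->
    P (\bigcap_(i < n) (increment Y (t i) (t i.+1) @^-1` B i)) =
    (\prod_(i < n) P (increment Y (t i) (t i.+1) @^-1` B i))%E ;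
  levy_process_stationary : forall (s t : R) (B : set (borel H)),
    0 <= s -> 0 <= t -> measurable B ->
    P (increment Y s (s + t) @^-1` B) = P (Y t @^-1` B) ;
  levy_process_cadlag : {ae P, forall w, forall t, 0 <= t ->
    ((Y u w : H) @[u --> t^'+] --> (Y t w : H)) /\
    (0 < t -> cvg ((Y u w : H) @[u --> t^'-]))}
}.

Definition cvg_in_distribution (nu_ : R -> R -> law) (nu : law) : Prop :=
  forall f : H -> R, continuous f -> [bounded f x | x in [set: H]] ->
    (\int[nu_ z.1 z.2]_x f x) @[z --> (0^'+, +oo)] --> \int[nu]_x f x.

(* density of the measure rho_alpha on ]0, +oo[ *)
Definition rho (alpha t : R) : R := t `^ (- alpha - 1) * expR (- t).

(* [nu_ p q] is the law of the integral of t over ]p, q] with respect to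
   Y(Gamma(-alpha, t)). *)
Definition law_random_integral (alpha : R) d (Omega : measurableType d)
    (P : probability Omega R) (Y : R -> {RV P >-> borel H}) (nu : law) : Prop :=
  exists nu_ : R -> R -> law,
    (forall p q : R, 0 < p -> p < q -> forall y : H,
      char_fun (nu_ p q) y =
      cexp (cintegral lebesgue_measure `]p, q] (fun t =>
        (rho alpha t)%:C * log_char_fun (distribution P (Y 1)) (t *: y)))) /\
    cvg_in_distribution nu_ nu.

(* The graph of K^(rho_alpha), modulo equality of laws. *)
Definition random_integral_mapping (alpha : R) (mu nu : law) : Prop :=
  exists d (Omega : measurableType d) (P : probability Omega R)
    (Y : R -> {RV P >-> borel H}),
    [/\ levy_process Y, distribution P (Y 1) ≡μ mu &
        law_random_integral alpha Y nu].

Definition TS (alpha : R) : set law :=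
  [set nu | exists2 mu, ID alpha mu & random_integral_mapping alpha mu nu].

Definition conv_closed (D : set law) : Prop :=
  forall mu nu, D mu -> D nu -> D (conv mu nu).

(* Laws being taken modulo [≡μ], [K] and [K'] are mutually inverse isomorphisms
   between the convolution semigroups [D] and [E]. *)
Record conv_isomorphism (D E : set law) (K K' : law -> law) : Prop := {
  iso_closed_dom : conv_closed D ;
  iso_closed_cod : conv_closed E ;
  iso_maps : forall mu, D mu -> E (K mu) ;
  iso_inv_maps : forall nu, E nu -> D (K' nu) ;
  iso_compat : forall mu1 mu2, D mu1 -> D mu2 ->
    mu1 ≡μ mu2 -> K mu1 ≡μ K mu2 ;
  iso_inv_compat : forall nu1 nu2, E nu1 -> E nu2 ->
    nu1 ≡μ nu2 -> K' nu1 ≡μ K' nu2 ;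
  isoK : forall mu, D mu -> K' (K mu) ≡μ mu ;
  iso_invK : forall nu, E nu -> K (K' nu) ≡μ nu ;
  iso_conv : forall mu1 mu2, D mu1 -> D mu2 ->
    K (conv mu1 mu2) ≡μ conv (K mu1) (K mu2)
}.

End random_integral.

(* Main.v *)
Require Import Defs.
From HB Require Import structures.
From mathcomp Require Import all_boot all_order all_algebra.
From mathcomp Require Import all_classical all_reals all_analysis.
From mathcomp Require Import measurable_realfun ring lra complex giry.

Set Implicit Arguments.
Unset Strict Implicit.
Unset Printing Implicit Defensive.

Import Order.TTheory GRing.Theory Num.Theory.
Import numFieldNormedType.Exports.

Local Open Scope classical_set_scope.
Local Open Scope ring_scope.
Local Open Scope complex_scope.

(* The exponent of the random integral is the mixture of the exponents
   psi(t y) of Y(1) by rho_alpha(dt). For 0 < alpha < 1 the moment condition makes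
   the jumps summable, so this mixture is again a Lévy exponent: its Gaussian
   part is scaled by a constant, its Lévy measure is the image of
   rho_alpha (x) M under (t, x) |-> t x, and the compensators only change the
   drift. Substituting t = s x in the mixture at y / s gives
     s^alpha log phi_I(y / s) = int_0^oo e^(-s x) psi(x y) x^(-alpha-1) dx,
   a Laplace transform; as inverse Laplace transforms are unique, its value at
   x = 1 returns psi(y). The assertions on the mapping follow because the exponent
   of a law is determined by its characteristic function (it is continuous along
   rays and vanishes at 0), which in turn determines the law. *)

(** * Hilbert spaces and their Borel sets *)

(** The mixture has to be exhibited as the exponent of a triplet: [log_char_fun] selects among
    exponents of triplets and is 0 when there is none, so an exponential formula for the
    characteristic function of the integral does not by itself give its logarithm. Two parts of the
    triplet cost work. A Gaussian covariance is defined by the second moments of an actual law, so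
    every closure property needs a law as witness and moments recovered from its characteristic
    function. The new Lévy measure rests on one estimate: the integral of min(1, t c) against
    rho_alpha(dt) is at most a constant times c^alpha, so the moment of order alpha makes min(1, t
    |x|) integrable for rho_alpha (x) M. Both uniqueness theorems use polynomial kernels. On H,
    which carries no Lebesgue measure to invert a Fourier transform against, trigonometric
    polynomials approximate indicators of half-spaces; for Laplace transforms, powers of a quadratic
    in e^(-x) concentrate at a point. *)

Section inner_product.
Context {R : realType} {H : separableHilbertType R}.
Implicit Types x y z : H.

Lemma innerC x y : ⟨x, y⟩ = ⟨y, x⟩.
Proof. by rewrite hermC /= expr0 mul1r. Qed.

Lemma innerDl x y z : ⟨x + y, z⟩ = ⟨x, z⟩ + ⟨y, z⟩.
Proof. by rewrite linearDl. Qed.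

Lemma innerDr x y z : ⟨z, x + y⟩ = ⟨z, x⟩ + ⟨z, y⟩.
Proof. by rewrite linearDr. Qed.

Lemma innerZl a y z : ⟨a *: y, z⟩ = a * ⟨y, z⟩.
Proof. by rewrite linearZl. Qed.

Lemma innerZr a y z : ⟨y, a *: z⟩ = a * ⟨y, z⟩.
Proof. by rewrite linearZr. Qed.

Lemma inner0l z : ⟨0, z⟩ = 0.
Proof. by rewrite -(scale0r 0) innerZl mul0r. Qed.

Lemma inner0r z : ⟨z, 0⟩ = 0.
Proof. by rewrite innerC inner0l. Qed.

Lemma innerNl y z : ⟨- y, z⟩ = - ⟨y, z⟩.
Proof. by rewrite -scaleN1r innerZl mulN1r. Qed.

Lemma innerNr y z : ⟨y, - z⟩ = - ⟨y, z⟩.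
Proof. by rewrite innerC innerNl innerC. Qed.

Lemma innerBl x y z : ⟨x - y, z⟩ = ⟨x, z⟩ - ⟨y, z⟩.
Proof. by rewrite innerDl innerNl. Qed.

Lemma innerBr x y z : ⟨z, x - y⟩ = ⟨z, x⟩ - ⟨z, y⟩.
Proof. by rewrite innerDr innerNr. Qed.

Lemma normD_sqr x y : `|x + y| ^+ 2 = `|x| ^+ 2 + 2 * ⟨x, y⟩ + `|y| ^+ 2.
Proof. by rewrite -!inner_norm innerDl !innerDr (innerC y x); ring. Qed.

(** The squared norm of |y| x - |x| y expands to 2 |x| |y| (|x| |y| - <x, y>). *)
Lemma inner_le x y : ⟨x, y⟩ <= `|x| * `|y|.
Proof.
have [->|x0] := eqVneq x 0; first by rewrite inner0l normr0 mul0r.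
have [->|y0] := eqVneq y 0; first by rewrite inner0r normr0 mulr0.
have xp : 0 < `|x| by rewrite normr_gt0.
have yp : 0 < `|y| by rewrite normr_gt0.
have : 0 <= `| `|y| *: x + (- `|x|) *: y| ^+ 2 by rewrite sqr_ge0.
rewrite normD_sqr !normrZ innerZl innerZr normrN !normr_id => h.
have : 0 <= 2 * (`|x| * `|y|) * (`|x| * `|y| - ⟨x, y⟩) by lra.
by rewrite pmulr_rge0 ?subr_ge0// !mulr_gt0.
Qed.

Lemma cauchy_schwarz x y : `|⟨x, y⟩| <= `|x| * `|y|.
Proof.
rewrite ler_norml inner_le andbT lerNl -innerNl.
by rewrite (le_trans (inner_le _ _))// normrN.
Qed.

Lemma continuous_inner y : continuous (fun x => ⟨y, x⟩).
Proof.
move=> x; apply/(@cvgrPdist_le _ R^o) => e e0.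
have d0 : 0 < e / (`|y| + 1) by rewrite divr_gt0// ltr_pwDr.
near=> z.
rewrite -innerBr (le_trans (cauchy_schwarz _ _))//.
have : `|x - z| <= e / (`|y| + 1).
  by near: z; apply: cvgr_dist_le => //; exact: cvg_id.
rewrite ler_pdivlMr ?ltr_pwDr// => h.
rewrite (le_trans _ h)// mulrC ler_wpM2l// lerDl//.
Unshelve. all: by end_near. Qed.

(* The representing vector minimises |y|^2 - 2 l(y); minimising sequences are
   Cauchy by the parallelogram identity. *)
Lemma riesz (l : H -> R) (C : R) :
  (forall x y, l (x + y) = l x + l y) -> (forall a x, l (a *: x) = a * l x) ->
  (forall y, `|l y| <= C * `|y|) -> exists b, forall y, ⟨y, b⟩ = l y.
Proof.
move=> lD lZ lC.
pose J y : R := `|y| ^+ 2 - 2 * l y.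
have JC y : - C ^+ 2 <= J y.
  have := lC y; rewrite ler_norml => /andP[_ ly].
  by have := sqr_ge0 (`|y| - C); rewrite /J sqrrB mulr2n; lra.
pose A := [set J y | y in [set: H]].
have A0 : A !=set0 by exists (J 0), 0.
have hA : has_inf A by split=> //; exists (- C ^+ 2) => _ [y _ <-].
have infJ y : inf A <= J y by apply: ge_inf; [case: hA|exists y].
have hu n : exists y, J y <= inf A + n.+1%:R^-1.
  have n0 : (0 : R) < n.+1%:R^-1 by [].
  have [_ [y _ <-] yJ] := inf_adherent n0 hA.
  by exists y; exact: ltW.
have [u uJ] := choice hu.
have par x y : `|x - y| ^+ 2 = 2 * J x + 2 * J y - 4 * J (2^-1 *: (x + y)).
  rewrite /J lZ lD normrZ exprMn !normD_sqr innerNr normrN.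
  by rewrite (ger0_norm (_ : 0 <= 2^-1)) ?invr_ge0//; field.
have nA (e : R) : 0 < e -> \forall n \near \oo, n.+1%:R^-1 < e.
  move=> e0; near=> n; rewrite invf_plt ?posrE//.
  rewrite (lt_le_trans (truncnS_gt _))// ler_nat.
  by near: n; exact: nbhs_infty_ge.
have uc : cauchy (u @ \oo).
  apply: cauchy_exP => e e0.
  have e2 : 0 < e ^+ 2 / 4 by rewrite divr_gt0// exprn_gt0.
  have [N _ Ne] := nA _ e2.
  exists (u N); exists N => // n /= Nn; rewrite -ball_normE /=.
  suff : `|u N - u n| ^+ 2 < e ^+ 2.
    by rewrite ltr_pXn2r ?nnegrE ?normr_ge0 ?(ltW e0).
  rewrite par; have h1 := uJ N; have h2 := uJ n.
  have /= h3 := Ne _ Nn; have /= h4 := Ne N (leqnn N).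
  have h5 := infJ (2^-1 *: (u N + u n)).
  move: (inf A) (J _) (J _) (J _) (n.+1%:R^-1) (N.+1%:R^-1) h1 h2 h3 h4 h5 => *; lra.
have ucv : cvg (u @ \oo) by exact: cauchy_cvg uc.
exists (lim (u @ \oo)) => y; set b := lim _.
have uyb : ⟨y, u n⟩ @[n --> \oo] --> ⟨y, b⟩.
  by apply: cvg_comp ucv _; exact: continuous_inner.
(* First variation at the minimiser: J (u n) is within 1/(n+1) of the infimum, hence exceeds J (u n
   + t y) by at most that much, and the limit removes the error. *)
have key t : 0 <= 2 * t * (⟨y, b⟩ - l y) + t ^+ 2 * `|y| ^+ 2.
  have h : (n.+1%:R^-1 + (2 * t * (⟨y, u n⟩ - l y) + t ^+ 2 * `|y| ^+ 2))
      @[n --> \oo] --> (0 + (2 * t * (⟨y, b⟩ - l y) + t ^+ 2 * `|y| ^+ 2)).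
    apply: cvgD; first exact: cvg_harmonic.
    by apply: cvgD; [apply: cvgMr; apply: cvgB => //; exact: cvg_cst|exact: cvg_cst].
  rewrite -[leRHS]add0r; apply: (cvgr_to_ge h); apply: nearW => n.
  have := uJ n; have := infJ (u n + t *: y).
  rewrite /J normD_sqr lD lZ innerZr normrZ exprMn real_normK ?num_real// (innerC y).
  move: (inf A) (`|u n| ^+ 2) (`|y| ^+ 2) (l _) (l _) (⟨_, _⟩) (n.+1%:R^-1) => *.
  lra.
(* Nearly the minimiser of this quadratic in t; the added 1 also covers y = 0. The value is a
   nonpositive multiple of d^2, which forces d = 0. *)
have := key (- (⟨y, b⟩ - l y) / (`|y| ^+ 2 + 1)).
set d := ⟨y, b⟩ - l y; set N := `|y| ^+ 2 => h.
have N0 : 0 <= N by rewrite sqr_ge0.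
have : 0 <= - (d ^+ 2 * (N + 2) / (N + 1) ^+ 2).
  apply: (le_trans h); rewrite le_eqVlt; apply/orP; left; apply/eqP.
  by field; rewrite gt_eqF// ltr_pwDr.
rewrite oppr_ge0 pmulr_lle0 ?invr_gt0 ?exprn_gt0 ?ltr_pwDr// pmulr_lle0 ?ltr_pwDr// => d0.
apply/eqP; rewrite -subr_eq0 -/d -sqrf_eq0 eq_le d0 sqr_ge0//.
Unshelve. all: by end_near. Qed.

Lemma dense_sequence : exists e : nat -> H,
  forall x (r : R), 0 < r -> exists n, `|e n - x| < r.
Proof.
have [D /countable_injP[f finj] dD] := @hilbert_separable R H.
(* Indices that [f] does not attain on [D] carry the default 0. *)
exists (fun n => xget 0 [set x | D x /\ f x = n]) => x r r0.
have [|d [xd Dd]] := dD (ball x r) _ (ball_open _ _).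
  by exists x; exact: ballxx.
exists (f d); case: xgetP => [z _ [Dz fz]|/(_ d)[]//].
have -> : z = d by apply: finj; rewrite ?inE.
by rewrite distrC; move: xd; rewrite -ball_normE.
Qed.

End inner_product.

Section borel_hilbert.
Context {R : realType} {H : separableHilbertType R}.

Lemma continuous_borel_measurable (f : H -> R) : continuous f ->
  measurable_fun [set: borel H] (f : borel H -> R).
Proof.
move=> cf; apply: (measurability _ (RGenOpens.measurableE R)) => _ [U [a [b ->]] <-].
rewrite setTI; apply: sub_sigma_algebra.
move/continuousP : cf; apply; exact: interval_open.
Qed.

Lemma measurable_inner (y : H) :
  measurable_fun [set: borel H] (fun x : borel H => ⟨y, x⟩).
Proof. by apply: continuous_borel_measurable; exact: continuous_inner. Qed.

Lemma measurable_norm : measurable_fun [set: borel H] (fun x : borel H => `|x : H|).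
Proof. by apply: continuous_borel_measurable; exact: norm_continuous. Qed.

Definition half_space (p : H * R) : set (borel H) := [set x | p.2 < ⟨p.1, x⟩].

(** Separability makes both passages countable: a closed ball is cut out by half-spaces normal to a
    dense sequence, and an open set is a union of closed balls with centres in that sequence and
    radii 1/(m+1). *)
Lemma borel_half_spaces :
  @measurable _ (borel H) = <<s range half_space >>.
Proof.
apply/seteqP; split; last first.
  apply: smallest_sub; first exact: sigma_algebra_measurable.
  move=> _ [[y c] _ <-]; rewrite -[half_space _]setTI.
  have -> : half_space (y, c) = (fun x : borel H => ⟨y, x⟩) @^-1` `]c, +oo[.
    by apply/seteqP; split => x /=; rewrite in_itv/= andbT.
  exact: measurable_inner.
apply: smallest_sub; first exact: smallest_sigma_algebra.
move=> U oU.
pose T := g_sigma_algebraType (range half_space).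
have [e de] := @dense_sequence R H.
have mcball (c : H) (r : R) : 0 <= r ->
    @measurable _ T [set x : H | `|x - c| <= r].
  move=> r0.
  have -> : [set x : H | `|x - c| <= r] =
      \bigcap_k ~` half_space (e k, r * `|e k| + ⟨e k, c⟩).
    apply/seteqP; split => [x /= xr k _|x /= h]; rewrite /half_space /=.
      apply/negP; rewrite -leNgt -lerBlDr -innerBr (le_trans (inner_le _ _))//.
      by rewrite mulrC ler_wpM2r.
    rewrite leNgt; apply/negP => rx.
    set v := x - c in rx *.
    have v0 : 0 < `|v| by exact: le_lt_trans rx.
    (* With a = |e_n - v|, the half-space inequality would give |v|^2 - a |v| <= r (a + |v|), that
       is |v|^2 - r |v| <= a (|v| + r); this tolerance on a excludes it. *)
    have [|n nv] := de v ((`|v| ^+ 2 - r * `|v|) / (`|v| + r + 1)).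
      apply: divr_gt0; first by rewrite subr_gt0 expr2 ltr_pM2r.
      by apply: ltr_pwDr => //; exact: addr_ge0.
    have := h n I; rewrite /half_space /= => /negP; rewrite -leNgt -lerBlDr -innerBr.
    rewrite -/v -[e n](subrK v) innerDl inner_norm.
    have := cauchy_schwarz (e n - v) v; rewrite ler_norml => /andP[h1 _].
    have h2 : r * `|e n - v + v| <= r * (`|e n - v| + `|v|).
      by rewrite ler_wpM2l// ler_normD.
    have w1 : 0 < `|v| + r + 1 by apply: ltr_pwDr => //; exact: addr_ge0.
    move: nv h1 h2; rewrite (ltr_pdivlMr _ _ w1).
    have := normr_ge0 (e n - v).
    move: (`|e n - v|) (⟨_, _⟩) (`|_ + v|) (`|v|) v0 => a b d w *; lra.
  apply: bigcap_measurableType => k _; apply: measurableC.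
  by apply: sub_sigma_algebra; exists (e k, r * `|e k| + ⟨e k, c⟩).
pose B (p : nat * nat) := [set x : H | `|x - e p.1| <= p.2.+1%:R^-1].
have -> : U = \bigcup_(p in [set p | B p `<=` U]) B p.
  apply/seteqP; split => [x Ux|x [p pU] /pU//].
  have /nbhs_ballP[r /= r0 rU] : nbhs x U by exact: open_nbhs_nbhs.
  pose m := Num.truncn (2 / r).
  have mr : m.+1%:R^-1 < r / 2.
    by rewrite invf_plt ?posrE ?divr_gt0// invf_div truncnS_gt.
  have m0 : 0 < (m.+1%:R^-1 : R) by [].
  have [n nx] := de x _ m0.
  exists (n, m) => /=; last by rewrite /B /= distrC ltW.
  move=> z; rewrite /B /= => zn; apply: rU; rewrite -ball_normE /=.
  rewrite (_ : x - z = - (e n - x) - (z - e n)); last first.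
    by rewrite !opprB addrA subrK.
  rewrite (le_lt_trans (ler_normB _ _))// normrN.
  by rewrite [ltRHS](splitr r) ltrD// ?(lt_trans nx)// (le_lt_trans zn).
have -> : \bigcup_(p in [set p | B p `<=` U]) B p =
    \bigcup_p (if `[< B p `<=` U >] then B p else set0).
  apply/seteqP; split => [x [p pU px]|x [p _]].
    by exists p => //; rewrite asboolT.
  by case: asboolP => // pU px; exists p.
apply: (@countable_bigcupT_measurable _ T) => // p; case: ifP => // _.
by apply: mcball; rewrite invr_ge0.
Qed.

(** Weak measurability is enough because half-spaces generate; this is how scalings such as (t, x)
    |-> t x are shown measurable. *)
Lemma measurable_into_borel d (T : measurableType d) (f : T -> borel H) :
  (forall y, measurable_fun setT (fun t => ⟨y, f t⟩)) -> measurable_fun setT f.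
Proof.
move=> mf; apply: (measurability _ borel_half_spaces) => _ [_ [[y c] _ <-] <-].
have -> : f @^-1` half_space (y, c) = (fun t => ⟨y, f t⟩) @^-1` `]c, +oo[.
  by apply/seteqP; split => x /=; rewrite in_itv/= andbT.
exact: mf.
Qed.

End borel_hilbert.

(** * Dominated convergence and integrability for real-valued functions *)

Section real_integrals.
Context d (T : measurableType d) {R : realType} (mu : {measure set T -> \bar R}).
Implicit Types (D : set T) (f g : T -> R).

Lemma dominated_Rintegral D (f_ : nat -> T -> R) f g : measurable D ->
  (forall n, measurable_fun D (f_ n)) ->
  (forall x, D x -> f_ n x @[n --> \oo] --> f x) ->
  mu.-integrable D (EFin \o g) ->
  (forall n x, D x -> `|f_ n x| <= g x) ->
  mu.-integrable D (EFin \o f) /\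
  \int[mu]_(x in D) f_ n x @[n --> \oo] --> \int[mu]_(x in D) f x.
Proof.
move=> mD mf_ f_f ig f_g.
have mEf_ n : measurable_fun D (EFin \o f_ n) by exact/measurable_EFinP.
have cE x : D x -> (EFin \o f_ n) x @[n --> \oo] --> (EFin \o f) x.
  by move=> Dx; apply: cvg_EFin; [exact: nearW|exact: f_f].
have mEf : measurable_fun D (EFin \o f).
  by apply: (emeasurable_fun_cvg (fun n => EFin \o f_ n)).
have [//||||i1 _ i2] := @dominated_convergence _ _ _ mu _ mD
  (fun n => EFin \o f_ n) (EFin \o f) (EFin \o g) _ mEf.
- by apply/aeW => x Dx; exact: cE.
- exact: ig.
- by apply/aeW => x n Dx; rewrite lee_fin; exact: f_g.
split => //; apply: fine_cvg; rewrite fineK//.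
exact: integrable_fin_num.
Qed.

Lemma le_Rintegrable D f g : measurable D -> measurable_fun D f ->
  (forall x, D x -> `|f x| <= g x) -> mu.-integrable D (EFin \o g) ->
  mu.-integrable D (EFin \o f).
Proof.
move=> mD mf fg; apply: le_integrable => //; first exact/measurable_EFinP.
by move=> x Dx; rewrite !abse_EFin lee_fin (le_trans (fg x Dx))// ler_norm.
Qed.

Lemma integrableRD D f g : measurable D -> mu.-integrable D (EFin \o f) ->
  mu.-integrable D (EFin \o g) -> mu.-integrable D (EFin \o (fun x => f x + g x)).
Proof. by move=> mD i1 i2; exact: (integrableD mD i1 i2). Qed.

Lemma integrableRB D f g : measurable D -> mu.-integrable D (EFin \o f) ->
  mu.-integrable D (EFin \o g) -> mu.-integrable D (EFin \o (fun x => f x - g x)).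
Proof. by move=> mD i1 i2; exact: (integrableB mD i1 i2). Qed.

Lemma integrableRZ D f (a : R) : measurable D -> mu.-integrable D (EFin \o f) ->
  mu.-integrable D (EFin \o (fun x => a * f x)).
Proof. by move=> mD i1; exact: (integrableZl mD a i1). Qed.

End real_integrals.

Section probability_integrals.
Context d (T : measurableType d) {R : realType} (P : probability T R).

Lemma bounded_integrable (f : T -> R) (C : R) : measurable_fun setT f ->
  (forall x, `|f x| <= C) -> P.-integrable setT (EFin \o f).
Proof.
move=> mf fC; apply: (@le_Rintegrable _ _ _ _ _ _ (cst C)) => //.
exact: finite_measure_integrable_cst.
Qed.

Lemma Rintegral_probability_cst (c : R) : \int[P]_x c = c.
Proof.
rewrite Rintegral_cst// -[RHS]mulr1; congr (_ * _).
by have /(congr1 fine) := probability_setT P.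
Qed.

Lemma bounded_cvg_Rintegral (f_ : nat -> T -> R) f (C : R) :
  (forall n, measurable_fun setT (f_ n)) ->
  (forall x, f_ n x @[n --> \oo] --> f x) -> (forall n x, `|f_ n x| <= C) ->
  \int[P]_x f_ n x @[n --> \oo] --> \int[P]_x f x.
Proof.
move=> mf f_f fC; apply: (dominated_Rintegral _ _ _ (_ : P.-integrable setT (EFin \o cst C)) _).2 => //.
exact: finite_measure_integrable_cst.
Qed.

End probability_integrals.

(** * Polynomial approximation of the sign *)

Section sign_iteration.
Context {R : realType}.
Implicit Types v : R.

(* The Newton-Schulz iteration for the sign: a polynomial map that drives every
   nonzero point of [-1, 1] to its sign. *)
Definition sign_step v := (3 * v - v ^+ 3) / 2.
(** The polynomial (u + u^2) / 2 sends the signs -1, 0, 1 to 0, 0, 1, turning a sign into the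
    indicator of positivity. *)
Definition pos_iter m v := (iter m sign_step v + iter m sign_step v ^+ 2) / 2.

Lemma sign_step_itv v : 0 <= v <= 1 -> v <= sign_step v <= 1.
Proof.
move=> /andP[v0 v1]; have -> : sign_step v = v + v * (1 - v ^+ 2) / 2.
  by rewrite /sign_step; field.
have h1 : 0 <= v * (1 - v ^+ 2).
  by rewrite mulr_ge0// subr_ge0 expr_le1.
have h2 : 0 <= (1 - v) ^+ 2 * (2 + v) by rewrite mulr_ge0 ?sqr_ge0// addr_ge0.
by apply/andP; split; [lra|move: h2; rewrite -subr_ge0 => h2; nra].
Qed.

Lemma sign_stepN v : sign_step (- v) = - sign_step v.
Proof. by rewrite /sign_step; field. Qed.

Lemma iter_sign_stepN m v : iter m sign_step (- v) = - iter m sign_step v.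
Proof. by elim: m => //= m ->; rewrite sign_stepN. Qed.

Lemma iter_sign_step0 m : iter m sign_step 0 = 0.
Proof. by elim: m => //= m ->; rewrite /sign_step; field. Qed.

Lemma iter_sign_step_itv m v : 0 <= v <= 1 -> v <= iter m sign_step v <= 1.
Proof.
move=> v01; elim: m => [|m /andP[h1 h2]] /=; first by rewrite lexx; case/andP: v01.
have /andP[h3 ->] := @sign_step_itv (iter m sign_step v) ltac:(lra).
by rewrite (le_trans h1 h3).
Qed.

Lemma iter_sign_step_norm m v : `|v| <= 1 -> `|iter m sign_step v| <= 1.
Proof.
move=> v1; have /andP[_ h] := @iter_sign_step_itv m `|v| ltac:(by rewrite normr_ge0).
have h0 : 0 <= iter m sign_step `|v|.
  by rewrite (le_trans (normr_ge0 v))//; case/andP: (@iter_sign_step_itv m `|v| ltac:(by rewrite normr_ge0)).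
have [v0|v0] := ger0P v; move: h h0.
  by rewrite ger0_norm// => h h0; rewrite ger0_norm.
by rewrite ltr0_norm// iter_sign_stepN => h h0; rewrite -normrN ger0_norm.
Qed.

Lemma cvg_iter_sign_step v : 0 < v <= 1 -> iter m sign_step v @[m --> \oo] --> (1 : R).
Proof.
move=> /andP[v0 v1].
(* One step multiplies the distance 1 - u by (2 - u - u^2) / 2 <= 1 - u / 2, and the iterates never
   fall below v. *)
have key m : 1 - iter m sign_step v <= (1 - v / 2) ^+ m.
  elim: m => [|m IH] /=; first by rewrite expr0; lra.
  have /andP[h1 h2] := @iter_sign_step_itv m v ltac:(lra).
  rewrite exprS; set u := iter m sign_step v in IH h1 h2 *.
  have -> : 1 - sign_step u = ((2 - u - u ^+ 2) / 2) * (1 - u).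
    by rewrite /sign_step; field.
  have u1 : u ^+ 2 <= 1 by rewrite expr_le1//; lra.
  have u0 := sqr_ge0 u.
  by apply: ler_pM => //; lra.
have h : (1 - (1 - v / 2) ^+ m) @[m --> \oo] --> (1 - 0 : R).
  apply: cvgB; first exact: cvg_cst.
  by apply: cvg_expr; rewrite ger0_norm; lra.
rewrite subr0 in h.
apply: (squeeze_cvgr _ h (cvg_cst (1 : R))); apply: nearW => m.
have /andP[h1 h2] := @iter_sign_step_itv m v ltac:(lra).
by rewrite h2 andbT; have := key m; lra.
Qed.

Lemma cvg_pos_iter v : `|v| <= 1 -> pos_iter m v @[m --> \oo] --> ((0 < v)%R%:R : R).
Proof.
move=> v1.
have cv (l : R) : iter m sign_step v @[m --> \oo] --> l ->
    pos_iter m v @[m --> \oo] --> (l + l ^+ 2) / 2.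
  by move=> vl; apply: cvgMl; apply: cvgD => //; rewrite expr2; apply: cvgM.
have [v0|v0|v0] := ltgtP 0 v.
- have := cv 1; rewrite expr1n -[1 + 1]/(2%:R) divff//; apply.
  by apply: cvg_iter_sign_step; rewrite v0 -(gtr0_norm v0).
- have := cv (- 1); rewrite sqrrN expr1n addNr mul0r; apply.
  have -> : (fun m => iter m sign_step v) = (fun m => - iter m sign_step (- v)).
    by apply/funext => m; rewrite iter_sign_stepN opprK.
  apply: cvgN; apply: cvg_iter_sign_step.
  by rewrite oppr_gt0 v0 -(ltr0_norm v0).
- have := cv 0; rewrite expr0n addr0 mul0r; apply; rewrite -v0.
  have -> : (fun m => iter m sign_step 0) = (fun m => 0).
    by apply/funext => m; rewrite iter_sign_step0.
  exact: cvg_cst.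
Qed.

Lemma pos_iter_norm m v : `|v| <= 1 -> `|pos_iter m v| <= 1.
Proof.
move=> /(iter_sign_step_norm m); rewrite /pos_iter; set u := iter _ _ _ => u1.
rewrite normrM (ger0_norm (_ : 0 <= 2^-1))// ler_pdivrMr// mul1r.
rewrite (le_trans (ler_normD _ _))// normrX -[leRHS]/(1 + 1) lerD// expr_le1//.
Qed.

End sign_iteration.

Section complex_exponential.
Context {R : realType}.

Lemma Re_cexp (z : R[i]) : complex.Re (cexp z) = expR (complex.Re z) * cos (complex.Im z).
Proof. by case: z => a b; rewrite /cexp /= mul0r subr0. Qed.

Lemma Im_cexp (z : R[i]) : complex.Im (cexp z) = expR (complex.Re z) * sin (complex.Im z).
Proof. by case: z => a b; rewrite /cexp /= mul0r addr0. Qed.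

Lemma cexpD (z w : R[i]) : cexp (z + w) = cexp z * cexp w.
Proof.
case: z w => [a b] [c d]; apply/eqP; rewrite eq_complex.
rewrite /cexp /= expRD cosD sinD; apply/andP; split; apply/eqP; ring.
Qed.

End complex_exponential.

(** * Uniqueness of characteristic functions *)

Section characteristic_function.
Context {R : realType} {H : separableHilbertType R}.
Local Notation law := (probability (borel H) R).
Implicit Types (mu nu : law) (y : H).

Lemma char_funE mu y :
  char_fun mu y = (\int[mu]_x cos ⟨y, x⟩) +i* (\int[mu]_x sin ⟨y, x⟩).
Proof.
rewrite /char_fun /cintegral; congr (_ +i* _); apply: eq_Rintegral => x _.
  by rewrite Re_cexp /= expR0 mul1r.
by rewrite Im_cexp /= expR0 mul1r.
Qed.

Lemma measurable_cos_innerD y (b : R) :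
  measurable_fun [set: borel H] (fun x : borel H => cos (⟨y, x⟩ + b)).
Proof.
apply: measurableT_comp.
  by apply: continuous_measurable_fun; exact: continuous_cos.
by apply: measurable_funD => //; exact: measurable_inner.
Qed.

Lemma measurable_sin_innerD y (b : R) :
  measurable_fun [set: borel H] (fun x : borel H => sin (⟨y, x⟩ + b)).
Proof.
apply: measurableT_comp.
  by apply: continuous_measurable_fun; exact: continuous_sin.
by apply: measurable_funD => //; exact: measurable_inner.
Qed.

Lemma integrable_cos_inner mu y b :
  mu.-integrable setT (EFin \o (fun x : borel H => cos (⟨y, x⟩ + b))).
Proof.
apply: (@bounded_integrable _ _ _ _ _ 1); first exact: measurable_cos_innerD.
by move=> x; exact: cos_max.
Qed.

Lemma integrable_sin_inner mu y b :
  mu.-integrable setT (EFin \o (fun x : borel H => sin (⟨y, x⟩ + b))).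
Proof.
apply: (@bounded_integrable _ _ _ _ _ 1); first exact: measurable_sin_innerD.
by move=> x; exact: sin_max.
Qed.

(* Real trigonometric polynomials form an algebra, and their integrals are
   determined by the characteristic function. *)
Inductive trig_poly : (H -> R) -> Prop :=
| trig_poly_cos (a b : R) y : trig_poly (fun x => a * cos (⟨y, x⟩ + b))
| trig_polyD f g : trig_poly f -> trig_poly g -> trig_poly (fun x => f x + g x).

Lemma trig_poly_ext f g : f =1 g -> trig_poly f -> trig_poly g.
Proof. by move=> /funext ->. Qed.

Lemma trig_poly_cst c : trig_poly (fun=> c).
Proof.
apply: trig_poly_ext (trig_poly_cos c 0 0) => x.
by rewrite inner0l addr0 cos0 mulr1.
Qed.

Lemma trig_polyM f g : trig_poly f -> trig_poly g -> trig_poly (fun x => f x * g x).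
Proof.
move=> tf tg; elim: tf => [a b y|f1 f2 _ IH1 _ IH2]; last first.
  by apply: trig_poly_ext (trig_polyD IH1 IH2) => x; rewrite mulrDl.
elim: tg => [a' b' y'|f1 f2 _ IH1 _ IH2]; last first.
  by apply: trig_poly_ext (trig_polyD IH1 IH2) => x; rewrite mulrDr.
apply: trig_poly_ext (trig_polyD (trig_poly_cos (a * a' / 2) (b + b') (y + y'))
  (trig_poly_cos (a * a' / 2) (b - b') (y - y'))) => x.
rewrite innerDl innerBl.
have -> : ⟨y, x⟩ + ⟨y', x⟩ + (b + b') = (⟨y, x⟩ + b) + (⟨y', x⟩ + b') by ring.
have -> : ⟨y, x⟩ - ⟨y', x⟩ + (b - b') = (⟨y, x⟩ + b) - (⟨y', x⟩ + b') by ring.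
by rewrite cosB cosD; field.
Qed.

Lemma trig_polyX f n : trig_poly f -> trig_poly (fun x => f x ^+ n).
Proof.
move=> tf; elim: n => [|n IH]; first exact: trig_poly_cst.
by apply: trig_poly_ext (trig_polyM tf IH) => x; rewrite exprS.
Qed.

Lemma trig_poly_sin b y : trig_poly (fun x => sin (⟨y, x⟩ + b)).
Proof.
apply: trig_poly_ext (trig_poly_cos 1 (b - pi / 2) y) => x.
by rewrite mul1r addrA cosBpihalf.
Qed.

Lemma trig_poly_pos_iter f m : trig_poly f -> trig_poly (fun x => pos_iter m (f x)).
Proof.
move=> tf.
have t2 g : trig_poly g -> trig_poly (fun x => g x / 2).
  by move=> tg; exact: (trig_polyM tg (trig_poly_cst _)).
have tm : trig_poly (fun x => iter m sign_step (f x)).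
  elim: m => //= m IH; apply: t2.
  have t1 := trig_polyM (trig_poly_cst 3) IH.
  have t3 := trig_polyM (trig_poly_cst (-1)) (trig_polyX 3 IH).
  by apply: trig_poly_ext (trig_polyD t1 t3) => x; rewrite mulN1r.
by apply: t2; exact: (trig_polyD tm (trig_polyX 2 tm)).
Qed.

Lemma trig_poly_prod I (s : seq I) (f : I -> H -> R) :
  (forall i, trig_poly (f i)) -> trig_poly (fun x => \prod_(i <- s) f i x).
Proof.
move=> tf; elim: s => [|i s IH].
  by apply: trig_poly_ext (trig_poly_cst 1) => x; rewrite big_nil.
by apply: trig_poly_ext (trig_polyM (tf i) IH) => x; rewrite big_cons.
Qed.

Lemma trig_poly_measurable f : trig_poly f ->
  measurable_fun setT (f : borel H -> R).
Proof.
elim=> [a b y|f1 f2 _ IH1 _ IH2]; last exact: measurable_funD IH1 IH2.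
by apply: measurable_funM => //; exact: measurable_cos_innerD.
Qed.

Lemma trig_poly_integrable mu f : trig_poly f ->
  mu.-integrable setT (EFin \o (f : borel H -> R)).
Proof.
elim=> [a b y|f1 f2 _ IH1 _ IH2]; last exact: (integrableRD measurableT IH1 IH2).
by apply: integrableRZ => //; exact: integrable_cos_inner.
Qed.

Lemma eq_trig_poly_integral mu nu f : char_fun mu =1 char_fun nu -> trig_poly f ->
  \int[mu]_x f x = \int[nu]_x f x.
Proof.
move=> munu; elim=> [a b y|f1 f2 t1 IH1 t2 IH2]; last first.
  rewrite RintegralD//; try exact: trig_poly_integrable.
  by rewrite RintegralD//; try exact: trig_poly_integrable; rewrite IH1 IH2.
rewrite !RintegralZl//; try exact: integrable_cos_inner.
congr (_ * _).
(* The addition formula turns the phase b into a combination of the real and imaginary parts of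
   [char_fun]. *)
have E (la : law) : \int[la]_x cos (⟨y, x⟩ + b) =
    cos b * complex.Re (char_fun la y) - sin b * complex.Im (char_fun la y).
  have ic := integrable_cos_inner la y 0; have isn := integrable_sin_inner la y 0.
  rewrite (_ : (fun x => cos (⟨y, x⟩ + 0)) = fun x : borel H => cos ⟨y, x⟩) in ic; last first.
    by apply/funext => x; rewrite addr0.
  rewrite (_ : (fun x => sin (⟨y, x⟩ + 0)) = fun x : borel H => sin ⟨y, x⟩) in isn; last first.
    by apply/funext => x; rewrite addr0.
  rewrite char_funE /= -!RintegralZl// -RintegralB//; try exact: integrableRZ.
  by apply: eq_Rintegral => x _; rewrite cosD mulrC [X in _ - X]mulrC.
by rewrite !E munu.
Qed.

Lemma cvg_prod_seq I (s : seq I) (f : I -> nat -> R) (l : I -> R) :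
  (forall i, f i n @[n --> \oo] --> l i) ->
  \prod_(i <- s) f i n @[n --> \oo] --> \prod_(i <- s) l i.
Proof.
move=> fl; elim: s => [|i s IH].
  by rewrite big_nil (_ : (fun n => _) = fun=> 1);
    [exact: cvg_cst|apply/funext => n; rewrite big_nil].
rewrite big_cons (_ : (fun n => _) = (fun n => f i n * \prod_(i <- s) f i n)).
  exact: cvgM.
by apply/funext => n; rewrite big_cons.
Qed.

Lemma prod_norm_le1 I (s : seq I) (f : I -> R) :
  (forall i, `|f i| <= 1) -> `|\prod_(i <- s) f i| <= 1.
Proof.
move=> f1; elim: s => [|i s IH]; first by rewrite big_nil normr1.
by rewrite big_cons normrM mulr_ile1.
Qed.

(** At a fixed u the periodicity of the sine is harmless: once |u| / (n+1) < pi the sine has the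
    sign of u, so the sequence is eventually constant. *)
Lemma cvg_pos_sin (u : R) :
  ((0 < sin (n.+1%:R^-1 * u))%R%:R : R) @[n --> \oo] --> ((0 < u)%R%:R : R).
Proof.
apply: cvg_near_cst; near=> n.
have un : `|n.+1%:R^-1 * u| < pi.
  rewrite normrM gtr0_norm// mulrC ltr_pdivrMr// mulrC -ltr_pdivrMr ?pi_gt0//.
  rewrite (lt_le_trans (truncnS_gt _))// ler_nat ltnS.
  by near: n; exact: nbhs_infty_ge.
have np : 0 < (n.+1%:R^-1 : R) by [].
have -> // : (0 < sin (n.+1%:R^-1 * u)) = (0 < u).
rewrite -[RHS](pmulr_rgt0 _ np); move: un; set v := _ * u => un.
have [v0|v0|v0] := ltgtP 0 v; last by rewrite -v0 sin0 ltxx.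
  by rewrite sin_gt0_pi// v0 -(gtr0_norm v0).
by apply/negbTE; rewrite -leNgt -oppr_ge0 -sinN sin_ge0_pi// oppr_ge0 (ltW v0)/= -(ltr0_norm v0) ltW.
Unshelve. all: by end_near. Qed.

(* The indicator of <y, x> > c is the limit, as n grows, of that of
   sin((<y, x> - c) / n) > 0, and the latter is a limit of polynomials in this
   sine; hence the laws agree on finite intersections of half-spaces. *)
Lemma char_fun_inj mu nu : char_fun mu =1 char_fun nu -> mu ≡μ nu.
Proof.
move=> munu.
(* Indexing by sequences makes these sets a pi-system: concatenation is intersection, and the empty
   sequence is the whole space. *)
pose cyl (s : seq (H * R)) : set (borel H) := [set x | all (fun p => p.2 < ⟨p.1, x⟩) s].
pose arg n (p : H * R) (x : borel H) := sin (n.+1%:R^-1 * (⟨p.1, x⟩ - p.2)).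
have argE n p x : arg n p x = sin (⟨n.+1%:R^-1 *: p.1, x⟩ + - (n.+1%:R^-1 * p.2)).
  by rewrite /arg innerZl mulrBr.
have marg n p : measurable_fun setT (arg n p).
  by rewrite (funext (argE n p)); exact: measurable_sin_innerD.
have tpos s m n : trig_poly (fun x => \prod_(p <- s) pos_iter m (arg n p x)).
  apply: trig_poly_prod => p; apply: trig_poly_pos_iter.
  by apply: trig_poly_ext (trig_poly_sin _ _) => x; rewrite argE.
have mpos (u : borel H -> R) : measurable_fun setT u ->
    measurable_fun setT (fun x => (0 < u x)%R%:R : R).
  move=> mu'; rewrite (_ : (fun x => _) = (fun x => \1_`]0, +oo[ (u x))).
    by apply: measurableT_comp mu' => //; exact: measurable_indic.
  by apply/funext => x; rewrite indicE; congr (_%:R); rewrite mem_setE in_itv/= andbT.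
have eq1 n s : \int[mu]_x \prod_(p <- s) (0 < arg n p x)%R%:R =
    \int[nu]_x \prod_(p <- s) (0 < arg n p x)%R%:R.
  have h (la : law) : \int[la]_x \prod_(p <- s) pos_iter m (arg n p x) @[m --> \oo] -->
      \int[la]_x \prod_(p <- s) (0 < arg n p x)%R%:R.
    apply: (@bounded_cvg_Rintegral _ _ _ _ _ _ 1).
    - by move=> m; apply: trig_poly_measurable; exact: tpos.
    - by move=> x; apply: cvg_prod_seq => p; apply: cvg_pos_iter; exact: sin_max.
    - by move=> m x; apply: prod_norm_le1 => p; apply: pos_iter_norm; exact: sin_max.
  apply: (cvg_unique _ (h mu)) => //.
  rewrite (_ : (fun m => _) = fun m =>
    \int[nu]_x \prod_(p <- s) pos_iter m (arg n p x)); first exact: h.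
  by apply/funext => m; apply: eq_trig_poly_integral => //; exact: tpos.
have eq2 s : \int[mu]_x \prod_(p <- s) (0 < ⟨p.1, x⟩ - p.2)%R%:R =
    \int[nu]_x \prod_(p <- s) (0 < ⟨p.1, x⟩ - p.2)%R%:R.
  have h (la : law) : \int[la]_x \prod_(p <- s) (0 < arg n p x)%R%:R @[n --> \oo] -->
      \int[la]_x \prod_(p <- s) (0 < ⟨p.1, x⟩ - p.2)%R%:R.
    apply: (@bounded_cvg_Rintegral _ _ _ _ _ _ 1).
    - by move=> m; apply: measurable_prod => p _; exact: mpos.
    - by move=> x; apply: cvg_prod_seq => p; exact: cvg_pos_sin.
    - by move=> m x; apply: prod_norm_le1 => p; case: (_ < _); rewrite ?normr1 ?normr0.
  apply: (cvg_unique _ (h mu)) => //.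
  rewrite (_ : (fun m => _) = fun n =>
    \int[nu]_x \prod_(p <- s) (0 < arg n p x)%R%:R); first exact: h.
  by apply/funext => m; exact: eq1.
have prodE s x : \prod_(p <- s) (0 < ⟨p.1, x⟩ - p.2)%R%:R = \1_(cyl s) x :> R.
  rewrite indicE; elim: s => [|p s IH]; first by rewrite big_nil mem_set.
  rewrite big_cons IH subr_gt0 -natrM mulnb; congr (nat_of_bool _)%:R.
  apply/idP/idP.
    by move=> /andP[h1 /set_mem h2]; apply/mem_set; rewrite /cyl /= h1.
  by move=> /set_mem /= /andP[h1 h2]; rewrite h1; apply/mem_set.
have mcyl s : measurable (cyl s).
  elim: s => [|p s IH]; first by rewrite (_ : cyl _ = setT)//; apply/seteqP; split.
  rewrite (_ : cyl _ = half_space p `&` cyl s).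
    by apply: measurableI => //; rewrite borel_half_spaces; apply: sub_sigma_algebra; exists p.
  by apply/seteqP; split => x /=; rewrite /cyl /half_space /= => /andP.
have eqcyl s : mu (cyl s) = nu (cyl s).
  have fp (la : law) : la (cyl s) \is a fin_num by exact: fin_num_measure.
  rewrite -(fineK (fp mu)) -(fineK (fp nu)); congr EFin.
  have h (la : law) : fine (la (cyl s)) = \int[la]_x \1_(cyl s) x.
    by rewrite /Rintegral integral_indic// setIT.
  rewrite !h; under eq_Rintegral do rewrite -prodE.
  by rewrite eq2; under eq_Rintegral do rewrite prodE.
move=> A mA; apply: (measure_unique (range cyl) (fun=> setT)) => //.
- rewrite borel_half_spaces; apply/seteqP; split; apply: smallest_sub;
    try exact: smallest_sigma_algebra.
    move=> _ [p _ <-]; apply: sub_sigma_algebra; exists [:: p] => //.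
    by apply/seteqP; split => x /=; rewrite /cyl /= andbT.
  by move=> _ [s _ <-]; rewrite -borel_half_spaces.
- move=> _ _ [s _ <-] [s' _ <-]; exists (s ++ s') => //.
  by apply/seteqP; split => x /=; rewrite /cyl /= all_cat => /andP.
- by move=> _; exists [::] => //; apply/seteqP; split.
- by rewrite bigcup_const.
- by move=> _ [s _ <-]; exact: eqcyl.
- by move=> _; rewrite -ge0_fin_numE ?fin_num_measure.
Qed.

End characteristic_function.

(** * Convolution and characteristic functions *)

Section convolution_theory.
Context {R : realType} {H : separableHilbertType R}.
Local Notation law := (probability (borel H) R).
Local Notation conv := Defs.conv.
Implicit Types (mu nu : law) (y : H).

Lemma eq_law_Rintegral mu nu (f : borel H -> R) : mu ≡μ nu ->
  \int[mu]_x f x = \int[nu]_x f x.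
Proof.
by move=> munu; congr fine; apply: eq_measure_integral => A mA _; exact: munu.
Qed.

Lemma char_fun_equiv mu nu : mu ≡μ nu -> char_fun mu =1 char_fun nu.
Proof. by move=> e y; rewrite !char_funE; congr (_ +i* _); exact: eq_law_Rintegral. Qed.

Lemma Rintegral_distribution d (T : measurableType d) (P : probability T R)
    (X : {RV P >-> borel H}) (f : borel H -> R) C :
  measurable_fun setT f -> (forall x, `|f x| <= C) ->
  \int[distribution P X]_x f x = \int[P]_x f (X x).
Proof.
move=> mf fC; congr fine; rewrite integral_pushforward//.
  exact/measurable_EFinP.
apply: (@bounded_integrable _ _ _ _ _ C) => //.
by apply: measurableT_comp mf _.
Qed.

Lemma Rintegral_prod mu nu (f g : borel H -> R) C :
  measurable_fun setT f -> measurable_fun setT g ->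
  (forall x, `|f x| <= C) -> (forall x, `|g x| <= C) ->
  \int[(mu \x nu)%E]_z (f z.1 * g z.2) = (\int[mu]_x f x) * (\int[nu]_x g x).
Proof.
move=> mf mg fC gC.
have mfg : measurable_fun setT (fun z : borel H * borel H => f z.1 * g z.2).
  by apply: measurable_funM; [exact: (measurableT_comp mf)|exact: (measurableT_comp mg)].
have ig : nu.-integrable setT (EFin \o g) by exact: bounded_integrable gC.
have if_ : mu.-integrable setT (EFin \o f) by exact: bounded_integrable fC.
have C0 : 0 <= C by exact: le_trans (fC 0).
have ifg : (mu \x nu)%E.-integrable setT (EFin \o (fun z : borel H * borel H => f z.1 * g z.2)).
  apply: (@bounded_integrable _ _ _ _ _ (C * C)) => // z.
  by rewrite normrM ler_pM.
rewrite {1}/Rintegral -(integral12_prod_meas1 ifg)/= /fubini_F/=.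
transitivity (fine (\int[mu]_x ((\int[nu]_y g y) * f x)%:E)).
  congr fine; apply: eq_integral => x _.
  rewrite -[LHS]fineK; last first.
    apply: integrable_fin_num => //; exact: (integrableRZ (f x) measurableT ig).
  by congr EFin; rewrite -/(Rintegral _ _ _) (RintegralZl (f x) measurableT ig) mulrC.
by rewrite -/(Rintegral _ _ _) (RintegralZl _ measurableT if_) mulrC.
Qed.

Lemma char_fun_conv mu nu y : char_fun (conv mu nu) y = char_fun mu y * char_fun nu y.
Proof.
have mc : measurable_fun setT (fun x : borel H => cos ⟨y, x⟩).
  apply: measurableT_comp; last exact: measurable_inner.
  by apply: continuous_measurable_fun; exact: continuous_cos.
have ms : measurable_fun setT (fun x : borel H => sin ⟨y, x⟩).
  apply: measurableT_comp; last exact: measurable_inner.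
  by apply: continuous_measurable_fun; exact: continuous_sin.
have c1 (x : borel H) : `|cos ⟨y, x⟩| <= 1 by exact: cos_max.
have s1 (x : borel H) : `|sin ⟨y, x⟩| <= 1 by exact: sin_max.
have iP (f g : borel H -> R) : measurable_fun setT f -> measurable_fun setT g ->
    (forall x, `|f x| <= 1) -> (forall x, `|g x| <= 1) ->
    (mu \x nu)%E.-integrable setT (EFin \o (fun z : borel H * borel H => f z.1 * g z.2)).
  move=> mf mg f1 g1.
  apply: (@bounded_integrable _ _ _ _ _ 1) => [|z]; last by rewrite normrM mulr_ile1.
  by apply: measurable_funM; [exact: (measurableT_comp mf)|exact: (measurableT_comp mg)].
rewrite !char_funE /conv.
rewrite (Rintegral_distribution _ mc c1) (Rintegral_distribution _ ms s1) /=.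
apply/eqP; rewrite eq_complex /=; apply/andP; split; apply/eqP.
  rewrite -!(Rintegral_prod _ _ _ _ c1 c1)// -!(Rintegral_prod _ _ _ _ s1 s1)//.
  rewrite -RintegralB//; [|exact: (iP _ _ mc mc c1 c1)|exact: (iP _ _ ms ms s1 s1)].
  by apply: eq_Rintegral => z _; rewrite /addH innerDr cosD.
rewrite -!(Rintegral_prod _ _ _ _ c1 s1)// -!(Rintegral_prod _ _ _ _ s1 c1)//.
rewrite -RintegralD//; [|exact: (iP _ _ mc ms c1 s1)|exact: (iP _ _ ms mc s1 c1)].
by apply: eq_Rintegral => z _; rewrite /addH innerDr sinD addrC.
Qed.

Lemma char_fun_iter_conv nu n y :
  char_fun (iter n (conv nu) nu) y = char_fun nu y ^+ n.+1.
Proof.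
elim: n => [|n IH]; first by rewrite expr1.
by rewrite /= char_fun_conv IH -exprS.
Qed.

(** The convolution of two n-th roots is an n-th root. The factors are rearranged on characteristic
    functions, where convolution is a commutative product. *)
Lemma infinitely_divisible_conv mu nu : infinitely_divisible mu ->
  infinitely_divisible nu -> infinitely_divisible (conv mu nu).
Proof.
move=> imu inu n; have [mu' e1] := imu n; have [nu' e2] := inu n.
exists (conv mu' nu'); apply: char_fun_inj => y.
rewrite char_fun_iter_conv !char_fun_conv exprMn.
by rewrite (char_fun_equiv e1) (char_fun_equiv e2) !char_fun_iter_conv.
Qed.

Lemma has_triplet_equiv mu nu a S M : char_fun mu =1 char_fun nu ->
  has_triplet mu a S M -> has_triplet nu a S M.
Proof. by move=> e [h1 h2 h3]; split => // y; rewrite -e. Qed.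

(** The two sets from which [xget] chooses coincide, so the chosen exponents are equal as
    functions. *)
Lemma log_char_fun_equiv mu nu : char_fun mu =1 char_fun nu ->
  log_char_fun mu = log_char_fun nu.
Proof.
move=> e; rewrite /log_char_fun; congr (xget _ _).
apply/seteqP; split => psi [a [S [M [tr ->]]]]; exists a, S, M; split => //.
  exact: has_triplet_equiv tr.
by apply: has_triplet_equiv tr => y; rewrite e.
Qed.

End convolution_theory.

(** * Trigonometric bounds and uniqueness of continuous logarithms *)

Section elementary_bounds.
Context {R : realType}.
Implicit Types u : R.

Lemma cos_lipschitz_gt0 u : 0 < u -> exists2 c, 0 < c < u & cos u - 1 = - sin c * u.
Proof.
move=> u0; have [|c cu] := @MVT R cos (fun x => - sin x) 0 u u0.
- by apply: continuous_in_subspaceT => x _; exact: continuous_cos.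
- rewrite cos0 subr0 => ->; exists c => //.
Qed.

Lemma sin_lipschitz_gt0 u : 0 < u -> exists2 c, 0 < c < u & sin u = cos c * u.
Proof.
move=> u0; have [|c cu] := @MVT R sin cos 0 u u0.
- by apply: continuous_in_subspaceT => x _; exact: continuous_sin.
- rewrite sin0 !subr0 => ->; exists c => //.
Qed.

Lemma norm_sin_le u : `|sin u| <= `|u|.
Proof.
wlog u0 : u / 0 < u => [h|].
  have [/h//|u0|<-] := ltgtP 0 u; last by rewrite sin0 normr0.
  by have := h (- u); rewrite sinN !normrN oppr_gt0; exact.
have [c _ ->] := sin_lipschitz_gt0 u0.
by rewrite normrM ler_piMl// cos_max.
Qed.

Lemma norm_cosB1_le u : `|cos u - 1| <= `|u|.
Proof.
wlog u0 : u / 0 < u => [h|].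
  have [/h//|u0|<-] := ltgtP 0 u; last by rewrite cos0 subrr normr0.
  by have := h (- u); rewrite cosN !normrN oppr_gt0; exact.
have [c _ ->] := cos_lipschitz_gt0 u0.
by rewrite normrM normrN ler_piMl// sin_max.
Qed.

Lemma norm_cosB1_le_sqr u : `|cos u - 1| <= u ^+ 2.
Proof.
wlog u0 : u / 0 < u => [h|].
  have [/h//|u0|<-] := ltgtP 0 u; last by rewrite cos0 subrr normr0 expr0n.
  by have := h (- u); rewrite cosN sqrrN oppr_gt0; exact.
have [c /andP[c0 cu] ->] := cos_lipschitz_gt0 u0.
rewrite normrM (gtr0_norm u0) expr2 normrN; apply: ler_wpM2r; first exact: ltW.
by rewrite (le_trans (norm_sin_le _))// gtr0_norm// ltW.
Qed.

Lemma norm_cosB1_le2 u : `|cos u - 1| <= 2.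
Proof.
by rewrite (le_trans (ler_normB _ _))// normr1 -[leRHS]/(1 + 1) lerD2r cos_max.
Qed.

Lemma norm_sinB_le_sqr u : `|sin u - u| <= u ^+ 2.
Proof.
wlog u0 : u / 0 < u => [h|].
  have [/h//|u0|<-] := ltgtP 0 u; last by rewrite sin0 subrr normr0 expr0n.
  by have := h (- u); rewrite sinN -opprD normrN sqrrN oppr_gt0; exact.
have [c /andP[c0 cu] ->] := sin_lipschitz_gt0 u0.
rewrite -[X in _ - X]mul1r -mulrBl normrM (gtr0_norm u0) expr2; apply: ler_wpM2r; first exact: ltW.
by rewrite (le_trans (norm_cosB1_le _))// gtr0_norm// ltW.
Qed.

Lemma cos_eq1_near0 u : `|u| <= 1 -> cos u = 1 -> u = 0.
Proof.
move=> u1 cu1; apply/eqP; rewrite -normr_eq0; apply/eqP.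
apply: cos_inj.
- by rewrite in_itv/= normr_ge0/= (le_trans u1)// (le_trans _ (pi_ge2 R))// ler1n.
- by rewrite in_itv/= lexx pi_ge0.
- rewrite cos0 -cu1; have [//|u0] := ger0P u; exact: cosN.
Qed.

(** If w t > 0, the path from 0 takes the value min(1, w t) on its way, and on ]0, 1] the cosine
    differs from 1. The other signs reduce to this case by reflection. *)
Lemma continuous_cos1_eq0 (w : R -> R) : continuous w -> w 0 = 0 ->
  (forall t, cos (w t) = 1) -> forall t, w t = 0.
Proof.
move=> cw w0 w1 t; apply: contrapT => /eqP wt.
wlog t0 : w t cw w0 w1 wt / 0 <= t => [h|].
  have [/h|] := leP 0 t; first exact.
  rewrite -oppr_gt0 => /ltW t0; apply: (h (w \o -%R) (- t)) => //=.
  - by move=> x; apply: continuous_comp; [exact: opp_continuous|exact: cw].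
  - by rewrite oppr0.
  - by rewrite opprK.
wlog wt0 : w cw w0 w1 wt / 0 < w t => [h|].
  have [wt0|wt0|/esym/eqP] := ltgtP 0 (w t); [exact: (h w)| |by rewrite (negbTE wt)].
  apply: (h (\- w)) => //=.
  - by move=> x; apply: continuousN; exact: cw.
  - by rewrite w0 oppr0.
  - by move=> x; rewrite cosN.
  - by rewrite oppr_eq0.
  - by rewrite oppr_gt0.
pose v := Num.min 1 (w t).
have v0 : 0 < v by rewrite lt_min ltr01.
have cwt : {within `[0, t], continuous w}.
  by apply: continuous_in_subspaceT => x _; exact: cw.
have [|c _ wc] := IVT t0 cwt (v := v).
  by rewrite w0 min_l ?max_r ?(ltW wt0)// (ltW v0) ge_min lexx orbT.
have := w1 c; rewrite wc => /cos_eq1_near0.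
rewrite gtr0_norm// ge_min lexx => /(_ isT) v00.
by rewrite v00 ltxx in v0.
Qed.

(** Two continuous logarithms of one path differ by a multiple of 2 pi i, constant by continuity and
    zero at t = 0. *)
Lemma cexp_path_inj (u v : R -> R[i]) :
  continuous (fun t => complex.Re (u t)) -> continuous (fun t => complex.Im (u t)) ->
  continuous (fun t => complex.Re (v t)) -> continuous (fun t => complex.Im (v t)) ->
  u 0 = v 0 -> (forall t, cexp (u t) = cexp (v t)) -> u =1 v.
Proof.
move=> cru ciu crv civ uv0 uv t.
have key s : complex.Re (u s) = complex.Re (v s) /\
    cos (complex.Im (u s) - complex.Im (v s)) = 1.
  have hr : expR (complex.Re (u s)) * cos (complex.Im (u s)) =
      expR (complex.Re (v s)) * cos (complex.Im (v s)) by rewrite -!Re_cexp uv.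
  have hi : expR (complex.Re (u s)) * sin (complex.Im (u s)) =
      expR (complex.Re (v s)) * sin (complex.Im (v s)) by rewrite -!Im_cexp uv.
  move: (complex.Re (u s)) (complex.Re (v s)) (complex.Im (u s)) (complex.Im (v s)) hr hi => a b c d hr hi.
  (* Adding the squares of both equations removes the phases. *)
  have ab : expR a = expR b.
    apply/eqP; rewrite -(@eqrXn2 _ 2) ?expR_ge0//; apply/eqP.
    rewrite -[LHS]mulr1 -[RHS]mulr1 -{1}(cos2Dsin2 c) -(cos2Dsin2 d).
    by rewrite !mulrDr -!exprMn hr hi.
  have e0 : expR b != 0 by rewrite gt_eqF// expR_gt0.
  split; first exact: expR_inj ab.
  rewrite cosB; move: hr hi; rewrite ab => /(mulfI e0) -> /(mulfI e0) ->.
  by rewrite -!expr2 cos2Dsin2.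
apply/eqP; rewrite eq_complex (key t).1 eqxx/= -subr_eq0; apply/eqP.
apply: (@continuous_cos1_eq0 (fun t => complex.Im (u t) - complex.Im (v t))).
- by move=> s; apply: continuousB; [exact: ciu|exact: civ].
- by rewrite uv0 subrr.
- by move=> s; exact: (key s).2.
Qed.

End elementary_bounds.

(** * The Lévy exponent *)

Section levy_khintchine.
Context {R : realType} {H : separableHilbertType R}.
Local Notation law := (probability (borel H) R).
Implicit Types (M : {measure set (borel H) -> \bar R}) (y : H).

Lemma measurable_setN0 : measurable (~` [set 0%R : H] : set (borel H)).
Proof.
apply: measurableC.
have -> : [set 0%R : H] = (fun x : borel H => `|x : H|) @^-1` [set 0].
  by apply/seteqP; split => x /= => [->|/eqP]; rewrite ?normr0// normr_eq0 => /eqP.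
by rewrite -[X in measurable X]setTI; exact: measurable_norm.
Qed.

Lemma integral_setN0 M (f : borel H -> \bar R) : f (0 : H) = 0%E ->
  (\int[M]_(x in ~` [set 0%R : H]) f x = \int[M]_x f x)%E.
Proof.
move=> f0; rewrite integral_mkcond; congr integral; apply/funext => x.
rewrite patchE; case: ifPn => //; rewrite notin_setE /= => /contrapT ->.
by rewrite f0.
Qed.

Lemma Rintegral_setN0 M (f : borel H -> R) : f (0 : H) = 0 ->
  \int[M]_(x in ~` [set 0%R : H]) f x = \int[M]_x f x.
Proof. by move=> f0; congr fine; apply: integral_setN0; rewrite f0. Qed.

Definition small_jump (x : borel H) : R := Num.min 1 (`|x : H| ^+ 2).
(** Real part of the compensated Lévy-Khintchine integrand; [sin_jump] is its imaginary part. *)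
Definition cos_jump y (x : borel H) : R := cos ⟨y, x⟩ - 1.
Definition sin_jump y (x : borel H) : R :=
  sin ⟨y, x⟩ - ⟨y, x⟩ * \1_[set x : H | `|x| <= 1] x.

Lemma levy_khintchineE a S M y : levy_khintchine a S M y =
  (- (⟨S y, y⟩ / 2) + \int[M]_x cos_jump y x) +i*
  (⟨y, a⟩ + \int[M]_x sin_jump y x).
Proof.
have E x : cexp (0 +i* ⟨y, x⟩) - 1 - (0 +i* (⟨y, x⟩ * \1_[set x : H | `|x| <= 1] x)) =
    cos_jump y x +i* sin_jump y x.
  rewrite /cexp /= expR0; apply/eqP; rewrite eq_complex /=.
  by apply/andP; split; apply/eqP; rewrite /cos_jump /sin_jump; ring.
rewrite /levy_khintchine /cintegral.
rewrite (_ : (fun x => complex.Re _) = cos_jump y); last first.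
  by apply/funext => x; rewrite E.
rewrite (_ : (fun x => complex.Im _) = sin_jump y); last first.
  by apply/funext => x; rewrite E.
rewrite !Rintegral_setN0; last 2 first.
- by rewrite /sin_jump inner0r sin0 mul0r subrr.
- by rewrite /cos_jump inner0r cos0 subrr.
by apply/eqP; rewrite eq_complex /= sub0r oppr0 addr0 !eqxx.
Qed.

Lemma measurable_unit_ball :
  measurable ([set x : H | `|x| <= 1] : set (borel H)).
Proof.
rewrite -[X in measurable X]setTI.
have -> : [set x : H | `|x| <= 1] = (fun x : borel H => `|x : H|) @^-1` `]-oo, 1].
  by apply/seteqP; split => x /=; rewrite in_itv.
by apply: measurable_norm.
Qed.

Lemma measurable_small_jump : measurable_fun setT small_jump.
Proof.
apply: measurable_minr => //; apply: measurable_funX; exact: measurable_norm.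
Qed.

Lemma measurable_cos_jump y : measurable_fun setT (cos_jump y).
Proof.
apply: measurable_funB => //; apply: measurableT_comp; last exact: measurable_inner.
by apply: continuous_measurable_fun; exact: continuous_cos.
Qed.

Lemma measurable_sin_jump y : measurable_fun setT (sin_jump y).
Proof.
apply: measurable_funB => //.
  apply: measurableT_comp; last exact: measurable_inner.
  by apply: continuous_measurable_fun; exact: continuous_sin.
apply: measurable_funM; first exact: measurable_inner.
by apply: measurable_indic; exact: measurable_unit_ball.
Qed.

(** The constant adds two regimes: 2 for jumps of norm at least 1, and |y|^2 from the quadratic
    estimate for smaller ones. *)
Lemma cos_jump_le y x : `|cos_jump y x| <= (2 + `|y| ^+ 2) * small_jump x.
Proof.
have yx : ⟨y, x⟩ ^+ 2 <= `|y| ^+ 2 * `|x : H| ^+ 2.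
  by rewrite -exprMn -real_normK ?num_real// lerXn2r ?nnegrE ?mulr_ge0// cauchy_schwarz.
rewrite /small_jump; case: (leP 1 (`|x : H| ^+ 2)) => _; rewrite /cos_jump.
  by rewrite mulr1 (le_trans (norm_cosB1_le2 _))// lerDl sqr_ge0.
rewrite (le_trans (norm_cosB1_le_sqr _))// (le_trans yx)//.
by rewrite ler_wpM2r ?sqr_ge0// lerDr.
Qed.

Lemma sin_jump_le y x : `|sin_jump y x| <= (2 + `|y| ^+ 2) * small_jump x.
Proof.
have yx : ⟨y, x⟩ ^+ 2 <= `|y| ^+ 2 * `|x : H| ^+ 2.
  by rewrite -exprMn -real_normK ?num_real// lerXn2r ?nnegrE ?mulr_ge0// cauchy_schwarz.
rewrite /small_jump /sin_jump indicE; have [x1|x1] := leP `|x : H| 1.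
  rewrite mem_set// mulr1 min_r ?expr_le1// (le_trans (norm_sinB_le_sqr _))//.
  by rewrite (le_trans yx)// ler_wpM2r ?sqr_ge0// lerDr.
rewrite memNset /=; last by apply/negP; rewrite -ltNge.
rewrite mulr0 subr0 min_l ?expr_ge1 ?(ltW x1)// mulr1 (le_trans (sin_max _))//.
by rewrite (le_trans (_ : _ <= 2)) ?ler1n// lerDl sqr_ge0.
Qed.

Lemma levy_measure_integrable M : levy_measure M ->
  M.-integrable setT (EFin \o small_jump).
Proof.
move=> [_ h]; apply/integrableP; split.
  by apply/measurable_EFinP; exact: measurable_small_jump.
move: h; rewrite integral_setN0; last by rewrite normr0 expr0n min_r.
move=> h'; rewrite (eq_integral (EFin \o small_jump))// => x _ /=.
by rewrite ger0_norm// le_min ler01 sqr_ge0.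
Qed.

Lemma integrable_cos_jump M y : levy_measure M ->
  M.-integrable setT (EFin \o cos_jump y).
Proof.
move=> /levy_measure_integrable iM.
apply: le_Rintegrable (integrableRZ (2 + `|y| ^+ 2) measurableT iM) => //.
  exact: measurable_cos_jump.
by move=> x _; exact: cos_jump_le.
Qed.

Lemma integrable_sin_jump M y : levy_measure M ->
  M.-integrable setT (EFin \o sin_jump y).
Proof.
move=> /levy_measure_integrable iM.
apply: le_Rintegrable (integrableRZ (2 + `|y| ^+ 2) measurableT iM) => //.
  exact: measurable_sin_jump.
by move=> x _; exact: sin_jump_le.
Qed.

Lemma continuous_ray_integral M (f : H -> borel H -> R) y : levy_measure M ->
  (forall z, measurable_fun setT (f z)) ->
  (forall z x, `|f z x| <= (2 + `|z| ^+ 2) * small_jump x) ->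
  (forall x, continuous (fun t : R => f (t *: y) x)) ->
  continuous (fun t : R => \int[M]_x f (t *: y) x).
Proof.
move=> lM mf fb cf t.
have iM := levy_measure_integrable lM.
(* On ]-c, c[, a neighbourhood of t, a single integrable majorant serves all parameters. *)
pose c := `|t| + 1.
pose g x := (2 + (c * `|y|) ^+ 2) * small_jump x.
have j0 x : 0 <= small_jump x by rewrite le_min ler01 sqr_ge0.
have fg s x : - c < s < c -> `|f (s *: y) x| <= g x.
  move=> /andP[s1 s2]; rewrite (le_trans (fb _ _))// ler_wpM2r// lerD2l normrZ.
  have sc : `|s| <= c by rewrite ler_norml !ltW.
  by rewrite lerXn2r ?nnegrE ?mulr_ge0 ?(le_trans _ sc)// ler_wpM2r.
have ig : M.-integrable setT (EFin \o g) by exact: integrableRZ.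
apply: (@continuity_under_integral _ _ _ M (fun s x => f (s *: y) x) setT _ (- c) c _ _ g) => //.
- move=> s; rewrite /= in_itv /= => sc; apply: le_Rintegrable ig => // x _; exact: fg.
- by apply/aeW => x _ s _; exact: cf.
- by move=> s; rewrite /= in_itv /= => sc; apply/aeW => x _; exact: fg.
- rewrite inE /= in_itv/= -ltr_norml /c ltrDl//.
Qed.

Lemma continuous_scaler_inner y x : continuous (fun t : R => ⟨t *: y, x⟩).
Proof.
rewrite (_ : (fun t => _) = fun t => t * ⟨y, x⟩); last first.
  by apply/funext => t; rewrite innerZl.
by move=> t; apply: cvgM; [exact: cvg_id|exact: cvg_cst].
Qed.

Lemma continuous_cos_jump y M : levy_measure M ->
  continuous (fun t : R => \int[M]_x cos_jump (t *: y) x).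
Proof.
move=> lM; apply: continuous_ray_integral => //.
- exact: measurable_cos_jump.
- exact: cos_jump_le.
- move=> x t; apply: cvgB; last exact: cvg_cst.
  apply: continuous_comp; first exact: continuous_scaler_inner.
  exact: continuous_cos.
Qed.

Lemma continuous_sin_jump y M : levy_measure M ->
  continuous (fun t : R => \int[M]_x sin_jump (t *: y) x).
Proof.
move=> lM; apply: continuous_ray_integral => //.
- exact: measurable_sin_jump.
- exact: sin_jump_le.
- move=> x t; apply: cvgB.
    apply: continuous_comp; first exact: continuous_scaler_inner.
    exact: continuous_sin.
  by apply: cvgM; [exact: continuous_scaler_inner|exact: cvg_cst].
Qed.

(** [S] is a bare function, so homogeneity is read off the covariance integral. Finiteness of that
    integral is not established at this point: if it is infinite, [fine] sends both sides to 0. *)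
Lemma gaussian_covariance_quad S y (t : R) : gaussian_covariance S ->
  ⟨S (t *: y), t *: y⟩ = t ^+ 2 * ⟨S y, y⟩.
Proof.
move=> [gamma [_ cov]]; rewrite !cov.
have [->|t0] := eqVneq t 0.
  rewrite expr0n mul0r (_ : (fun x => _) = cst 0) ?Rintegral_cst ?mul0r//.
  by apply/funext => x; rewrite scale0r inner0l mul0r.
rewrite /Rintegral.
under eq_integral => x _ do rewrite innerZl mulrACA EFinM.
rewrite ge0_integralZl//.
- rewrite -expr2; case: (integral _ _ _) => [r| |]//=.
  + by rewrite gt0_muley ?mulr0// lte_fin exprn_even_gt0.
  + by rewrite gt0_muleNy ?mulr0// lte_fin exprn_even_gt0.
- by apply/measurable_EFinP; apply: measurable_funM; exact: measurable_inner.
- by move=> x _; rewrite lee_fin -expr2 sqr_ge0.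
- by rewrite lee_fin -expr2 sqr_ge0.
Qed.

Lemma levy_khintchine_ray a S M y : gaussian_covariance S -> levy_measure M ->
  [/\ continuous (fun t : R => complex.Re (levy_khintchine a S M (t *: y))),
      continuous (fun t : R => complex.Im (levy_khintchine a S M (t *: y))) &
      levy_khintchine a S M 0 = 0].
Proof.
move=> gS lM; split.
- rewrite (_ : (fun t => _) = fun t =>
    - (t ^+ 2 * ⟨S y, y⟩ / 2) + \int[M]_x cos_jump (t *: y) x); last first.
    by apply/funext => t; rewrite levy_khintchineE /= gaussian_covariance_quad.
  move=> t; apply: cvgD; last exact: continuous_cos_jump.
  apply: cvgN; apply: cvgM; last exact: cvg_cst.
  apply: cvgM; last exact: cvg_cst; exact: exprn_continuous.
- rewrite (_ : (fun t => _) = fun t =>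
    ⟨t *: y, a⟩ + \int[M]_x sin_jump (t *: y) x); last first.
    by apply/funext => t; rewrite levy_khintchineE.
  move=> t; apply: cvgD; last exact: continuous_sin_jump.
  exact: continuous_scaler_inner.
- rewrite levy_khintchineE inner0l inner0r mul0r oppr0 !add0r.
  rewrite (_ : cos_jump 0 = cst 0); last first.
    by apply/funext => x; rewrite /cos_jump inner0l cos0 subrr.
  rewrite (_ : sin_jump 0 = cst 0); last first.
    by apply/funext => x; rewrite /sin_jump inner0l sin0 mul0r subrr.
  by rewrite !Rintegral_cst// !mul0r.
Qed.

(** The choice may fall on another triplet; its exponent is compared with the given one along the
    ray t y, from t = 0 to t = 1. *)
Lemma log_char_funE (mu : law) a S M : has_triplet mu a S M ->
  log_char_fun mu = levy_khintchine a S M.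
Proof.
move=> tr; rewrite /log_char_fun; case: xgetP; last first.
  by move=> /(_ (levy_khintchine a S M)) h; exfalso; apply: h; exists a, S, M.
move=> _ _ [a' [S' [M' [tr' ->]]]]; apply/funext => y.
have [gS lM cE] := tr; have [gS' lM' cE'] := tr'.
have [c1 c2 z] := levy_khintchine_ray a y gS lM.
have [c1' c2' z'] := levy_khintchine_ray a' y gS' lM'.
have := cexp_path_inj c1' c2' c1 c2.
rewrite scale0r z z' => /(_ erefl _ 1); rewrite !scale1r; apply => t.
by rewrite -cE -cE'.
Qed.

End levy_khintchine.

(** * Gaussian covariances *)

Section gaussian.
Context {R : realType} {H : separableHilbertType R}.
Local Notation law := (probability (borel H) R).
Local Notation conv := Defs.conv.

(** The lower bound follows from e^(-s) (1 + s) <= 1 and (1 - s + s^2) (1 + s) = 1 + s^3. *)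
Lemma expRN_bounds (s : R) : 0 <= s -> s - s ^+ 2 <= 1 - expR (- s) <= s.
Proof.
move=> s0; apply/andP; split; last by have := expR_ge1Dx (- s); lra.
have h : expR (- s) * (1 + s) <= 1.
  by rewrite expRN ler_pdivrMl ?expR_gt0// mulr1 expR_ge1Dx.
have e0 := expR_gt0 (- s).
have : expR (- s) <= 1 - s + s ^+ 2.
  rewrite -(@ler_pM2r _ (1 + s)) ?ltr_pwDl// (le_trans h)//.
  have : 0 <= s ^+ 3 by rewrite exprn_ge0.
  rewrite (_ : (1 - s + s ^+ 2) * (1 + s) = 1 + s ^+ 3); [lra|ring].
by lra.
Qed.

Lemma cvg_sin_quotient (u : R) :
  (sin (n.+1%:R^-1 * u) / n.+1%:R^-1) ^+ 2 @[n --> \oo] --> u ^+ 2.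
Proof.
suff h : sin (n.+1%:R^-1 * u) / n.+1%:R^-1 @[n --> \oo] --> u.
  exact: (cvgM h h).
have h1 : u - n.+1%:R^-1 * u ^+ 2 @[n --> \oo] --> u.
  rewrite -[X in _ --> X]subr0 -(mul0r (u ^+ 2)).
  by apply: cvgB; [exact: cvg_cst|apply: cvgMl; exact: cvg_harmonic].
have h2 : u + n.+1%:R^-1 * u ^+ 2 @[n --> \oo] --> u.
  rewrite -[X in _ --> X]addr0 -(mul0r (u ^+ 2)).
  by apply: cvgD; [exact: cvg_cst|apply: cvgMl; exact: cvg_harmonic].
apply: squeeze_cvgr h1 h2; apply: nearW => n.
set e := (n.+1%:R^-1 : R); have e0 : 0 < e by rewrite invr_gt0.
have := norm_sinB_le_sqr (e * u); rewrite ler_norml => /andP[h3 h4].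
by apply/andP; split; rewrite -(ler_pM2l e0) [e * (sin _ / e)]mulrCA divff ?gt_eqF// mulr1; lra.
Qed.

(* A covariance requires second moments, which are recovered
   from the characteristic function by letting h -> 0 in (sin (h u) / h)^2. *)
Lemma gaussian_second_moment (gamma : law) (q : H -> R) :
  (forall t y, q (t *: y) = t ^+ 2 * q y) ->
  (forall y, char_fun gamma y = (expR (- (q y / 2)))%:C) ->
  forall y, gamma.-integrable setT (EFin \o (fun x => ⟨y, x⟩ ^+ 2)) /\
    \int[gamma]_x (⟨y, x⟩ ^+ 2) = q y.
Proof.
move=> qZ cf y.
have cE z : \int[gamma]_x cos ⟨z, x⟩ = expR (- (q z / 2)).
  by have := cf z; rewrite char_funE => /eqP; rewrite eq_complex => /andP[/eqP ].
have mc z : measurable_fun setT (fun x : borel H => cos ⟨z, x⟩).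
  by have := measurable_cos_innerD z 0; under eq_fun do rewrite addr0.
have ms z : measurable_fun setT (fun x : borel H => sin ⟨z, x⟩).
  by have := measurable_sin_innerD z 0; under eq_fun do rewrite addr0.
have ic z : gamma.-integrable setT (EFin \o (fun x => cos ⟨z, x⟩)).
  by apply: (@bounded_integrable _ _ _ _ _ 1) => // x; exact: cos_max.
have q0 z : 0 <= q z.
  have : expR (- (q z / 2)) <= 1.
    rewrite -cE (le_trans (ler_norm _))// (le_trans (le_normr_Rintegral _ _))//.
    rewrite (le_trans (le_Rintegral (f2 := cst 1) _ _ _ _))//.
    - exact: (integrable_norm (ic z)).
    - exact: finite_measure_integrable_cst.
    - by move=> x _; exact: cos_max.
    - by rewrite Rintegral_probability_cst.
  by rewrite -expR0 ler_expR oppr_le0 pmulr_lge0.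
(* The double-angle formula makes this an affine function of cos <2 y / (n+1), x>, whose integral
   the characteristic function gives. *)
pose f n (x : borel H) : R := (sin (n.+1%:R^-1 * ⟨y, x⟩) / n.+1%:R^-1) ^+ 2.
have fE n x : f n x = (n.+1%:R ^+ 2 / 2) * (1 - cos ⟨(2 / n.+1%:R) *: y, x⟩).
  rewrite /f innerZl (_ : 2 / n.+1%:R * ⟨y, x⟩ = n.+1%:R^-1 * ⟨y, x⟩ *+ 2); last first.
    by rewrite mulr2n; field.
  rewrite cos_mulr2n cos2sin2 expr_div_n.
  by field.
have n0 n : (0 : R) < n.+1%:R by [].
have mf n : measurable_fun setT (f n).
  rewrite (funext (fE n)); apply: measurable_funM => //.
  by apply: measurable_funB => //; exact: mc.
have f0 n x : 0 <= f n x by exact: sqr_ge0.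
have cf_ x : f n x @[n --> \oo] --> ⟨y, x⟩ ^+ 2 by exact: cvg_sin_quotient.
(* This is q (2 y / (n+1)) / 2, the Gaussian exponent at the doubled argument. *)
pose s n := 2 * q y / n.+1%:R ^+ 2.
have s0 n : 0 <= s n by rewrite mulr_ge0 ?invr_ge0 ?exprn_ge0 ?mulr_ge0.
have ifn n : gamma.-integrable setT (EFin \o f n).
  rewrite (funext (fE n)); apply: integrableRZ => //; apply: integrableRB => //.
  exact: finite_measure_integrable_cst.
have If n : \int[gamma]_x f n x = n.+1%:R ^+ 2 / 2 * (1 - expR (- s n)).
  rewrite (funext (fE n)) RintegralZl//; last first.
    by apply: integrableRB => //; exact: finite_measure_integrable_cst.
  rewrite RintegralB//; last exact: finite_measure_integrable_cst.
  rewrite Rintegral_probability_cst cE qZ.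
  by congr (_ * (1 - expR (- _))); rewrite /s; field.
have Ifle n : \int[gamma]_x f n x <= q y.
  have /andP[_ h] := expRN_bounds (s0 n).
  have c0 : 0 <= n.+1%:R ^+ 2 / 2 :> R by rewrite divr_ge0 ?sqr_ge0.
  rewrite If (le_trans (ler_wpM2l c0 h))//.
  by rewrite /s le_eqVlt; apply/orP; left; apply/eqP; field.
have mu2 : measurable_fun setT (fun x : borel H => ⟨y, x⟩ ^+ 2).
  by apply: measurable_funX; exact: measurable_inner.
have iu2 : gamma.-integrable setT (EFin \o (fun x => ⟨y, x⟩ ^+ 2)).
  apply/integrableP; split; first exact/measurable_EFinP.
  (* Fatou, with the uniform bound q y on the integrals of [f n]. Integrability comes first because
     the square then dominates the [f n] in the exact limit. *)
  rewrite (eq_integral (fun x => limn_einf (fun n => (f n x)%:E))); last first.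
    move=> x _ /=; rewrite ger0_norm ?sqr_ge0//.
    have cfE : (f n x)%:E @[n --> \oo] --> (⟨y, x⟩ ^+ 2)%:E.
      by apply: cvg_EFin; [exact: nearW|exact: cf_].
    by rewrite is_cvg_limn_einfE ?(cvg_lim _ cfE)//; apply/cvg_ex; eexists; exact: cfE.
  apply: le_lt_trans (ltry (q y)); apply: (le_trans (fatou _ _ _ _)) => //.
  - by move=> n; exact/measurable_EFinP.
  - by move=> n x _; rewrite lee_fin.
  - apply: (le_trans (limn_einf_sup _)).
    rewrite limn_esup_lim; apply: lime_le; first exact: is_cvg_esups.
    apply: nearW => n; apply: ge_ereal_sup => _ [m _ <-].
    rewrite -[leLHS]fineK ?lee_fin; first exact: Ifle.
    exact: (integrable_fin_num measurableT (ifn m)).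
split=> //.
have [|||_ h] := @dominated_Rintegral _ _ _ gamma setT f (fun x => ⟨y, x⟩ ^+ 2)
  (fun x => ⟨y, x⟩ ^+ 2) measurableT mf.
- by move=> x _; exact: cf_.
- exact: iu2.
- move=> n x _; rewrite ger0_norm// /f.
  have nv0 : (0 : R) < n.+1%:R^-1 by rewrite invr_gt0.
  have hn : `|sin (n.+1%:R^-1 * ⟨y, x⟩) / n.+1%:R^-1| <= `|⟨y, x⟩|.
    rewrite normrM normfV (gtr0_norm nv0) ler_pdivrMr//.
    by rewrite (le_trans (norm_sin_le _))// normrM (gtr0_norm nv0) mulrC.
  rewrite -(real_normK (num_real (sin _ / _))) -(real_normK (num_real ⟨y, x⟩)).
  by rewrite lerXn2r// nnegrE.
apply: (cvg_unique _ h) => //.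
(* The bound s - s^2 yields the error 2 q(y)^2 / (n+1)^2, weakened to 1/(n+1) to use the harmonic
   sequence. *)
have h1 : q y - n.+1%:R^-1 * (2 * q y ^+ 2) @[n --> \oo] --> q y.
  rewrite -[X in _ --> X]subr0 -(mul0r (2 * q y ^+ 2)).
  by apply: cvgB; [exact: cvg_cst|apply: cvgMl; exact: cvg_harmonic].
apply: squeeze_cvgr h1 (cvg_cst (q y)); apply: nearW => n; rewrite Ifle andbT If.
have /andP[h2 _] := expRN_bounds (s0 n).
have c0 : 0 <= n.+1%:R ^+ 2 / 2 :> R by rewrite divr_ge0 ?sqr_ge0.
apply: (le_trans _ (ler_wpM2l c0 h2)).
rewrite (_ : _ * (s n - s n ^+ 2) = q y - n.+1%:R^-1 ^+ 2 * (2 * q y ^+ 2)); last first.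
  by rewrite /s; field.
rewrite lerD2l lerN2 ler_wpM2r ?mulr_ge0 ?sqr_ge0// expr2 ler_piMl//.
by rewrite invf_le1// ler1n.
Qed.

(** Polarisation under the integral sign, legitimate because the second moments are finite. *)
Lemma gaussian_polar (S : H -> H) y z : gaussian_covariance S ->
  ⟨S y, z⟩ = (⟨S (y + z), y + z⟩ - ⟨S y, y⟩ - ⟨S z, z⟩) / 2.
Proof.
move=> gS; have [gamma [cf cov]] := gS.
have sm u := gaussian_second_moment (fun t u => gaussian_covariance_quad u t gS) cf u.
have i2 u := (sm u).1; have e2 u : \int[gamma]_x (⟨u, x⟩ ^+ 2) = ⟨S u, u⟩ := (sm u).2.
rewrite -!e2 cov.
rewrite -RintegralB// -RintegralB//; last exact: integrableRB.
rewrite mulrC -RintegralZl//; last by do 2 (apply: integrableRB => //).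
by apply: eq_Rintegral => x _; rewrite innerDl; field.
Qed.

(** The characteristic function fixes the diagonal moments and polarity the mixed ones; so sums and
    multiples of covariances only require a law with the right characteristic function. *)
Lemma gaussian_covarianceP (S : H -> H) (gamma : law) :
  (forall y z, ⟨S y, z⟩ = (⟨S (y + z), y + z⟩ - ⟨S y, y⟩ - ⟨S z, z⟩) / 2) ->
  (forall t y, ⟨S (t *: y), t *: y⟩ = t ^+ 2 * ⟨S y, y⟩) ->
  (forall y, char_fun gamma y = (expR (- (⟨S y, y⟩ / 2)))%:C) ->
  gaussian_covariance S.
Proof.
move=> pol qZ cf; exists gamma; split => // y z.
have sm u := gaussian_second_moment qZ cf u.
have i2 u := (sm u).1; have e2 u : \int[gamma]_x (⟨u, x⟩ ^+ 2) = ⟨S u, u⟩ := (sm u).2.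
rewrite pol -!e2.
rewrite -RintegralB// -RintegralB//; last exact: integrableRB.
rewrite mulrC -RintegralZl//; last by do 2 (apply: integrableRB => //).
by apply: eq_Rintegral => x _; rewrite innerDl; field.
Qed.

Lemma gaussian_covarianceD (S1 S2 : H -> H) : gaussian_covariance S1 ->
  gaussian_covariance S2 -> gaussian_covariance (fun y : H => S1 y + S2 y).
Proof.
move=> g1 g2; have [gamma1 [c1 _]] := g1; have [gamma2 [c2 _]] := g2.
apply: (@gaussian_covarianceP _ (conv gamma1 gamma2)).
- move=> y z; rewrite innerDl (gaussian_polar y z g1) (gaussian_polar y z g2).
  by rewrite !(innerDl (S1 _)); field.
- by move=> t y; rewrite !innerDl !gaussian_covariance_quad// mulrDr.
- move=> y; rewrite char_fun_conv c1 c2 innerDl mulrDl opprD expRD.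
  by apply/eqP; rewrite eq_complex /= !mul0r !mulr0 subr0 addr0 !eqxx.
Qed.

Definition scaleH (c : R) (x : borel H) : borel H := c *: (x : H).

Lemma measurable_scaleH c : measurable_fun setT (scaleH c).
Proof.
apply: measurable_into_borel => y.
under eq_fun do rewrite /scaleH innerZr.
by apply: measurable_funM => //; exact: measurable_inner.
Qed.

HB.instance Definition _ c := isMeasurableFun.Build _ _ _ _ (scaleH c) (measurable_scaleH c).

Lemma char_fun_scale (mu : law) c y :
  char_fun (distribution mu (scaleH c)) y = char_fun mu (c *: y).
Proof.
rewrite !char_funE (@Rintegral_distribution _ _ _ _ _ _ _ 1); last 2 first.
- by have := measurable_cos_innerD y 0; under eq_fun do rewrite addr0.
- by move=> x; exact: cos_max.
rewrite (@Rintegral_distribution _ _ _ _ _ _ _ 1); last 2 first.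
- by have := measurable_sin_innerD y 0; under eq_fun do rewrite addr0.
- by move=> x; exact: sin_max.
congr (_ +i* _); apply: eq_Rintegral => x _; by rewrite /scaleH innerZr innerZl.
Qed.

Lemma gaussian_covarianceZ (S : H -> H) c : 0 <= c -> gaussian_covariance S ->
  gaussian_covariance (fun y : H => c *: S y).
Proof.
move=> c0 g; have [gamma [cf _]] := g.
(* Dilating a random vector by the square root of c multiplies its covariance by c. *)
apply: (@gaussian_covarianceP _ (distribution gamma (scaleH (Num.sqrt c)))).
- by move=> y z; rewrite !innerZl (gaussian_polar y z g); field.
- move=> t y; rewrite (innerZl c (S (t *: y))) (innerZl c (S y)).
  by rewrite gaussian_covariance_quad// mulrCA.
- by move=> y; rewrite char_fun_scale cf gaussian_covariance_quad// sqr_sqrtr// innerZl.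
Qed.

End gaussian.

(** * The measure rho and the mixture of Lévy measures *)

Section lebesgue_scaling.
Context {R : realType}.
Local Notation mu := (@lebesgue_measure R).
Local Notation D := (`]0, +oo[%classic : set R).

(** The image of Lebesgue measure under x |-> c x, multiplied by c, agrees with Lebesgue measure on
    half-open intervals, hence everywhere. *)
Lemma ge0_integral_scale (f : R -> \bar R) (c : R) : 0 < c ->
  measurable_fun setT f -> (forall x, (0 <= f x)%E) ->
  (\int[mu]_(x in D) f x = c%:E * \int[mu]_(x in D) f (c * x)%R)%E.
Proof.
move=> c0 mf f0.
pose phi : R -> measurableTypeR R := *%R c.
have mphi : measurable_fun setT phi by exact: measurable_funM.
have ci : 0 < c^-1 by rewrite invr_gt0.
pose m := mscale (NngNum (ltW c0)) (pushforward mu phi) :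
  {measure set (measurableTypeR R) -> \bar R}.
have E : (\int[mu]_(x in D) f x = \int[m mphi]_(x in D) f x)%E.
  apply: eq_measure_integral => A mA _.
  apply: lebesgue_measure_unique => // _ [[a b]] _ <- /=.
  rewrite /m /mscale /= /pushforward.
  have -> : phi @^-1` `]a, b]%classic = `](c^-1 * a), (c^-1 * b)]%classic.
    by apply/seteqP; split => x /=; rewrite !in_itv/= /phi ltr_pdivrMl// ler_pdivlMl.
  rewrite !lebesgue_measure_itv /= !lte_fin ltr_pM2l//; case: ifPn => _.
    by rewrite -!EFinB -EFinM -mulrBr mulrA divff ?gt_eqF// mul1r.
  by rewrite mule0.
rewrite E ge0_integral_mscale//; last exact: measurable_funTS.
rewrite ge0_integral_pushforward//; last exact: measurable_funTS.
congr (_ * integral _ _ _)%E; apply/seteqP; split => x /=; rewrite !in_itv/= !andbT /phi.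
  by rewrite pmulr_rgt0.
by rewrite pmulr_rgt0.
Qed.

Lemma Rintegral_scale (f : R -> R) (c : R) : 0 < c ->
  measurable_fun setT f -> mu.-integrable D (EFin \o f) ->
  mu.-integrable D (EFin \o (fun x => f (c * x))) /\
  \int[mu]_(x in D) f x = c * \int[mu]_(x in D) f (c * x).
Proof.
move=> c0 mf fi; have cn0 : c != 0 by rewrite gt_eqF.
have mEf : measurable_fun setT (EFin \o f) by exact/measurable_EFinP.
have mc : measurable_fun setT (fun x => f (c * x)).
  by apply: (measurableT_comp mf); exact: measurable_funM.
have ci : mu.-integrable D (EFin \o (fun x => f (c * x))).
  apply/integrableP; split; first by apply/measurable_funTS/measurable_EFinP.
  have /integrableP[_] := fi.
  rewrite (ge0_integral_scale c0 (f := fun x => `|(f x)%:E|%E))//; last first.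
    exact: measurableT_comp.
  by move=> h; rewrite -(@lte_pmul2l _ c%:E) ?lte_fin// (lt_le_trans h)// gt0_muley// lte_fin.
split=> //; rewrite /Rintegral.
rewrite integralE [in RHS]integralE.
rewrite (ge0_integral_scale c0 (f := ((EFin \o f)^\+)%E))//; last exact: measurable_funepos.
rewrite (ge0_integral_scale c0 (f := ((EFin \o f)^\-)%E))//; last exact: measurable_funeneg.
have p1 := integrable_pos_fin_num _ ci; have n1 := integrable_neg_fin_num _ ci.
have -> : (\int[mu]_(x in D) (EFin \o f)^\+ (c * x)%R =
  \int[mu]_(x in D) (EFin \o (fun x => f (c * x)%R))^\+ x)%E.
  by congr integral; exact: (esym (funepos_comp (EFin \o f) ( *%R c))).
have -> : (\int[mu]_(x in D) (EFin \o f)^\- (c * x)%R =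
  \int[mu]_(x in D) (EFin \o (fun x => f (c * x)%R))^\- x)%E.
  by congr integral; exact: (esym (funeneg_comp (EFin \o f) ( *%R c))).
rewrite -muleBr//; last by rewrite fin_num_adde_defl// fin_numN n1.
by rewrite fineM// fin_numB p1// n1.
Qed.

End lebesgue_scaling.

Section tempered_density.
Context {R : realType} (alpha : R).
Hypotheses (alpha_gt0 : 0 < alpha) (alpha_lt1 : alpha < 1).
Local Notation mu := (@lebesgue_measure R).
Local Notation D := (`]0, +oo[%classic : set R).

Lemma continuous_powR_gt0 (p x : R) :
  0 < x -> {for x, continuous (fun y : R => y `^ p)}.
Proof.
move=> x0; apply: differentiable_continuous; apply/derivable1_diffP.
by apply: derivable_powR; rewrite in_itv/= x0.
Qed.

Lemma integral_powR (a b p : R) : 0 < a -> a < b -> p != 0 ->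
  (\int[mu]_(t in `[a, b]) (t `^ (p - 1))%:E = ((b `^ p - a `^ p) / p)%:E)%E.
Proof.
move=> a0 ab p0; have b0 := lt_trans a0 ab.
rewrite (@continuous_FTC2 _ _ (fun t => p^-1 * t `^ p))//.
- by rewrite -EFinB -mulrBr mulrC.
- apply: continuous_in_subspaceT => x; rewrite inE /= in_itv/= => /andP[ax _].
  by apply: continuous_powR_gt0; exact: lt_le_trans ax.
- split.
  + move=> x; rewrite in_itv/= => /andP[ax _]; apply: derivableM => //.
    by apply: derivable_powR; rewrite in_itv/= (lt_trans a0 ax).
  + apply: cvg_at_right_filter; apply: cvgMr; exact: continuous_powR_gt0.
  + apply: cvg_at_left_filter; apply: cvgMr; exact: continuous_powR_gt0.
- move=> x; rewrite in_itv/= => /andP[ax _]; have x0 := lt_trans a0 ax.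
  rewrite derive1Ml; last by apply: derivable_powR; rewrite in_itv/= x0.
  by rewrite powR_derive1 ?in_itv/= ?x0// mulrA mulVf// mul1r.
Qed.

(* Dominates t * rho t and t^2 * rho t up to constants; it is integrable exactly
   because 0 < alpha < 1. *)
Definition tail_weight (t : R) : R := Num.min 1 t * t `^ (- alpha - 1).

Lemma tail_weight_ge0 t : 0 < t -> 0 <= tail_weight t.
Proof. by move=> t0; rewrite mulr_ge0 ?powR_ge0// le_min ler01 ltW. Qed.

Lemma measurable_tail_weight : measurable_fun setT tail_weight.
Proof.
apply: measurable_funM; first exact: measurable_minr.
exact: measurable_powR.
Qed.

Lemma tail_weight_lty : (\int[mu]_(t in D) (tail_weight t)%:E < +oo)%E.
Proof.
have mw (A : set R) : measurable_fun A (fun t => (tail_weight t)%:E).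
  by apply/measurable_EFinP/measurable_funTS; exact: measurable_tail_weight.
(* The index n+2 keeps 1 strictly inside, so both pieces below are nondegenerate intervals. *)
pose F (n : nat) : set R := `[n.+2%:R^-1, n.+2%:R]%classic.
(* The two terms are the integrals of t^(-alpha) over ]0, 1] and of t^(-alpha-1) over ]1, +oo[. *)
have F1 n : (\int[mu]_(t in F n) (tail_weight t)%:E <= ((1 - alpha)^-1 + alpha^-1)%:E)%E.
  have n1 : (1 : R) < n.+2%:R by rewrite ltr1n.
  have n0 : (0 : R) < n.+2%:R by [].
  have ni : (0 : R) < n.+2%:R^-1 by rewrite invr_gt0.
  have ni1 : n.+2%:R^-1 < (1 : R) by rewrite invf_lt1.
  have h1 : (\int[mu]_(t in `[n.+2%:R^-1%R, 1%R]) (tail_weight t)%:E <= ((1 - alpha)^-1)%:E)%E.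
    rewrite (@eq_integral _ _ _ mu _ (fun t => (t `^ (1 - alpha - 1))%:E)); last first.
      move=> x; rewrite inE /= in_itv/= => /andP[h1 h2]; congr EFin.
      have x0 := lt_le_trans ni h1.
      rewrite /tail_weight min_r// -{1}(powRr1 (ltW x0)) -powRD; last by rewrite (gt_eqF x0) implybT.
      by congr (_ `^ _); ring.
    rewrite integral_powR//; last by rewrite gt_eqF// subr_gt0.
    have b0 : 0 < 1 - alpha by rewrite subr_gt0.
    by rewrite lee_fin powR1 ler_pdivrMr// mulVf ?gt_eqF// lerBlDr lerDl powR_ge0.
  have h2 : (\int[mu]_(t in `]1%R, n.+2%:R%R]) (tail_weight t)%:E <= (alpha^-1)%:E)%E.
    rewrite (@eq_integral _ _ _ mu _ (fun t => (t `^ (- alpha - 1))%:E)); last first.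
      move=> x; rewrite inE /= in_itv/= => /andP[x1 _]; congr EFin.
      by rewrite /tail_weight min_l ?mul1r// ltW.
    rewrite integral_itv_obnd_cbnd; last first.
      by apply/measurable_EFinP/measurable_funTS; exact: measurable_powR.
    rewrite integral_powR ?oppr_eq0 ?gt_eqF// lee_fin powR1 invrN mulrN -mulNr opprB.
    rewrite ler_pdivrMr// mulVf ?gt_eqF// lerBlDr lerDl powR_ge0//.
  have -> : F n = `[n.+2%:R^-1, 1] `|` `]1, n.+2%:R].
    rewrite /F; apply/seteqP; split => x /=; rewrite !in_itv/=.
      by move=> /andP[-> ->]; rewrite andbT; case: (leP x 1) => h; [left|right].
    move=> [/andP[-> h]|/andP[h ->]]; first by rewrite (le_trans h (ltW n1)).
    by rewrite (ltW (lt_trans ni1 h)).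
  rewrite ge0_integral_setU//=; last 2 first.
  - move=> x; rewrite !in_itv/= => -[/andP[h _]|/andP[h _]]; rewrite lee_fin tail_weight_ge0//.
      exact: lt_le_trans h.
    exact: lt_trans h.
  - apply/disj_setPS => x [/=]; rewrite !in_itv/= => /andP[_ h] /andP[h' _].
    by rewrite leNgt h' in h.
  - by rewrite EFinD; apply: leeD; [exact: h1|exact: h2].
  - exact: mw.
have FD : \bigcup_n F n = D.
  apply/seteqP; split => [x [n _]|x] /=; rewrite /F /= !in_itv/= ?andbT.
    by move=> /andP[h _]; rewrite (lt_le_trans _ h)// invr_gt0.
  move=> x0; pose n := maxn (Num.truncn x) (Num.truncn x^-1).
  exists n => //=; rewrite in_itv/=; apply/andP; split.
    rewrite invf_ple ?posrE//; apply/ltW/(lt_le_trans (truncnS_gt _)).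
    by rewrite ler_nat ltnS; apply: leqW; exact: leq_maxr.
  apply/ltW/(lt_le_trans (truncnS_gt _)).
  by rewrite ler_nat ltnS; apply: leqW; exact: leq_maxl.
have h : (\int[mu]_(t in F n) (tail_weight t)%:E)%E @[n --> \oo] -->
    (\int[mu]_(t in D) (tail_weight t)%:E)%E.
  rewrite -FD; apply: ge0_nondecreasing_set_cvg_integral => //.
  - apply/nondecreasing_seqP => n; apply/subsetPset => x; rewrite /F /= !in_itv/=.
    move=> /andP[h1 h2]; rewrite (le_trans _ h1) ?(le_trans h2)// ?ler_nat//.
    by rewrite lef_pV2 ?posrE// ler_nat.
  - by move=> i; exact: measurable_itv.
  - by move=> i; exact: mw.
  - move=> i x; rewrite /F /= in_itv/= => /andP[h _]; rewrite lee_fin tail_weight_ge0//.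
    by rewrite (lt_le_trans _ h)// invr_gt0.
rewrite -(cvg_lim _ h)//; apply: le_lt_trans (ltry ((1 - alpha)^-1 + alpha^-1)).
by apply: lime_le; [apply/cvg_ex; eexists; exact: h|exact: nearW].
Qed.

Lemma integrable_tail_weight : mu.-integrable D (EFin \o tail_weight).
Proof.
apply/integrableP; split.
  by apply/measurable_EFinP/measurable_funTS; exact: measurable_tail_weight.
rewrite (@eq_integral _ _ _ mu _ (fun t => (tail_weight t)%:E)); first exact: tail_weight_lty.
by move=> x; rewrite inE /= in_itv/= andbT => x0; rewrite ger0_norm// tail_weight_ge0.
Qed.

(** Cut off at 0, so that it serves as a density on the whole line. *)
Definition pos_rho (t : R) : R := if 0 < t then rho alpha t else 0.

Lemma rho_ge0 t : 0 <= rho alpha t.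
Proof. by rewrite mulr_ge0 ?powR_ge0 ?expR_ge0. Qed.

Lemma pos_rho_ge0 t : 0 <= pos_rho t.
Proof. by rewrite /pos_rho; case: ifP => // _; exact: rho_ge0. Qed.

Lemma measurable_rho : measurable_fun setT (rho alpha).
Proof.
apply: measurable_funM; first exact: measurable_powR.
by apply: measurableT_comp => //; exact: measurable_funN.
Qed.

Lemma measurable_pos_rho : measurable_fun setT pos_rho.
Proof.
rewrite (_ : pos_rho = rho alpha \_ D); last first.
  by apply/funext => t; rewrite patchE /pos_rho mem_setE in_itv/= andbT.
by apply/(measurable_restrictT _ _).1 => //; apply: measurable_funTS; exact: measurable_rho.
Qed.

Lemma rho_le_powR t : 0 < t -> rho alpha t <= t `^ (- alpha - 1).
Proof.
by move=> t0; rewrite /rho ler_piMr ?powR_ge0// -expR0 ler_expR oppr_le0 ltW.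
Qed.

Lemma rho_mul_le t : 0 < t -> t * rho alpha t <= tail_weight t.
Proof.
move=> t0; rewrite /rho /tail_weight mulrCA [leRHS]mulrC; apply: ler_wpM2l; first exact: powR_ge0.
have te : t * expR (- t) <= 1.
  rewrite expRN ler_pdivrMr ?expR_gt0// mul1r (le_trans _ (expR_ge1Dx t))//.
  by rewrite lerDr.
have e1 : expR (- t) <= 1 by rewrite -expR0 ler_expR oppr_le0 ltW.
by rewrite le_min te/= ler_piMr// ltW.
Qed.

Lemma rho_sqr_mul_le t : 0 < t -> t ^+ 2 * rho alpha t <= 2 * tail_weight t.
Proof.
move=> t0; rewrite /rho /tail_weight mulrCA [leRHS]mulrA [leRHS]mulrC.
apply: ler_wpM2l; first exact: powR_ge0.
have te : t * expR (- t) <= 1.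
  rewrite expRN ler_pdivrMr ?expR_gt0// mul1r (le_trans _ (expR_ge1Dx t))//.
  by rewrite lerDr.
(* From e^t >= 1 + t^2 / 2. *)
have te2 : t ^+ 2 * expR (- t) <= 2.
  rewrite expRN ler_pdivrMr ?expR_gt0//.
  by have := expR_ge1Dxn 1 (ltW t0); rewrite /= !factS fact0 !mul1n /=; lra.
have e0 := expR_gt0 (- t).
have h : t ^+ 2 * expR (- t) <= 2 * t.
  by rewrite expr2 -mulrA (le_trans (ler_wpM2l (ltW t0) te))// mulr1; lra.
by case: (leP 1 t) => _; rewrite ?mulr1.
Qed.

(** The source of the moment of order alpha: bounding e^(-t) by 1 leaves a homogeneous density, and
    the substitution u = t c produces the factor c^alpha. *)
Lemma integral_min_rho_le (c : R) : 0 <= c ->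
  (\int[mu]_t (Num.min 1 (t * c) * pos_rho t)%:E <=
   (c `^ alpha)%:E * \int[mu]_(t in D) (tail_weight t)%:E)%E.
Proof.
move=> c0.
have E : (\int[mu]_t (Num.min 1 (t * c) * pos_rho t)%:E =
    \int[mu]_(t in D) (Num.min 1 (t * c) * rho alpha t)%:E)%E.
  rewrite [RHS]integral_mkcond; apply: eq_integral => t _.
  rewrite patchE mem_setE in_itv/= andbT /pos_rho; case: ifP => // _.
  by rewrite mulr0.
rewrite E; have [->|cn0] := eqVneq c 0.
  rewrite powR0 ?gt_eqF// mul0e integral0_eq// => t _.
  by rewrite mulr0 min_r// mul0r.
have cp : 0 < c by rewrite lt_neqAle eq_sym cn0.
(* The scaling formula asks for nonnegativity on the whole line, while [tail_weight] is controlled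
   for t > 0 only. *)
pose w t := Num.max 0 (tail_weight t).
have wE (t : R) : 0 < t -> w t = tail_weight t.
  by move=> t0; rewrite /w max_r// tail_weight_ge0.
have mw : measurable_fun setT w by apply: measurable_maxr => //; exact: measurable_tail_weight.
rewrite [X in (_ * X)%E](@eq_integral _ _ _ mu _ (fun t => (w t)%:E)); last first.
  by move=> t; rewrite inE /= in_itv/= andbT => /wE ->.
rewrite (ge0_integral_scale cp (f := fun t => (w t)%:E)); last 2 first.
- exact/measurable_EFinP.
- by move=> x; rewrite lee_fin le_max lexx.
rewrite [leRHS]muleA -EFinM -ge0_integralZl//; last 3 first.
- apply/measurable_EFinP/measurable_funTS; apply: (measurableT_comp mw).
  exact: measurable_funM.
- by move=> x _; rewrite lee_fin le_max lexx.
- by rewrite lee_fin mulr_ge0 ?powR_ge0.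
apply: ge0_le_integral => //.
- by move=> t /=; rewrite in_itv/= andbT => t0; rewrite lee_fin mulr_ge0 ?rho_ge0// le_min ler01 mulr_ge0// ltW.
- apply/measurable_EFinP/measurable_funTS; apply: measurable_funM; last exact: measurable_rho.
  by apply: measurable_minr => //; exact: measurable_funM.
- apply: measurable_funeM; apply/measurable_EFinP/measurable_funTS.
  by apply: (measurableT_comp mw); exact: measurable_funM.
- move=> t /=; rewrite in_itv/= andbT => t0.
  rewrite -EFinM lee_fin wE ?mulr_gt0// /tail_weight powRM ?(ltW t0)//.
  rewrite [leRHS](_ : _ = (c `^ alpha * c * c `^ (- alpha - 1)) *
    (Num.min 1 (t * c) * t `^ (- alpha - 1))); last by rewrite (mulrC c t); ring.
  have -> : c `^ alpha * c * c `^ (- alpha - 1) = 1.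
    rewrite -{2}(powRr1 (ltW cp)) -!powRD ?(gt_eqF cp) ?implybT//.
    by rewrite (_ : alpha + 1 + (- alpha - 1) = 0) ?powRr0//; ring.
  by rewrite mul1r ler_wpM2l ?rho_le_powR// le_min ler01 mulr_ge0// ltW.
Qed.

End tempered_density.

Section density.
Context d (T : measurableType d) {R : realType} (mu : {measure set T -> \bar R}).
Variable g : T -> R.
Hypotheses (mg : measurable_fun setT g) (g0 : forall x, 0 <= g x).
Local Open Scope ereal_scope.
Import HBNNSimple.

(** The integration formula passes from indicators to simple functions by linearity and to
    nonnegative functions by monotone convergence. *)
Lemma density_measure : exists N : {measure set T -> \bar R},
  forall f : T -> \bar R, measurable_fun setT f -> (forall x, 0 <= f x) ->
  \int[N]_x f x = \int[mu]_x (f x * (g x)%:E).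
Proof.
have mEg A : measurable_fun A (EFin \o g) by exact/measurable_EFinP/measurable_funTS.
have Eg0 x : 0 <= (g x)%:E by rewrite lee_fin.
pose n A := \int[mu]_(x in A) (g x)%:E.
have n0 : n set0 = 0 by exact: integral_set0.
have nge0 A : 0 <= n A by exact: integral_ge0.
have nsa : semi_sigma_additive n.
  move=> F mF tF mUF; rewrite /n ge0_integral_bigcup//.
  by apply: is_cvg_ereal_nneg_natsum_cond => k _ _; exact: nge0.
have [N NE] : exists N : {measure set T -> \bar R}, forall A, N A = n A.
  pose N : {measure set T -> \bar R} := HB.pack n (isMeasure.Build _ _ _ n n0 nge0 nsa).
  by exists N.
exists N => f mf f0.
pose f_ := nnsfun_approx measurableT mf.
have mf_ k A : measurable_fun A (fun x => (f_ k x)%:E).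
  by apply/measurable_EFinP/measurable_funTS.
transitivity (limn (fun k => \int[N]_x (f_ k x)%:E)).
  rewrite -monotone_convergence//=.
  - apply: eq_integral => x _; apply/esym/cvg_lim => //=.
    by apply: cvg_nnsfun_approx.
  - by move=> k x _; rewrite lee_fin.
  - by move=> x _ a b ab; rewrite lee_fin//; exact/lefP/nd_nnsfun_approx.
transitivity (limn (fun k => \int[mu]_x ((f_ k x)%:E * (g x)%:E))); last first.
  rewrite -monotone_convergence//=.
  - apply: eq_integral => x _; apply/cvg_lim => //=.
    by apply: cvgeZr => //; apply: cvg_nnsfun_approx.
  - by move=> k; apply: emeasurable_funM.
  - by move=> k x _; rewrite mule_ge0// lee_fin.
  - move=> x _ a b ab; rewrite lee_wpmul2r// lee_fin//.
    exact/lefP/nd_nnsfun_approx.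
congr (limn _); apply/funext => k.
set h := f_ k.
under [LHS]eq_integral do rewrite fimfunE -fsumEFin//.
rewrite [LHS]ge0_integral_fsum//; last 2 first.
  - by move=> r; apply/measurable_EFinP/measurable_funTS/measurable_funM.
  - by move=> r x _; rewrite EFinM nnfun_muleindic_ge0.
under [RHS]eq_integral.
  move=> x xD; rewrite fimfunE -fsumEFin// ge0_mule_fsuml; last first.
    by move=> r; rewrite EFinM nnfun_muleindic_ge0.
  over.
rewrite [RHS]ge0_integral_fsum//; last 2 first.
  - move=> r; apply: emeasurable_funM => //.
    by apply/measurable_EFinP/measurable_funTS/measurable_funM.
  - by move=> r x _; rewrite mule_ge0// EFinM nnfun_muleindic_ge0.
apply: eq_fsbigr => r rh.
have r0 : (0 <= r)%R by move: rh; rewrite inE => -[x _ <-].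
under [LHS]eq_integral do rewrite EFinM.
under [RHS]eq_integral do rewrite EFinM -muleA.
have mi : measurable_fun setT (fun x => (\1_(h @^-1` [set r]) x : R)%:E).
  by apply/measurable_EFinP.
rewrite [LHS]ge0_integralZl ?lee_fin//.
rewrite [RHS]ge0_integralZl ?lee_fin//; last 2 first.
- by apply: emeasurable_funM => //; exact: mEg.
- by move=> x _; rewrite mule_ge0// lee_fin.
congr (_ * _); rewrite integral_indic// setIT NE.
rewrite /n [LHS]integral_mkcond; apply: eq_integral => x _.
by rewrite patchE indicE; case: ifPn => _; rewrite ?mul1e ?mul0e.
Qed.

End density.

(** Repackages the measure with sigma-finiteness in its type, as product measures and Fubini
    require. *)
Lemma sigma_finite_measure_of d (T : measurableType d) (R : realType)
    (mu : {measure set T -> \bar R}) : sigma_finite setT mu ->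
  exists nu : {sigma_finite_measure set T -> \bar R},
    forall f, (\int[nu]_x f x = \int[mu]_x f x)%E.
Proof.
move=> musf; pose m A := mu A.
have m0 : m set0 = 0%E by exact: measure0.
have mge0 A : (0 <= m A)%E by exact: measure_ge0.
have msa : semi_sigma_additive m by exact: measure_semi_sigma_additive.
have msfin : sfinite_measure m by exact/sfinite_measure_sigma_finite.
pose nu : {sigma_finite_measure set T -> \bar R} :=
  HB.pack m (isMeasure.Build _ _ _ m m0 mge0 msa) (isSFinite.Build _ _ _ m msfin)
    (isSigmaFinite.Build _ _ _ m musf).
by exists nu => f; exact: eq_measure_integral.
Qed.

Section dilation.
Context {R : realType} {H : separableHilbertType R} (alpha : R).
Hypotheses (alpha_gt0 : 0 < alpha) (alpha_lt1 : alpha < 1).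
Local Notation lam := (@lebesgue_measure R).

(** Unlike [small_jump], linear near 0: the majorant for which jumps need no compensation. *)
Definition jump_size (x : borel H) : R := Num.min 1 `|x : H|.

Lemma jump_size_ge0 x : 0 <= jump_size x.
Proof. by rewrite le_min ler01 normr_ge0. Qed.

Lemma measurable_jump_size : measurable_fun setT jump_size.
Proof. by apply: measurable_minr => //; exact: measurable_norm. Qed.

(** By Markov's inequality the sets where [small_jump] is at least 1/(n+1) have finite mass; they
    exhaust H up to the null point 0, which is added to each. *)
Lemma levy_sigma_finite (M : {measure set (borel H) -> \bar R}) :
  levy_measure M -> sigma_finite setT M.
Proof.
move=> lM; have [M0 _] := lM.
have /integrableP[mj fin] := levy_measure_integrable lM.
have j0 (x : borel H) : 0 <= small_jump x by rewrite le_min ler01 sqr_ge0.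
pose G (n : nat) : set (borel H) := [set x | n.+1%:R^-1 <= small_jump x].
have mG n : measurable (G n).
  rewrite -[X in measurable X]setTI.
  have -> : G n = small_jump @^-1` `[n.+1%:R^-1, +oo[.
    by apply/seteqP; split => x /=; rewrite in_itv/= andbT.
  exact: measurable_small_jump.
have m0 : measurable ([set 0%R : H] : set (borel H)).
  by rewrite -[X in measurable X]setCK; apply: measurableC; exact: measurable_setN0.
exists (fun n => [set 0%R : H] `|` G n).
  apply/seteqP; split => // x _.
  have [->|x0] := eqVneq x (0 : H); first by exists 0%N => //; left.
  have jx : 0 < small_jump x by rewrite lt_min ltr01 exprn_gt0// normr_gt0.
  exists (Num.truncn (small_jump x)^-1) => //; right; rewrite /G /=.
  by rewrite invf_ple ?posrE//; exact/ltW/truncnS_gt.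
move=> n; split; first exact: measurableU.
suff MG : (M (G n) < +oo)%E.
  apply: (le_lt_trans (measureU2 _ _ _)) => //.
  by rewrite [X in (X + _)%E](_ : _ = 0%E)// add0e; exact: MG.
have -> : M (G n) = (\int[M]_x (\1_(G n) x)%:E)%E.
  by rewrite integral_indic// setIT.
apply: (@le_lt_trans _ _ (\int[M]_x (n.+1%:R%:E * (small_jump x)%:E))%E).
  apply: ge0_le_integral => //.
  - by apply/measurable_EFinP; exact: measurable_indic.
  - by apply: emeasurable_funM => //; apply/measurable_EFinP; exact: measurable_small_jump.
  - move=> x _; rewrite -EFinM lee_fin indicE; case: (boolP (x \in G n)) => [|_].
      by rewrite inE /G /= -ler_pdivrMl// mulr1.
    by rewrite mulr_ge0.
have mE : measurable_fun setT (fun x : borel H => (small_jump x)%:E).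
  by apply/measurable_EFinP; exact: measurable_small_jump.
rewrite ge0_integralZl ?lee_fin//.
rewrite lte_mul_pinfty// (le_lt_trans _ fin)//.
rewrite le_eqVlt; apply/orP; left; apply/eqP; apply: eq_integral => x _ /=.
  by rewrite ger0_norm.
by move=> x _; rewrite lee_fin.
Qed.

Variable M : {measure set (borel H) -> \bar R}.
Hypothesis levyM : levy_measure M.
Hypothesis momM :
  (\int[M]_(x in ~` [set 0%R : H]) (`|x : H| `^ alpha)%:E < +oo)%E.

Lemma moment_lty : (\int[M]_x (`|x : H| `^ alpha)%:E < +oo)%E.
Proof. by move: momM; rewrite integral_setN0// normr0 powR0// gt_eqF. Qed.

(** Inside the unit ball |x| <= |x|^alpha since alpha < 1; outside it 1 <= |x|^alpha since alpha >
    0. *)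
Lemma jump_size_le (x : borel H) : jump_size x <= `|x : H| `^ alpha.
Proof.
have [->|x0] := eqVneq x (0 : H); first by rewrite /jump_size normr0 min_r// powR_ge0.
rewrite /jump_size; case: (leP 1 `|x : H|) => x1.
  by rewrite -(powRr0 `|x : H|) ler_powR// ltW.
by apply: ger1_powR; [rewrite normr_gt0 x0 ltW|exact: ltW].
Qed.

Lemma measurable_norm_powR : measurable_fun setT (fun x : borel H => `|x : H| `^ alpha).
Proof. by apply: (measurableT_comp (measurable_powR _)); exact: measurable_norm. Qed.

Lemma integrable_jump_size : M.-integrable setT (EFin \o jump_size).
Proof.
apply: (@le_Rintegrable _ _ _ _ _ _ (fun x : borel H => `|x : H| `^ alpha)) => //.
- exact: measurable_jump_size.
- by move=> x _; rewrite ger0_norm ?jump_size_ge0// jump_size_le.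
- apply/integrableP; split; first by apply/measurable_EFinP; exact: measurable_norm_powR.
  under eq_integral => x _ do rewrite /= ger0_norm ?powR_ge0//.
  exact: moment_lty.
Qed.

Lemma jump_size_scale t (x : borel H) :
  jump_size (t *: (x : H)) <= (1 + `|t|) * jump_size x.
Proof.
rewrite /jump_size normrZ; have := normr_ge0 t; have := normr_ge0 (x : H).
move: `|t| `|x : H| => a b b0 a0.
case: (leP 1 b) => b1.
  by rewrite ge_min mulr1 lerDl a0.
by rewrite ge_min mulrDl mul1r (lerDr (a * b)) b0 orbT.
Qed.

(* M' is the image of rho(t) dt x M under (t, x) |-> t x, i.e. the Lévy measure of
   the random integral. *)
Lemma dilation_measure : exists M' : {measure set (borel H) -> \bar R},
  M' [set 0%R : H] = 0%E /\
  forall (f : borel H -> R) (C : R), measurable_fun setT f -> 0 <= C ->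
    (forall x, `|f x| <= C * jump_size x) ->
  [/\ M'.-integrable setT (EFin \o f),
      lam.-integrable setT
        (EFin \o (fun t => (\int[M]_x f (t *: (x : H))) * pos_rho alpha t)) &
      \int[M']_x f x = \int[lam]_t ((\int[M]_x f (t *: (x : H))) * pos_rho alpha t)].
Proof.
have [Ms MsI] := sigma_finite_measure_of (levy_sigma_finite levyM).
pose P := (lam \x Ms)%E.
pose g (z : measurableTypeR R * borel H) : R := pos_rho alpha z.1.
have mg : measurable_fun setT g.
  by apply: (measurableT_comp (measurable_pos_rho alpha)).
have g0 z : 0 <= g z by exact: pos_rho_ge0.
have [N NE] := density_measure P mg g0.
pose phi (z : measurableTypeR R * borel H) : borel H := z.1 *: (z.2 : H).
have mphi : measurable_fun setT phi.
  apply: measurable_into_borel => y; under eq_fun do rewrite /phi innerZr.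
  apply: measurable_funM => //.
  exact: (measurableT_comp (measurable_inner y)).
have [M' M'E] : exists M' : {measure set (borel H) -> \bar R},
    forall f, measurable_fun setT f -> (forall x, 0 <= f x)%E ->
    (\int[M']_x f x = \int[P]_z (f (phi z) * (g z)%:E))%E.
  pose M' := pushforward N phi : {measure set (borel H) -> \bar R}.
  exists (M' mphi) => f mf f0.
  transitivity (\int[N]_(z in phi @^-1` setT) (f \o phi) z)%E.
    exact: (ge0_integral_pushforward mphi N measurableT mf (fun y _ => f0 y)).
  rewrite preimage_setT NE// => [|z]; last exact: f0.
  exact: (measurableT_comp mf).
have m0 : measurable ([set 0%R : H] : set (borel H)).
  by rewrite -[X in measurable X]setCK; apply: measurableC; exact: measurable_setN0.
have M0 : M [set 0%R : H] = 0%E by case: levyM.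
exists M'; split.
  have mi : measurable_fun setT (fun x : borel H =>
      (\1_([set 0%R : H] : set (borel H)) x : R)%:E).
    by apply/measurable_EFinP; exact: measurable_indic.
  transitivity (\int[M']_x (\1_([set 0%R : H] : set (borel H)) x : R)%:E)%E.
    by rewrite integral_indic// setIT.
  rewrite M'E//.
  have mF : measurable_fun setT (fun z : measurableTypeR R * borel H =>
      ((\1_([set 0%R : H] : set (borel H)) (phi z) : R)%:E * (g z)%:E)%E).
    apply: emeasurable_funM; last exact/measurable_EFinP.
    apply/measurable_EFinP; apply: (measurableT_comp _ mphi).
    exact: measurable_indic.
  have F0 z : (0 <= (\1_([set 0%R : H] : set (borel H)) (phi z) : R)%:E * (g z)%:E)%E.
    by rewrite mule_ge0// lee_fin.
  rewrite fubini_tonelli2// MsI.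
  have mFF := @measurable_fun_fubini_tonelli_G _ _ _ _ _ lam _ mF F0.
  (* For x different from 0, t x = 0 forces t = 0, where the density vanishes, so the inner integral
     is 0; the remaining point x = 0 is null for [M]. *)
  rewrite -[RHS](null_set_integral m0 (measurable_funTS mFF) M0) [RHS]integral_mkcond.
  apply: eq_integral => x _; rewrite patchE; case: ifPn => //.
  rewrite notin_setE /= => x0; apply: integral0_eq => t _ /=.
  rewrite indicE /g /pos_rho; case: ifPn => [t0|_]; last by rewrite mule0.
  rewrite memNset ?mul0e//= => /eqP; rewrite scaler_eq0 gt_eqF//=.
  by move/eqP.
move=> f C mf C0 fC.
pose F (z : measurableTypeR R * borel H) : R := f (phi z) * g z.
have mF : measurable_fun setT F.
  by apply: measurable_funM => //; exact: (measurableT_comp mf).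
have FC z : `|F z| <= C * (Num.min 1 (z.1 * `|z.2 : H|) * pos_rho alpha z.1).
  rewrite /F normrM (ger0_norm (g0 z)) mulrA /g /pos_rho; case: ifPn => [t0|_].
    rewrite ler_wpM2r ?rho_ge0// (le_trans (fC _))//.
    by rewrite /jump_size /phi normrZ gtr0_norm.
  by rewrite !mulr0.
pose K := fine (\int[lam]_(t in `]0%R, +oo[) (tail_weight alpha t)%:E)%E.
have KE : (\int[lam]_(t in `]0%R, +oo[) (tail_weight alpha t)%:E = K%:E)%E.
  rewrite fineK// ge0_fin_numE ?tail_weight_lty//.
  apply: integral_ge0 => t /=; rewrite in_itv/= andbT => t0.
  by rewrite lee_fin tail_weight_ge0.
have K0 : 0 <= K.
  rewrite /K fine_ge0// integral_ge0// => t /=; rewrite in_itv/= andbT => t0.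
  by rewrite lee_fin tail_weight_ge0.
have mnp : measurable_fun setT (fun x : borel H => (`|x : H| `^ alpha)%:E).
  by apply/measurable_EFinP; exact: measurable_norm_powR.
(* Tonelli with t innermost: for fixed x the integral is at most C K |x|^alpha, which is integrable
   for [M]. *)
have iF : P.-integrable setT (EFin \o F).
  apply/integrable21ltyP; first exact/measurable_EFinP.
  apply: (@le_lt_trans _ _ (\int[Ms]_x ((C * K)%:E * (`|x : H| `^ alpha)%:E))%E).
    apply: ge0_le_integral => //.
    - by move=> x _; exact: integral_ge0.
    - apply: (@measurable_fun_fubini_tonelli_G _ _ _ _ _ lam (fun z => `|(F z)%:E|%E)) => //.
      by apply: measurableT_comp => //; exact/measurable_EFinP.
    - exact: emeasurable_funM.
    - move=> x _; have mfx : measurable_fun setT (fun t : R =>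
          (Num.min 1 (t * `|x : H|) * pos_rho alpha t)%:E).
        apply/measurable_EFinP; apply: measurable_funM; last exact: measurable_pos_rho.
        by apply: measurable_minr => //; exact: measurable_funM.
      have p0 t : 0 <= Num.min 1 (t * `|x : H|) * pos_rho alpha t.
        rewrite /pos_rho; case: ifPn => t0; last by rewrite mulr0.
        by rewrite mulr_ge0 ?rho_ge0// le_min ler01 mulr_ge0// ltW.
      apply: (@le_trans _ _ (\int[lam]_t (C%:E * (Num.min 1 (t * `|x : H|) * pos_rho alpha t)%:E))%E).
        apply: ge0_le_integral => //.
        + apply: measurableT_comp => //; apply/measurable_EFinP.
          exact: (measurableT_comp mF).
        + exact: emeasurable_funM.
        + by move=> t _; rewrite -EFinM abse_EFin lee_fin; exact: (FC (t, x)).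
      rewrite ge0_integralZl ?lee_fin//; last by move=> t _; rewrite lee_fin.
      rewrite EFinM -muleA lee_wpmul2l ?lee_fin//.
      by rewrite -KE muleC integral_min_rho_le.
  rewrite MsI ge0_integralZl ?lee_fin ?mulr_ge0//.
  by rewrite lte_mul_pinfty ?lee_fin ?mulr_ge0//; exact: moment_lty.
have iM' (h : borel H -> R) : measurable_fun setT h ->
    (forall x, `|h x| <= `|f x|) -> M'.-integrable setT (EFin \o h).
  move=> mh hf; apply/integrableP; split; first exact/measurable_EFinP.
  rewrite M'E//; last by apply: measurableT_comp => //; exact/measurable_EFinP.
  have /integrableP[_] := iF; apply: le_lt_trans; apply: ge0_le_integral => //.
  - by move=> z _; rewrite mule_ge0// lee_fin.
  - apply: emeasurable_funM; last exact/measurable_EFinP.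
    apply: measurableT_comp => //; apply/measurable_EFinP.
    exact: (measurableT_comp mh).
  - by apply: measurableT_comp => //; exact/measurable_EFinP.
  - move=> z _; rewrite -EFinM /= lee_fin /F normrM (ger0_norm (g0 z)).
    by rewrite ler_wpM2r.
have iPF (h : borel H -> R) : measurable_fun setT h ->
    (forall x, `|h x| <= `|f x|) ->
    P.-integrable setT (EFin \o (fun z => h (phi z) * g z)).
  move=> mh hf; apply: le_integrable iF => //.
    by apply/measurable_EFinP/measurable_funM => //; exact: (measurableT_comp mh).
  move=> z _; rewrite /= lee_fin /F !normrM ler_wpM2r//.
have ge0E (h : borel H -> R) : measurable_fun setT h -> (forall x, 0 <= h x) ->
    \int[M']_x h x = \int[P]_z (h (phi z) * g z).
  move=> mh h0; rewrite /Rintegral M'E//; last exact/measurable_EFinP.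
(* The formula defining [M'] covers nonnegative functions only, so the signed case is split. *)
pose fp x := Num.max (f x) 0; pose fn x := Num.max (- f x) 0.
have mfp : measurable_fun setT fp by exact: measurable_maxr.
have mfn : measurable_fun setT fn.
  by apply: measurable_maxr => //; exact: measurable_funN.
have fpn x : f x = fp x - fn x.
  by rewrite /fp /fn; case: (leP (f x) 0) => f0; case: (leP (- f x) 0) => f1; lra.
have fpf x : `|fp x| <= `|f x|.
  by rewrite /fp; case: (leP (f x) 0) => // _; rewrite normr0.
have fnf x : `|fn x| <= `|f x|.
  by rewrite /fn -[leRHS]normrN; case: (leP (- f x) 0) => // _; rewrite normr0.
have PE : \int[M']_x f x = \int[P]_z F z.
  rewrite (_ : f = fun x => fp x - fn x); last by apply/funext.
  rewrite RintegralB//; [|exact: iM'|exact: iM'].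
  rewrite !ge0E//; [|by move=> x; rewrite /fn le_max lexx orbT|by move=> x; rewrite /fp le_max lexx orbT].
  rewrite -RintegralB//; [|exact: iPF|exact: iPF].
  by apply: eq_Rintegral => z _; rewrite /F fpn mulrBl.
have iMt (t : R) : M.-integrable setT (EFin \o (fun x : borel H => f (t *: (x : H)))).
  apply: (le_Rintegrable _ _ _ (integrableRZ (C * (1 + `|t|)) measurableT integrable_jump_size)) => //.
    by apply: (measurableT_comp mf); exact: (measurable_scaleH t).
  move=> x _; rewrite (le_trans (fC _))// -mulrA ler_wpM2l//.
  exact: jump_size_scale.
have FE : fubini_F Ms (EFin \o F) =
    EFin \o (fun t => (\int[M]_x f (t *: (x : H))) * pos_rho alpha t).
  apply/funext => t; rewrite /fubini_F MsI /= /F /phi /g /=.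
  rewrite -(RintegralZr (pos_rho alpha t) measurableT (iMt t)).
  rewrite /Rintegral fineK//; apply: integrable_fin_num => //.
  under eq_fun do rewrite mulrC.
  exact: (integrableRZ (pos_rho alpha t) measurableT (iMt t)).
split.
- exact: iM'.
- by rewrite -FE; exact: integrable_fubini_F.
- by rewrite PE /Rintegral -(integral12_prod_meas1 iF) FE.
Qed.

End dilation.

Section small_jumps.
Context {R : realType} {H : separableHilbertType R}.
Implicit Types (N : {measure set (borel H) -> \bar R}) (y : H).

Lemma measurable_sin_inner y : measurable_fun setT (fun x : borel H => sin ⟨y, x⟩).
Proof.
apply: measurableT_comp; last exact: measurable_inner.
by apply: continuous_measurable_fun; exact: continuous_sin.
Qed.

Lemma cos_jump_le_size y x : `|cos_jump y x| <= (2 + `|y|) * jump_size x.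
Proof.
rewrite /cos_jump /jump_size; case: (leP 1 `|x : H|) => _.
  by rewrite mulr1 (le_trans (norm_cosB1_le2 _))// lerDl.
rewrite (le_trans (norm_cosB1_le _))// (le_trans (cauchy_schwarz _ _))//.
by rewrite ler_wpM2r// lerDr.
Qed.

Lemma sin_inner_le_size y (x : borel H) : `|sin ⟨y, x⟩| <= (1 + `|y|) * jump_size x.
Proof.
rewrite /jump_size; case: (leP 1 `|x : H|) => _.
  by rewrite mulr1 (le_trans (sin_max _))// lerDl.
rewrite (le_trans (norm_sin_le _))// (le_trans (cauchy_schwarz _ _))//.
by rewrite ler_wpM2r// lerDr.
Qed.

Lemma small_jump_le_size (x : borel H) : small_jump x <= jump_size x.
Proof.
rewrite /small_jump /jump_size le_min !ge_min lexx/=.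
case: (leP `|x : H| 1) => x1; last by rewrite (ltW x1).
by rewrite expr2 ler_piMr ?orbT.
Qed.

Lemma integrable_small_jump N : N.-integrable setT (EFin \o @jump_size R H) ->
  (\int[N]_(x in ~` [set 0%R : H]) (Num.min 1 (`|x : H| ^+ 2))%:E < +oo)%E.
Proof.
move=> iN; rewrite integral_setN0; last by rewrite normr0 expr0n min_r.
have iS : N.-integrable setT (EFin \o @small_jump R H).
  apply: le_Rintegrable iN => // [|x _]; first exact: measurable_small_jump.
  by rewrite ger0_norm ?small_jump_le_size// le_min ler01 sqr_ge0.
exact: (integrable_lty measurableT iS).
Qed.

(* Since jumps are absolutely summable (alpha < 1), the compensator is a bounded
   linear functional of y and can be absorbed into the drift. *)
Lemma uncompensated N : N.-integrable setT (EFin \o @jump_size R H) ->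
  exists b : H, forall y,
    N.-integrable setT (EFin \o (fun x : borel H => sin ⟨y, x⟩)) /\
    \int[N]_x sin_jump y x = \int[N]_x sin ⟨y, x⟩ - ⟨y, b⟩.
Proof.
move=> iN.
pose l0 y (x : borel H) : R := ⟨y, x⟩ * \1_([set x : H | `|x| <= 1] : set (borel H)) x.
have ml0 y : measurable_fun setT (l0 y).
  apply: measurable_funM; first exact: measurable_inner.
  by apply: measurable_indic; exact: measurable_unit_ball.
have l0b y x : `|l0 y x| <= `|y| * jump_size x.
  rewrite /l0 indicE /jump_size; have [x1|x1] := leP `|x : H| 1.
    by rewrite mem_set// mulr1 cauchy_schwarz.
  rewrite memNset /=; last by apply/negP; rewrite -ltNge.
  by rewrite mulr0 normr0 mulr_ge0.
have il0 y : N.-integrable setT (EFin \o l0 y).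
  apply: le_Rintegrable (integrableRZ `|y| measurableT iN) => // x _; exact: l0b.
have [||| b bE] := @riesz R H (fun y => \int[N]_x l0 y x) (\int[N]_x jump_size x).
- move=> x y; rewrite -(RintegralD measurableT (il0 x) (il0 y)).
  by apply: eq_Rintegral => z _; rewrite /l0 innerDl mulrDl.
- move=> c y; rewrite -(RintegralZl c measurableT (il0 y)).
  by apply: eq_Rintegral => z _; rewrite /l0 innerZl mulrA.
- move=> y; rewrite mulrC -(RintegralZl `|y| measurableT iN).
  rewrite (le_trans (le_normr_Rintegral measurableT (il0 y)))//.
  apply: le_Rintegral => //; first exact: integrable_norm (il0 y).
  exact: (integrableRZ `|y| measurableT iN).
exists b => y.
have isn : N.-integrable setT (EFin \o (fun x : borel H => sin ⟨y, x⟩)).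
  apply: le_Rintegrable (integrableRZ (1 + `|y|) measurableT iN) => //.
    exact: measurable_sin_inner.
  by move=> x _; exact: sin_inner_le_size.
by split=> //; rewrite bE -(RintegralB measurableT isn (il0 y)).
Qed.

End small_jumps.

(** * Mixtures of Lévy exponents *)

Section exponent_mixture.
Context {R : realType} {H : separableHilbertType R} (alpha : R).
Hypotheses (alpha_gt0 : 0 < alpha) (alpha_lt1 : alpha < 1).
Local Notation lam := (@lebesgue_measure R).
Local Notation D := (`]0, +oo[%classic : set R).

Lemma measurable_pos : measurable (D : set (measurableTypeR R)).
Proof. exact: measurable_itv. Qed.

Lemma Re_mul_real (z : R[i]) (r : R) : complex.Re (z * r%:C) = complex.Re z * r.
Proof. by case: z => a b /=; rewrite mulr0 subr0. Qed.

Lemma Im_mul_real (z : R[i]) (r : R) : complex.Im (z * r%:C) = complex.Im z * r.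
Proof. by case: z => a b /=; rewrite mulr0 add0r. Qed.

Lemma integrable_pos_rho (G : R -> R) :
  lam.-integrable setT (EFin \o (fun t => G t * pos_rho alpha t)) ->
  lam.-integrable D (EFin \o (fun t => G t * rho alpha t)) /\
  \int[lam]_(t in D) (G t * rho alpha t) = \int[lam]_t (G t * pos_rho alpha t).
Proof.
have E : (fun t => G t * pos_rho alpha t) = (fun t => G t * rho alpha t) \_ D.
  apply/funext => t; rewrite patchE mem_setE in_itv/= andbT /pos_rho.
  by case: ifP => // _; rewrite mulr0.
move=> iG; split; last by rewrite [LHS]Rintegral_mkcond -E.
rewrite (integrable_mkcond _ measurable_pos).
by rewrite restrict_EFin -E.
Qed.

Lemma integrable_rho_id : lam.-integrable D (EFin \o (fun t => t * rho alpha t)).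
Proof.
apply: le_Rintegrable (integrable_tail_weight alpha_gt0 alpha_lt1) => //.
  by apply: measurable_funTS; apply: measurable_funM => //; exact: measurable_rho.
move=> t; rewrite /= in_itv/= andbT => t0.
by rewrite ger0_norm ?rho_mul_le// mulr_ge0 ?rho_ge0// ltW.
Qed.

Lemma integrable_rho_sqr : lam.-integrable D (EFin \o (fun t => t ^+ 2 * rho alpha t)).
Proof.
have i2 := integrableRZ 2 measurable_pos (integrable_tail_weight alpha_gt0 alpha_lt1).
apply: le_Rintegrable i2 => //.
  apply: measurable_funTS; apply: measurable_funM; last exact: measurable_rho.
  exact: measurable_funX.
move=> t; rewrite /= in_itv/= andbT => t0.
by rewrite ger0_norm ?rho_sqr_mul_le// mulr_ge0 ?rho_ge0// sqr_ge0.
Qed.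

Lemma exponent_mixture (a : H) (S : H -> H) (M : {measure set (borel H) -> \bar R}) :
  gaussian_covariance S -> levy_measure M ->
  (\int[M]_(x in ~` [set 0%R : H]) (`|x : H| `^ alpha)%:E < +oo)%E ->
  exists a' S' (M' : {measure set (borel H) -> \bar R}),
  [/\ gaussian_covariance S', levy_measure M' &
    forall y,
      cintegrable lam D (fun t => levy_khintchine a S M (t *: y) * (rho alpha t)%:C) /\
      levy_khintchine a' S' M' y =
      cintegral lam D (fun t => levy_khintchine a S M (t *: y) * (rho alpha t)%:C)].
Proof.
move=> gS levyM momM.
have iJ := integrable_jump_size alpha_gt0 alpha_lt1 momM.
have [M' [M'0 M'E]] := dilation_measure alpha_gt0 alpha_lt1 levyM momM.
have iJ' : M'.-integrable setT (EFin \o @jump_size R H).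
  have [] // := M'E (@jump_size R H) 1 (measurable_jump_size) ler01 _.
  by move=> x; rewrite mul1r ger0_norm ?jump_size_ge0.
have [b bE] := uncompensated iJ; have [b' b'E] := uncompensated iJ'.
pose c1 := \int[lam]_(t in D) (t * rho alpha t).
pose c2 := \int[lam]_(t in D) (t ^+ 2 * rho alpha t).
have c20 : 0 <= c2 by apply: Rintegral_ge0 => t _; rewrite mulr_ge0 ?sqr_ge0 ?rho_ge0.
(* Without compensator the drift is a - b; mixing scales it by the first moment of rho and the
   covariance by the second. Adding b' restores the compensator, now for [M']. *)
exists (c1 *: (a - b) + b'), (fun y => c2 *: S y), M'; split.
- exact: gaussian_covarianceZ.
- by split=> //; exact: integrable_small_jump.
move=> y.
have [_ ic cE] := M'E (cos_jump y) (2 + `|y|) (measurable_cos_jump y)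
  (addr_ge0 (ler0n _ 2) (normr_ge0 y)) (cos_jump_le_size y).
have [_ is_ sE] := M'E (fun x => sin ⟨y, x⟩) (1 + `|y|) (measurable_sin_inner y)
  (addr_ge0 ler01 (normr_ge0 y)) (sin_inner_le_size y).
have [icD cED] := integrable_pos_rho ic; have [isD sED] := integrable_pos_rho is_.
have mD := measurable_pos.
have i1 := integrable_rho_id; have i2 := integrable_rho_sqr.
have ReE : (fun t => complex.Re (levy_khintchine a S M (t *: y) * (rho alpha t)%:C)) =
    (fun t => - (⟨S y, y⟩ / 2) * (t ^+ 2 * rho alpha t) +
       (\int[M]_x cos_jump y (t *: (x : H))) * rho alpha t).
  apply/funext => t; rewrite Re_mul_real levy_khintchineE /= gaussian_covariance_quad//.
  rewrite mulrDl; congr (_ + _); first by ring.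
  by congr (_ * _); apply: eq_Rintegral => x _; rewrite /cos_jump innerZl innerZr.
have ImE : (fun t => complex.Im (levy_khintchine a S M (t *: y) * (rho alpha t)%:C)) =
    (fun t => ⟨y, a - b⟩ * (t * rho alpha t) +
       (\int[M]_x sin ⟨y, t *: (x : H)⟩) * rho alpha t).
  apply/funext => t; rewrite Im_mul_real levy_khintchineE /= (bE (t *: y)).2.
  rewrite !innerZl innerBr (_ : \int[M]_x sin ⟨t *: y, x⟩ = \int[M]_x sin ⟨y, t *: (x : H)⟩).
    by ring.
  by apply: eq_Rintegral => x _; rewrite innerZl innerZr.
split.
  split; [rewrite ReE|rewrite ImE]; apply: integrableRD => //; exact: integrableRZ.
rewrite /cintegral ReE ImE levy_khintchineE (b'E y).2 innerZl.
rewrite (RintegralD mD (integrableRZ _ mD i2) icD).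
rewrite (RintegralD mD (integrableRZ _ mD i1) isD).
rewrite (RintegralZl _ mD i2) (RintegralZl _ mD i1) -/c1 -/c2 cED sED -cE -sE.
by congr (_ +i* _); [ring|rewrite (innerDr (c1 *: (a - b)) b') innerZr; ring].
Qed.

End exponent_mixture.

(** * Uniqueness of inverse Laplace transforms *)

Section laplace.
Context {R : realType}.
Local Notation lam := (@lebesgue_measure R).
Local Notation D := (`]0, +oo[%classic : set R).

(* With u = exp(-x), the power (1 + eta - (u - u0)^2)^n is a polynomial in u whose
   mass concentrates near u = u0, as in the proof of Weierstrass' theorem. *)
Lemma laplace_kernel (h : R -> R) (u0 eta : R) :
  (forall s : R, 0 < s -> lam.-integrable D (EFin \o (fun x => expR (- s * x) * h x)) /\
    \int[lam]_(x in D) (expR (- s * x) * h x) = 0) ->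
  forall n k : nat,
    let f x := expR (- (k.+1%:R) * x) * ((1 + eta - (expR (- x) - u0) ^+ 2) ^+ n * h x) in
    lam.-integrable D (EFin \o f) /\ \int[lam]_(x in D) f x = 0.
Proof.
move=> L; have mD := @measurable_pos R.
elim=> [|n IH] k /=.
  rewrite (_ : (fun x => _) = fun x => expR (- k.+1%:R * x) * h x); last first.
    by apply/funext => x; rewrite expr0 mul1r.
  exact: L.
pose f j x := expR (- (j.+1%:R) * x) * ((1 + eta - (expR (- x) - u0) ^+ 2) ^+ n * h x).
(* Expanding one factor in u = e^(-x) gives terms in 1, u and u^2, which raise k by 0, 1 and 2;
   hence the induction on n keeps k general. *)
have E : (fun x => expR (- k.+1%:R * x) * ((1 + eta - (expR (- x) - u0) ^+ 2) ^+ n.+1 * h x))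
   = (fun x => ((1 + eta - u0 ^+ 2) * f k x + 2 * u0 * f k.+1 x) - f k.+2 x).
  apply/funext => x; rewrite /f.
  have e1 : expR (- k.+2%:R * x) = expR (- k.+1%:R * x) * expR (- x).
    by rewrite -expRD; congr expR; rewrite -(natr1 k.+1); ring.
  have e2 : expR (- k.+3%:R * x) = expR (- k.+1%:R * x) * expR (- x) ^+ 2.
    rewrite expr2 -!expRD; congr expR; rewrite -(natr1 k.+2) -(natr1 k.+1); ring.
  by rewrite e1 e2 exprS; ring.
have [i0 z0] := IH k; have [i1 z1] := IH k.+1; have [i2 z2] := IH k.+2.
have j0 := integrableRZ (1 + eta - u0 ^+ 2) mD i0.
have j1 := integrableRZ (2 * u0) mD i1.
have j01 := integrableRD mD j0 j1.
rewrite E; split; first exact: (integrableRB mD j01 i2).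
rewrite (RintegralB mD j01 i2) (RintegralD mD j0 j1).
by rewrite (RintegralZl _ mD i0) (RintegralZl _ mD i1) z0 z1 z2 !mulr0 addr0 subr0.
Qed.

(** If h x0 > 0, the integral of h against the kernel gains at least a multiple of (1 + kap)^n near
    x0 and loses at most the fixed amount [K] elsewhere, yet it is 0 for every n. *)
Lemma laplace_le0 (h : R -> R) (x0 : R) : 0 < x0 -> {for x0, continuous h} ->
  (forall s : R, 0 < s -> lam.-integrable D (EFin \o (fun x => expR (- s * x) * h x)) /\
    \int[lam]_(x in D) (expR (- s * x) * h x) = 0) ->
  h x0 <= 0.
Proof.
move=> x00 ch L; rewrite leNgt; apply/negP => hx0.
have mD := @measurable_pos R.
pose eps := h x0 / 2.
have eps0 : 0 < eps by rewrite divr_gt0.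
have [r r0 hr] : exists2 r, 0 < r & forall x, `|x - x0| < r -> eps < h x.
  have /cvgrPdist_lt/(_ eps eps0)/nbhs_ballP[r /= r0 rh] := ch.
  exists r => // x xr; have := rh x; rewrite -ball_normE /= distrC => /(_ xr).
  by rewrite ltr_norml /eps => /andP[_]; lra.
pose u0 := expR (- x0).
have u00 : 0 < u0 by exact: expR_gt0.
have u01 : u0 < 1 by rewrite -expR0 ltr_expR oppr_lt0.
(* The radius r around x0, transported to the variable u = e^(-x). *)
pose delta := Num.min (expR (- (x0 - r)) - u0) (u0 - expR (- (x0 + r))).
have d0 : 0 < delta.
  by rewrite lt_min !subr_gt0 !ltr_expR !ltrN2 gtrBl ltrDl r0.
have near_x0 x : `|expR (- x) - u0| < delta -> eps < h x.
  rewrite lt_min => /andP[h1 h2]; apply: hr.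
  have l1 : expR (- x) < expR (- (x0 - r)).
    by have := le_lt_trans (ler_norm _) h1; lra.
  have l2 : expR (- (x0 + r)) < expR (- x).
    by rewrite -normrN in h2; have := le_lt_trans (ler_norm _) h2; lra.
  by move: l1 l2; rewrite !ltr_expR ltr_norml => l1 l2; apply/andP; split; lra.
(* For |u - u0| <= delta/2 the base is at least 1 + eta - delta^2/4 = 1 + kap; for |u - u0| >= delta
   it is at most 1 - delta^2/2; and it is nonnegative everywhere, as (u - u0)^2 <= 1. *)
pose eta := delta ^+ 2 / 2.
pose p x := 1 + eta - (expR (- x) - u0) ^+ 2.
pose kap := delta ^+ 2 / 4.
have kap0 : 0 < kap by rewrite divr_gt0// exprn_gt0.
(* One-sided, hence contained in the half-line; x |-> e^(-x) is 1-Lipschitz there, so u stays within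
   delta/2 of u0. *)
pose I := `[x0, x0 + delta / 2]%classic : set R.
have mI : measurable (I : set (measurableTypeR R)) by exact: measurable_itv.
have ID : I `<=` D.
  by move=> x /=; rewrite !in_itv/= andbT => /andP[h1 _]; exact: (lt_le_trans x00 h1).
have II_near x : I x -> `|expR (- x) - u0| <= delta / 2 /\
    expR (- (x0 + delta / 2)) <= expR (- x).
  rewrite /I /= in_itv/= => /andP[h1 h2]; split; last by rewrite ler_expR; lra.
  have le1 : expR (- x) <= u0 by rewrite ler_expR; lra.
  rewrite ler0_norm ?subr_le0// opprB.
  have -> : expR (- x) = u0 * expR (- (x - x0)) by rewrite -expRD; congr expR; ring.
  have /andP[_ h3] := @expRN_bounds R (x - x0) ltac:(lra).
  have s0 : 0 <= 1 - expR (- (x - x0)) by rewrite subr_ge0 -expR0 ler_expR; lra.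
  have -> : u0 - u0 * expR (- (x - x0)) = u0 * (1 - expR (- (x - x0))) by ring.
  by rewrite (le_trans (ler_wpM2r s0 (ltW u01)))// mul1r; lra.
pose c := eps * expR (- (x0 + delta / 2)).
have c0 : 0 < c by rewrite mulr_gt0// expR_gt0.
pose K := \int[lam]_(x in D) `|expR (- 1 * x) * h x|.
have iI : lam.-integrable D (EFin \o (\1_I : R -> R)).
  apply: (integrableS measurableT mD (@subsetT _ _)).
  exact: integrable_indic_itv.
have II : \int[lam]_(x in D) (\1_I x : R) = delta / 2.
  rewrite /Rintegral integral_indic// (setIidl ID).
  have mIE : lam I = (delta / 2)%:E.
    by rewrite /I lebesgue_measure_itv /= lte_fin ltrDl divr_gt0// -EFinB addrC addKr.
  exact: (congr1 fine mIE).
have [i1 _] := L 1 ltr01.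
have iA := integrable_norm i1.
have bound n : (1 + kap) ^+ n * (c * (delta / 2)) <= K.
  have [iF zF] := laplace_kernel u0 eta L n 0.
  rewrite -/(p _) in iF zF.
  have iG := integrableRZ ((1 + kap) ^+ n * c) mD iI.
  have iGA := integrableRB mD iG iA.
  (* Pointwise comparison with the kernel integrand, in three zones: beyond delta it is at least
     -|e^(-x) h|, within delta it is nonnegative, and on [I] it is at least c (1 + kap)^n. *)
  have : \int[lam]_(x in D) ((1 + kap) ^+ n * c * \1_I x - `|expR (- 1 * x) * h x|) <= 0.
    move: (lexx (0 : R)); rewrite -{1}zF; apply: le_trans.
    apply: (le_Rintegral mD iGA iF) => x /=; rewrite in_itv/= andbT => x_gt0.
    rewrite -/(p x) lerBlDr.
    have ex0 : 0 < expR (- 1 * x) by exact: expR_gt0.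
    have eE : expR (- x) = expR (- 1 * x) by rewrite mulN1r.
    have ex1 : expR (- x) < 1 by rewrite -expR0 ltr_expR oppr_lt0.
    have ex2 : 0 < expR (- x) by exact: expR_gt0.
    have sq1 : (expR (- x) - u0) ^+ 2 <= 1.
      by rewrite -real_normK ?num_real// expr_le1// ler_norml; apply/andP; split; lra.
    have p0 : 0 <= p x.
      by have := sqr_ge0 delta; rewrite /p /eta; move: sq1; set q := _ ^+ 2; lra.
    have ne0 : 0 <= `|expR (- 1 * x) * h x| by [].
    have [xd|xd] := ltP `|expR (- x) - u0| delta; last first.
      rewrite indicE memNset ?mulr0; last first.
        move=> /II_near[h1 _]; have := le_trans xd h1; lra.
      have p1 : p x <= 1.
        have : delta ^+ 2 <= (expR (- x) - u0) ^+ 2.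
          by rewrite -[leRHS]real_normK ?num_real// lerXn2r// nnegrE// ltW.
        by have := sqr_ge0 delta; rewrite /p /eta; set q := (_ - u0) ^+ 2; lra.
      have pn1 : `|p x ^+ n| <= 1 by rewrite normrX ger0_norm// exprn_ile1.
      have : `|expR (- 1 * x) * (p x ^+ n * h x)| <= `|expR (- 1 * x) * h x|.
        rewrite mulrCA [leLHS]normrM ler_piMl//.
      by rewrite ler_norml => /andP[h1 _]; lra.
    have hx := near_x0 _ xd.
    have fge0 : 0 <= expR (- 1 * x) * (p x ^+ n * h x).
      by rewrite mulr_ge0 ?(ltW ex0)// mulr_ge0 ?exprn_ge0// ltW// (lt_trans eps0).
    rewrite indicE; have [xI|xI] := boolP (x \in I); last by rewrite mulr0 addr_ge0.
    rewrite mulr1 -[leLHS]addr0; apply: lerD => //.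
    move: xI; rewrite inE => /II_near[h1 h2].
    have px : 1 + kap <= p x.
      have : (expR (- x) - u0) ^+ 2 <= (delta / 2) ^+ 2.
        by rewrite -[leLHS]real_normK ?num_real// lerXn2r// nnegrE// divr_ge0// ltW.
      have -> : (delta / 2) ^+ 2 = kap by rewrite /kap expr_div_n; congr (_ / _); ring.
      rewrite /p /eta (_ : delta ^+ 2 / 2 = kap + kap); last by rewrite /kap; field.
      by set q := _ ^+ 2; lra.
    rewrite [leRHS]mulrCA; apply: ler_pM.
    - by rewrite exprn_ge0// addr_ge0// ltW.
    - exact: ltW.
    - by rewrite lerXn2r// nnegrE// addr_ge0// ltW.
    - by rewrite /c mulrC; apply: ler_pM; [exact: ltW (expR_gt0 _)|exact: ltW|rewrite -eE|exact: ltW].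
  rewrite (RintegralB mD iG iA) (RintegralZl _ mD iI) II -/K; lra.
have bern n : 1 + n%:R * kap <= (1 + kap) ^+ n.
  elim: n => [|n IH]; first by rewrite mul0r addr0 expr0.
  rewrite exprSr; have k1 : 0 <= 1 + kap by rewrite addr_ge0// ltW.
  apply: (le_trans _ (ler_wpM2r k1 IH)); rewrite -natr1.
  have : 0 <= n%:R * kap ^+ 2 :> R by rewrite mulr_ge0// sqr_ge0.
  by rewrite expr2; lra.
pose C := c * (delta / 2).
have C0 : 0 < C by rewrite mulr_gt0// divr_gt0.
(* Chosen so that n kap C > K, which contradicts [bound] through Bernoulli's inequality. *)
pose n := (Num.truncn (K / (kap * C))).+1.
have : K / (kap * C) < n%:R by exact: truncnS_gt.
have kC : 0 < kap * C by exact: mulr_gt0.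
rewrite (ltr_pdivrMr _ _ kC) mulrA => h1.
have := bound n; rewrite -/C => h2.
have h3 := ler_wpM2r (ltW C0) (bern n).
suff : K < K by rewrite ltxx.
apply: (lt_le_trans h1); apply: le_trans h2; apply: le_trans h3.
by rewrite mulrDl mul1r lerDr ltW.
Qed.

Lemma laplace_eq0 (h : R -> R) : {in `]0, +oo[, continuous h} ->
  (forall s : R, 0 < s -> lam.-integrable D (EFin \o (fun x => expR (- s * x) * h x)) /\
    \int[lam]_(x in D) (expR (- s * x) * h x) = 0) ->
  forall x, 0 < x -> h x = 0.
Proof.
move=> ch L x x0; have cx : {for x, continuous h} by apply: ch; rewrite in_itv/= x0.
apply/eqP; rewrite eq_le; apply/andP; split; first exact: laplace_le0 L.
rewrite -oppr_le0; apply: (@laplace_le0 (\- h)) => //; first exact: cvgN.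
move=> s s0; have [i z] := L s s0; have mD := @measurable_pos R.
rewrite (_ : (fun x => _) = fun x => -1 * (expR (- s * x) * h x)); last first.
  by apply/funext => t /=; ring.
split; first exact: integrableRZ.
by rewrite (RintegralZl _ mD i) z mulr0.
Qed.

Lemma inverse_laplace_inj (F f g : R -> R[i]) :
  is_inverse_laplace F f -> is_inverse_laplace F g ->
  forall x, 0 < x -> f x = g x.
Proof.
move=> [rf mf Lf] [rg mg Lg] x x0; have mD := @measurable_pos R.
have Re_e s (z : R[i]) t : complex.Re ((expR (- s * t))%:C * z) = expR (- s * t) * complex.Re z.
  by case: z => a b /=; rewrite mul0r subr0.
have Im_e s (z : R[i]) t : complex.Im ((expR (- s * t))%:C * z) = expR (- s * t) * complex.Im z.
  by case: z => a b /=; rewrite mul0r addr0.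
apply/eqP; rewrite eq_complex -subr_eq0 -[X in _ && X]subr_eq0; apply/andP; split; apply/eqP.
- apply: (@laplace_eq0 (fun t => complex.Re (f t) - complex.Re (g t))) => //.
    by move=> t t0; apply: cvgB; [exact: rf|exact: rg].
  move=> s s0; have [[i1 _] e1] := Lf s s0; have [[i2 _] e2] := Lg s s0.
  have E : complex.Re (cintegral lam D (fun t => (expR (- s * t))%:C * f t)) =
      complex.Re (cintegral lam D (fun t => (expR (- s * t))%:C * g t)) by rewrite e1 e2.
  rewrite (_ : (fun t => _) = (fun t => complex.Re ((expR (- s * t))%:C * f t) -
    complex.Re ((expR (- s * t))%:C * g t))); last first.
    by apply/funext => t; rewrite !Re_e mulrBr.
  split; first exact: integrableRB.
  by rewrite (RintegralB mD i1 i2); apply/eqP; rewrite subr_eq0; apply/eqP.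
- apply: (@laplace_eq0 (fun t => complex.Im (f t) - complex.Im (g t))) => //.
    by move=> t t0; apply: cvgB; [exact: mf|exact: mg].
  move=> s s0; have [[_ i1] e1] := Lf s s0; have [[_ i2] e2] := Lg s s0.
  have E : complex.Im (cintegral lam D (fun t => (expR (- s * t))%:C * f t)) =
      complex.Im (cintegral lam D (fun t => (expR (- s * t))%:C * g t)) by rewrite e1 e2.
  rewrite (_ : (fun t => _) = (fun t => complex.Im ((expR (- s * t))%:C * f t) -
    complex.Im ((expR (- s * t))%:C * g t))); last first.
    by apply/funext => t; rewrite !Im_e mulrBr.
  split; first exact: integrableRB.
  by rewrite (RintegralB mD i1 i2); apply/eqP; rewrite subr_eq0; apply/eqP.
Qed.

(** An explicit transform shows that [xget] does not fall back on its default; uniqueness then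
    identifies the chosen function on the half-line, which contains x = 1. *)
Lemma inverse_laplaceP (F f : R -> R[i]) : is_inverse_laplace F f ->
  is_inverse_laplace F (inverse_laplace F) /\
  forall x, 0 < x -> inverse_laplace F x = f x.
Proof.
move=> Ff; have h : is_inverse_laplace F (inverse_laplace F).
  by rewrite /inverse_laplace; case: xgetP => [g _ //|/(_ f)].
by split=> // x x0; exact: (inverse_laplace_inj h Ff).
Qed.

End laplace.

(** * The random integral mapping *)

Section triplets_of_convolutions.
Context {R : realType} {H : separableHilbertType R}.
Local Notation law := (probability (borel H) R).
Local Notation conv := Defs.conv.
Implicit Types (mu nu : law) (M : {measure set (borel H) -> \bar R}) (y : H).

Lemma Rintegral_measure_add M1 M2 (f : borel H -> R) :
  M1.-integrable setT (EFin \o f) -> M2.-integrable setT (EFin \o f) ->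
  \int[measure_add M1 M2]_x f x = \int[M1]_x f x + \int[M2]_x f x.
Proof.
move=> i1 i2; rewrite /Rintegral integral_measure_add//.
  by rewrite fineD//; exact: integrable_fin_num.
Qed.

Lemma levy_measure_add M1 M2 : levy_measure M1 -> levy_measure M2 ->
  levy_measure (measure_add M1 M2).
Proof.
move=> [z1 l1] [z2 l2]; split.
  by apply: (etrans (measure_addE M1 M2 _)); rewrite z1 z2 adde0.
have mS : measurable_fun (~` [set 0%R : H] : set (borel H))
    (fun x : borel H => (Num.min 1 (`|x : H| ^+ 2))%:E).
  by apply/measurable_EFinP/measurable_funTS; exact: measurable_small_jump.
rewrite (ge0_integral_measure_add M1 M2 measurable_setN0 _ mS).
  by apply: lte_add_pinfty; [exact: l1|exact: l2].
by move=> x _; rewrite lee_fin le_min ler01 sqr_ge0.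
Qed.

Lemma levy_khintchineD a1 a2 S1 S2 M1 M2 y : levy_measure M1 -> levy_measure M2 ->
  levy_khintchine (a1 + a2) (fun z : H => S1 z + S2 z) (measure_add M1 M2) y =
  levy_khintchine a1 S1 M1 y + levy_khintchine a2 S2 M2 y.
Proof.
move=> l1 l2; rewrite !levy_khintchineE innerDl innerDr.
rewrite !Rintegral_measure_add; try exact: integrable_cos_jump; try exact: integrable_sin_jump.
by apply/eqP; rewrite eq_complex /=; apply/andP; split; apply/eqP; ring.
Qed.

Lemma has_triplet_conv mu1 mu2 a1 a2 S1 S2 M1 M2 :
  has_triplet mu1 a1 S1 M1 -> has_triplet mu2 a2 S2 M2 ->
  has_triplet (conv mu1 mu2) (a1 + a2) (fun z : H => S1 z + S2 z) (measure_add M1 M2).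
Proof.
move=> [g1 l1 c1] [g2 l2 c2]; split.
- exact: gaussian_covarianceD.
- exact: levy_measure_add.
- by move=> y; rewrite char_fun_conv c1 c2 levy_khintchineD// cexpD.
Qed.

Lemma ID_conv alpha : conv_closed (@ID R H alpha).
Proof.
move=> mu1 mu2 [d1 [a1 [S1 [M1 [t1 m1]]]]] [d2 [a2 [S2 [M2 [t2 m2]]]]]; split.
  exact: infinitely_divisible_conv.
exists (a1 + a2), (fun z => S1 z + S2 z), (measure_add M1 M2); split.
  exact: has_triplet_conv.
have mS : measurable_fun (~` [set 0%R : H] : set (borel H))
    (fun x : borel H => (`|x : H| `^ alpha)%:E).
  apply/measurable_EFinP/measurable_funTS.
  by apply: (measurableT_comp (measurable_powR _)); exact: measurable_norm.
rewrite (ge0_integral_measure_add M1 M2 measurable_setN0 _ mS).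
  by apply: lte_add_pinfty; [exact: m1|exact: m2].
by move=> x _; rewrite lee_fin powR_ge0.
Qed.

Lemma log_char_fun_conv alpha mu1 mu2 y : ID alpha mu1 -> ID alpha mu2 ->
  log_char_fun (conv mu1 mu2) y = log_char_fun mu1 y + log_char_fun mu2 y.
Proof.
move=> [_ [a1 [S1 [M1 [t1 _]]]]] [_ [a2 [S2 [M2 [t2 _]]]]].
rewrite (log_char_funE t1) (log_char_funE t2) (log_char_funE (has_triplet_conv t1 t2)).
by case: t1 t2 => _ l1 _ [_ l2 _]; exact: levy_khintchineD.
Qed.

End triplets_of_convolutions.

Section random_integrals.
Context {R : realType} {H : separableHilbertType R} (alpha : R).
Local Notation law := (probability (borel H) R).
Local Notation conv := Defs.conv.
Local Notation lam := (@lebesgue_measure R).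
Local Notation D := (`]0, +oo[%classic : set R).
Implicit Types (mu nu : law) (y : H).

Lemma cvg_truncated_Rintegral (g : R -> R) : lam.-integrable D (EFin \o g) ->
  \int[lam]_(t in `]n.+1%:R^-1, n.+2%:R]) g t @[n --> \oo] --> \int[lam]_(t in D) g t.
Proof.
move=> ig; have mD := @measurable_pos R.
(* The upper end n+2 keeps the lower end strictly below it already at n = 0. *)
pose I n : set R := `]n.+1%:R^-1, n.+2%:R]%classic.
have mI n : measurable (I n : set (measurableTypeR R)) by exact: measurable_itv.
have DI n : D `&` I n = I n.
  apply/setIidr => x; rewrite /I /= !in_itv/= andbT => /andP[h _].
  by rewrite (lt_trans _ h)// invr_gt0.
rewrite (_ : (fun n => _) = fun n => \int[lam]_(t in D) (g \_ (I n)) t); last first.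
  by apply/funext => n; rewrite -Rintegral_mkcondr DI.
have mg : measurable_fun D g by apply/measurable_EFinP; exact: (measurable_int lam).
apply: (@dominated_Rintegral _ _ _ lam D (fun n => g \_ (I n)) g (fun t => `|g t|) mD _ _ _ _).2.
- move=> n; apply: (iffLR (measurable_restrict g (mI n) mD)).
  by apply: measurable_funS mg => // x [].
- move=> t; rewrite /= in_itv/= andbT => t0; apply: cvg_near_cst; near=> n.
  rewrite patchE mem_set// /I /= in_itv/=; apply/andP; split.
    rewrite invf_plt ?posrE// (lt_le_trans (truncnS_gt _))// ler_nat ltnS.
    by near: n; exact: nbhs_infty_ge.
  rewrite ltW// (lt_le_trans (truncnS_gt _))// ler_nat ltnS leqW//.
  by near: n; exact: nbhs_infty_ge.
- exact: integrable_norm.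
- by move=> n x _; rewrite patchE; case: ifP => // _; rewrite normr0.
Unshelve. all: by end_near. Qed.

Lemma cvg_in_distribution_seq (nu_ : R -> R -> law) nu (f : H -> R) :
  cvg_in_distribution nu_ nu -> continuous f -> (forall x, `|f x| <= 1) ->
  \int[nu_ n.+1%:R^-1 n.+2%:R]_x f x @[n --> \oo] --> \int[nu]_x f x.
Proof.
move=> nunu cf f1.
have bf : [bounded f x | x in [set: H]].
  by exists 1; split=> // m m1 x _ /=; exact: (le_trans (f1 x) (ltW m1)).
have h := nunu f cf bf.
apply: (cvg_comp (fun n : nat => (n.+1%:R^-1 : R, n.+2%:R : R)) _ _ h).
apply: cvg_pair => /=.
  move=> A A0.
  have A0' : nbhs (0 : R) (fun x : R => 0 < x -> A x) by exact: A0.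
  have h2 : (\oo : set_system nat) (fun n => 0 < (harmonic n : R) -> A (harmonic n)).
    exact: ((@cvg_harmonic R) _ A0').
  have : (\oo : set_system nat) (fun n => A (harmonic n)).
    by apply: filterS h2 => n; apply; exact: harmonic_gt0.
  by [].
apply/cvgryPge => A; near=> n.
rewrite (le_trans (ltW (truncnS_gt A)))// ler_nat ltnS leqW//.
by near: n; exact: nbhs_infty_ge.
Unshelve. all: by end_near. Qed.

(** Weak convergence is tested on cos <y, x> and sin <y, x> along one sequence of truncations; the
    truncated exponents converge by integrability, and the complex exponential is continuous. *)
Lemma char_fun_random_integral d (Omega : measurableType d)
    (P : probability Omega R) (Y : R -> {RV P >-> borel H}) nu y :
  law_random_integral alpha Y nu ->
  cintegrable lam D (fun t =>
    log_char_fun (distribution P (Y 1)) (t *: y) * (rho alpha t)%:C) ->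
  char_fun nu y = cexp (cintegral lam D (fun t =>
    log_char_fun (distribution P (Y 1)) (t *: y) * (rho alpha t)%:C)).
Proof.
move=> [nu_ [nu_E nu_nu]] [iRe iIm].
set psi := log_char_fun _ in nu_E iRe iIm *.
pose g t := psi (t *: y) * (rho alpha t)%:C.
pose w n := cintegral lam `]n.+1%:R^-1, n.+2%:R] g.
have wE n : char_fun (nu_ n.+1%:R^-1 n.+2%:R) y = cexp (w n).
  rewrite nu_E ?invr_gt0//; last first.
    by apply: (@le_lt_trans _ _ 1); rewrite ?ltr1n// invf_le1// ler1n.
  by congr (cexp (cintegral _ _ _)); apply/funext => t; rewrite mulrC.
have cRe := cvg_truncated_Rintegral iRe; have cIm := cvg_truncated_Rintegral iIm.
have h1 : \int[nu_ n.+1%:R^-1 n.+2%:R]_x cos ⟨y, x⟩ @[n --> \oo] --> \int[nu]_x cos ⟨y, x⟩.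
  apply: cvg_in_distribution_seq => // x; last exact: cos_max.
  by apply: continuous_comp; [exact: continuous_inner|exact: continuous_cos].
have h2 : \int[nu_ n.+1%:R^-1 n.+2%:R]_x sin ⟨y, x⟩ @[n --> \oo] --> \int[nu]_x sin ⟨y, x⟩.
  apply: cvg_in_distribution_seq => // x; last exact: sin_max.
  by apply: continuous_comp; [exact: continuous_inner|exact: continuous_sin].
have k0 : expR (complex.Re (w n)) @[n --> \oo] --> expR (complex.Re (cintegral lam D g)).
  by apply: (cvg_comp _ _ cRe); exact: continuous_expR.
have k1 : expR (complex.Re (w n)) * cos (complex.Im (w n)) @[n --> \oo] -->
    complex.Re (cexp (cintegral lam D g)).
  rewrite Re_cexp; apply: cvgM => //.
  by apply: (cvg_comp _ _ cIm); exact: continuous_cos.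
have k2 : expR (complex.Re (w n)) * sin (complex.Im (w n)) @[n --> \oo] -->
    complex.Im (cexp (cintegral lam D g)).
  rewrite Im_cexp; apply: cvgM => //.
  by apply: (cvg_comp _ _ cIm); exact: continuous_sin.
apply/eqP; rewrite eq_complex; apply/andP; split; apply/eqP.
  rewrite char_funE /=; apply: (cvg_unique _ h1) => //.
  rewrite (_ : (fun n => _) = (fun n => expR (complex.Re (w n)) * cos (complex.Im (w n)))) //.
  by apply/funext => n; rewrite -Re_cexp -wE char_funE.
rewrite char_funE /=; apply: (cvg_unique _ h2) => //.
rewrite (_ : (fun n => _) = (fun n => expR (complex.Re (w n)) * sin (complex.Im (w n)))) //.
by apply/funext => n; rewrite -Im_cexp -wE char_funE.
Qed.

End random_integrals.

Section laplace_of_exponent.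
Context {R : realType} {H : separableHilbertType R} (alpha : R).
Local Notation lam := (@lebesgue_measure R).
Local Notation D := (`]0, +oo[%classic : set R).

Lemma laplace_scaling (u : R -> R) (s : R) : 0 < s -> continuous u ->
  lam.-integrable D (EFin \o (fun t => u (s^-1 * t) * rho alpha t)) ->
  let g x := expR (- s * x) * (u x * x `^ (- alpha - 1)) in
  lam.-integrable D (EFin \o g) /\
  \int[lam]_(x in D) g x =
    s `^ alpha * \int[lam]_(t in D) (u (s^-1 * t) * rho alpha t).
Proof.
move=> s0 cu iu g.
have mG : measurable_fun setT (fun t => u (s^-1 * t) * rho alpha t).
  apply: measurable_funM; last exact: measurable_rho.
  apply: (measurableT_comp (f := u)).
    exact: continuous_measurable_fun.
  by apply: measurable_funM.
have [i1 ->] := Rintegral_scale s0 mG iu.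
have mD := @measurable_pos R.
(* Rescaling the density costs s^(alpha + 1); the Jacobian of t = s x accounts for one factor s,
   which leaves s^alpha. *)
have sE x : D x -> g x = s `^ (alpha + 1) * (u (s^-1 * (s * x)) * rho alpha (s * x)).
  rewrite /= in_itv/= andbT => x0.
  rewrite mulKf ?gt_eqF// /rho powRM ?(ltW s0)// ?(ltW x0)//.
  rewrite (_ : - alpha - 1 = - (alpha + 1)); last by rewrite opprD.
  rewrite (powRN s) /g mulNr (_ : - alpha - 1 = - (alpha + 1)); last by rewrite opprD.
  have : s `^ (alpha + 1) != 0 by rewrite gt_eqF// powR_gt0.
  by move=> ?; field.
split.
  apply: (eq_integrable mD (EFin \o (fun x => s `^ (alpha + 1) * (u (s^-1 * (s * x)) * rho alpha (s * x))))).
    by move=> x /set_mem xD; rewrite /= -sE.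
  exact: (integrableRZ _ mD i1).
rewrite (@eq_Rintegral _ _ _ lam D (fun x => s `^ (alpha + 1) * (u (s^-1 * (s * x)) * rho alpha (s * x)))); last first.
  by move=> x /set_mem xD; rewrite -sE.
rewrite RintegralZl// powRD ?powRr1 ?(ltW s0)// ?mulrA//.
by rewrite (gt_eqF s0) implybT.
Qed.

Lemma is_inverse_laplace_exponent (psi G : H -> R[i]) y :
  continuous (fun t : R => complex.Re (psi (t *: y))) ->
  continuous (fun t : R => complex.Im (psi (t *: y))) ->
  (forall z, cintegrable lam D (fun t => psi (t *: z) * (rho alpha t)%:C) /\
    G z = cintegral lam D (fun t => psi (t *: z) * (rho alpha t)%:C)) ->
  is_inverse_laplace (fun s => (s `^ alpha)%:C * G (s^-1 *: y))
    (fun x => psi (x *: y) * (x `^ (- alpha - 1))%:C).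
Proof.
move=> cRe cIm psiG.
split.
- move=> x; rewrite in_itv/= andbT => x0.
  rewrite (_ : (fun _ => _) = fun x : R => complex.Re (psi (x *: y)) * x `^ (- alpha - 1)).
    by apply: cvgM; [exact: cRe|exact: continuous_powR_gt0].
  by apply/funext => z; rewrite Re_mul_real.
- move=> x; rewrite in_itv/= andbT => x0.
  rewrite (_ : (fun _ => _) = fun x : R => complex.Im (psi (x *: y)) * x `^ (- alpha - 1)).
    by apply: cvgM; [exact: cIm|exact: continuous_powR_gt0].
  by apply/funext => z; rewrite Im_mul_real.
move=> s s0 g; have [[iRe iIm] ->] := psiG (s^-1 *: y).
have E t : t *: (s^-1 *: y) = (s^-1 * t) *: y by rewrite scalerA mulrC.
have ReE : (fun t : R => complex.Re (psi (t *: (s^-1 *: y)) * (rho alpha t)%:C)) =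
    fun t => complex.Re (psi ((s^-1 * t) *: y)) * rho alpha t.
  by apply/funext => t; rewrite Re_mul_real E.
have ImE : (fun t : R => complex.Im (psi (t *: (s^-1 *: y)) * (rho alpha t)%:C)) =
    fun t => complex.Im (psi ((s^-1 * t) *: y)) * rho alpha t.
  by apply/funext => t; rewrite Im_mul_real E.
have gE x : g x = (psi (x *: y)) * (expR (- s * x) * x `^ (- alpha - 1))%:C.
  by rewrite /g rmorphM/= mulrCA.
have RegE : (fun x => complex.Re (g x)) =
    fun x => expR (- s * x) * (complex.Re (psi (x *: y)) * x `^ (- alpha - 1)).
  by apply/funext => t; rewrite gE Re_mul_real mulrCA.
have ImgE : (fun x => complex.Im (g x)) =
    fun x => expR (- s * x) * (complex.Im (psi (x *: y)) * x `^ (- alpha - 1)).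
  by apply/funext => t; rewrite gE Im_mul_real mulrCA.
rewrite ReE in iRe; rewrite ImE in iIm.
have [i1 e1] := laplace_scaling s0 cRe iRe.
have [i2 e2] := laplace_scaling s0 cIm iIm.
rewrite /cintegrable /cintegral RegE ImgE ReE ImE e1 e2; split=> //.
by rewrite [RHS]mulrC; apply/eqP; rewrite eq_complex Re_mul_real Im_mul_real/= ![_ * s `^ _]mulrC !eqxx.
Qed.

End laplace_of_exponent.

Section mapping.
Context {R : realType} {H : separableHilbertType R} (alpha : R).
Hypotheses (alpha_gt0 : 0 < alpha) (alpha_lt1 : alpha < 1).
Local Notation law := (probability (borel H) R).
Local Notation conv := Defs.conv.
Local Notation lam := (@lebesgue_measure R).
Local Notation D := (`]0, +oo[%classic : set R).
Local Notation K_integrand mu y :=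
  (fun t : R => log_char_fun mu (t *: y) * (rho alpha t)%:C).
Local Notation K_laplace nu y :=
  (fun s : R => (s `^ alpha)%:C * log_char_fun nu (s^-1 *: y)).
Implicit Types (mu nu : law) (y : H).

(** The formula for [char_fun nu] is assumed conditionally on integrability, which
    [exponent_mixture] supplies; the lemma then serves both for a given process and for the
    mapping. *)
Lemma log_char_fun_random_integral mu nu : ID alpha mu ->
  (forall y, cintegrable lam D (K_integrand mu y) ->
    char_fun nu y = cexp (cintegral lam D (K_integrand mu y))) ->
  (exists a S M, has_triplet nu a S M) /\
  forall y, [/\ cintegrable lam D (K_integrand mu y),
    log_char_fun nu y = cintegral lam D (K_integrand mu y),
    is_inverse_laplace (K_laplace nu y) (inverse_laplace (K_laplace nu y)) &
    log_char_fun mu y = inverse_laplace (K_laplace nu y) 1].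
Proof.
move=> [_ [a [S [M [tmu momM]]]]].
have [gS lM _] := tmu; rewrite (log_char_funE tmu) => nuE.
have [a' [S' [M' [gS' lM' LK']]]] := exponent_mixture alpha_gt0 alpha_lt1 a gS lM momM.
(* Without a triplet for [nu], [log_char_fun nu] would be the default 0. *)
have tnu : has_triplet nu a' S' M'.
  by split=> // y; have [i ->] := LK' y; exact: nuE.
split; first by exists a', S', M'.
move=> y; rewrite (log_char_funE tnu); have [i e] := LK' y.
have [cRe cIm _] := levy_khintchine_ray a y gS lM.
have [h1 h2] := inverse_laplaceP (is_inverse_laplace_exponent cRe cIm LK').
by split=> //; rewrite h2// powR1 scale1r mulr1.
Qed.

Lemma char_fun_ID mu y : ID alpha mu -> char_fun mu y = cexp (log_char_fun mu y).
Proof. by move=> [_ [a [S [M [tmu _]]]]]; rewrite (log_char_funE tmu); case: tmu. Qed.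

Lemma random_integral_mappingP mu nu : ID alpha mu ->
  random_integral_mapping alpha mu nu ->
  forall y, [/\ cintegrable lam D (K_integrand mu y),
    char_fun nu y = cexp (cintegral lam D (K_integrand mu y)) &
    log_char_fun mu y = inverse_laplace (K_laplace nu y) 1].
Proof.
move=> IDmu [d [T [P [Y [_ Ymu Inu]]]]] y.
have nuE z : cintegrable lam D (K_integrand mu z) ->
    char_fun nu z = cexp (cintegral lam D (K_integrand mu z)).
  rewrite -(log_char_fun_equiv (char_fun_equiv Ymu)).
  exact: char_fun_random_integral.
have [_ /(_ y)[i _ _ e]] := log_char_fun_random_integral IDmu nuE.
by split=> //; exact: nuE.
Qed.

Lemma random_integral_mapping_equiv mu nu1 nu2 : nu1 ≡μ nu2 ->
  random_integral_mapping alpha mu nu1 -> random_integral_mapping alpha mu nu2.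
Proof.
move=> e [d [T [P [Y [lY Ymu [nu_ [nuE nuc]]]]]]].
exists d, T, P, Y; split=> //; exists nu_; split=> // f cf bf.
by rewrite -(eq_law_Rintegral _ e); exact: nuc.
Qed.

Lemma random_integral_mapping_compat mu1 mu2 nu1 nu2 :
  ID alpha mu1 -> ID alpha mu2 ->
  random_integral_mapping alpha mu1 nu1 ->
  random_integral_mapping alpha mu2 nu2 ->
  mu1 ≡μ mu2 -> nu1 ≡μ nu2.
Proof.
move=> I1 I2 K1 K2 e; apply: char_fun_inj => y.
have [_ -> _] := random_integral_mappingP I1 K1 y.
have [_ -> _] := random_integral_mappingP I2 K2 y.
by rewrite (log_char_fun_equiv (char_fun_equiv e)).
Qed.

(** The inversion formula recovers the exponent of the source from that of the image, and the
    exponent determines the law. *)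
Lemma random_integral_mapping_inj mu1 mu2 nu1 nu2 :
  ID alpha mu1 -> ID alpha mu2 ->
  random_integral_mapping alpha mu1 nu1 ->
  random_integral_mapping alpha mu2 nu2 ->
  nu1 ≡μ nu2 -> mu1 ≡μ mu2.
Proof.
move=> I1 I2 K1 K2 e; apply: char_fun_inj => y; rewrite !char_fun_ID//.
have [_ _ ->] := random_integral_mappingP I1 K1 y.
have [_ _ ->] := random_integral_mappingP I2 K2 y.
by rewrite (log_char_fun_equiv (char_fun_equiv e)).
Qed.

Lemma random_integral_mapping_conv mu1 mu2 nu1 nu2 nu :
  ID alpha mu1 -> ID alpha mu2 ->
  random_integral_mapping alpha mu1 nu1 ->
  random_integral_mapping alpha mu2 nu2 ->
  random_integral_mapping alpha (conv mu1 mu2) nu -> nu ≡μ conv nu1 nu2.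
Proof.
move=> I1 I2 K1 K2 K; apply: char_fun_inj => y; rewrite char_fun_conv.
have [_ -> _] := random_integral_mappingP (ID_conv I1 I2) K y.
have [[re1 im1] -> _] := random_integral_mappingP I1 K1 y.
have [[re2 im2] -> _] := random_integral_mappingP I2 K2 y.
have mD := @measurable_pos R.
rewrite -cexpD; congr cexp; rewrite /cintegral.
rewrite [RHS](_ : _ = (complex.Re (cintegral lam D (K_integrand mu1 y)) +
  complex.Re (cintegral lam D (K_integrand mu2 y))) +i*
  (complex.Im (cintegral lam D (K_integrand mu1 y)) +
  complex.Im (cintegral lam D (K_integrand mu2 y))))//= .
rewrite -(RintegralD mD re1 re2) -(RintegralD mD im1 im2).
congr (_ +i* _); apply: eq_Rintegral => t _.
  by rewrite (log_char_fun_conv _ I1 I2) mulrDl raddfD.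
by rewrite (log_char_fun_conv _ I1 I2) mulrDl raddfD.
Qed.

Lemma random_integral_mapping_isomorphism (K : law -> law) :
  (forall mu, ID alpha mu -> random_integral_mapping alpha mu (K mu)) ->
  exists Kinv : law -> law, conv_isomorphism (ID alpha) (TS alpha) K Kinv /\
    forall nu, TS alpha nu -> forall y,
      char_fun (Kinv nu) y = cexp (inverse_laplace (K_laplace nu y) 1).
Proof.
move=> KE.
(* Some preimage in ID_alpha; the default value occurs only outside TS_alpha. *)
pose Kinv nu := xget nu
  [set mu | ID alpha mu /\ random_integral_mapping alpha mu nu].
have KinvE nu : TS alpha nu ->
    ID alpha (Kinv nu) /\ random_integral_mapping alpha (Kinv nu) nu.
  move=> [mu Imu Kmu]; rewrite /Kinv; case: xgetP => [? _ //|/(_ mu) []].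
  by split.
have Kconv mu1 mu2 : ID alpha mu1 -> ID alpha mu2 ->
    K (conv mu1 mu2) ≡μ conv (K mu1) (K mu2).
  move=> I1 I2; apply: (random_integral_mapping_conv I1 I2); apply: KE => //.
  exact: ID_conv.
have TSK mu : ID alpha mu -> TS alpha (K mu) by move=> I; exists mu => //; exact: KE.
exists Kinv; split; last first.
  move=> nu /KinvE[I k] y; rewrite char_fun_ID//.
  by have [_ _ ->] := random_integral_mappingP I k y.
split=> //.
- exact: ID_conv.
- move=> nu1 nu2 [mu1 I1 k1] [mu2 I2 k2]; exists (conv mu1 mu2); first exact: ID_conv.
  (* [K (conv mu1 mu2)] equals [conv nu1 nu2] only up to [≡μ], under which the graph of the mapping
     is stable in its second argument. *)
  have I := ID_conv I1 I2; apply: random_integral_mapping_equiv (KE _ I).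
  exact: random_integral_mapping_conv I1 I2 k1 k2 (KE _ I).
- by move=> nu /KinvE[].
- by move=> mu1 mu2 I1 I2; apply: random_integral_mapping_compat => //; exact: KE.
- move=> nu1 nu2 /KinvE[I1 k1] /KinvE[I2 k2].
  exact: (random_integral_mapping_inj I1 I2 k1 k2).
- move=> mu Imu; have [I k] := KinvE _ (TSK _ Imu).
  by apply: (random_integral_mapping_inj I Imu k (KE _ Imu)).
- move=> nu /KinvE[I k].
  by apply: (random_integral_mapping_compat I I (KE _ I) k).
Qed.

End mapping.

Theorem proposition4 (R : realType) (H : separableHilbertType R) (alpha : R)
    (alpha_gt0 : 0 < alpha) (alpha_lt1 : alpha < 1) :
  (* Lévy exponent of the random integral, and its inversion; [nu] is the law of
     the random integral of the Lévy process Y *)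
  (forall (d : measure_display) (Omega : measurableType d)
      (P : probability Omega R) (Y : R -> {RV P >-> borel H})
      (nu : probability (borel H) R),
    levy_process Y ->
    ID alpha (distribution P (Y 1)) ->
    law_random_integral alpha Y nu ->
    (exists a S M, has_triplet nu a S M) /\
    forall y : H,
      let F s := (s `^ alpha)%:C * log_char_fun nu (s^-1 *: y) in
      [/\ cintegrable lebesgue_measure `]0, +oo[ (fun t : R =>
            log_char_fun (distribution P (Y 1)) (t *: y) *
            (t `^ (- alpha - 1) * expR (- t))%:C),
          log_char_fun nu y =
          cintegral lebesgue_measure `]0, +oo[ (fun t : R =>
            log_char_fun (distribution P (Y 1)) (t *: y) *
            (t `^ (- alpha - 1) * expR (- t))%:C),
          is_inverse_laplace F (inverse_laplace F) &
          log_char_fun (distribution P (Y 1)) y = inverse_laplace F 1]) /\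
  (* [K] is the random integral mapping on ID_alpha *)
  (forall K : probability (borel H) R -> probability (borel H) R,
    (forall mu, ID alpha mu -> random_integral_mapping alpha mu (K mu)) ->
    exists Kinv : probability (borel H) R -> probability (borel H) R,
      conv_isomorphism (ID alpha) (TS alpha) K Kinv /\
      forall nu, TS alpha nu -> forall y : H,
        char_fun (Kinv nu) y =
        cexp (inverse_laplace
          (fun s : R => (s `^ alpha)%:C * log_char_fun nu (s^-1 *: y)) 1)).
Proof.
split; last exact: random_integral_mapping_isomorphism.
move=> d Omega P Y nu _ IDY Inu.
apply: (log_char_fun_random_integral alpha_gt0 alpha_lt1 IDY) => y.
exact: char_fun_random_integral Inu.
Qed.
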